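(* Let $\mu>4\pi$. If $f\in A^2(\overline{\mathcal{W}'_\mu})$, then $f$ admits a holomorphic extension to the domain $$\widehat{\mathcal{W}}'_\mu:=\mathcal{W}'_\mu\cup\bigcup_{-\frac\mu2<a<\frac\mu2-2\pi}\big\{(z_1,z_2,z_3)\in\mathbb{C}^3:\ |z_1-e^{2ia}|<1,\ a<\log|z_j|^2<a+2\pi\text{ for }j\in\{2,3\}\big\}.$$ As a consequence, $A^2(\overline{\mathcal{W}'_\mu})\subsetneq A^2(\mathcal{W}'_\mu)$. The same conclusions hold true with any $\Omega\in\mathscr{C}_\mu$ in place of $\mathcal{W}'_\mu$: every $f\in A^2(\overline{\Omega})$ admits a holomorphic extension to $$\widehat{\Omega}:=\Omega\cup\bigcup_{-\frac\mu2<a<\frac\mu2-2\pi}\big\{(z_1,z_2,z_3)\in\mathbb{C}^3:\ |z_1-e^{2ia}|<1,\ a<\log|z_j|^2<a+2\pi\text{ for }j\in\{2,3\}\big\},$$ and $A^2(\overline{\Omega})\subsetneq A^2(\Omega)$.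
   Context: $\mathbb{C}^*:=\mathbb{C}\setminus\{0\}$. For a domain $\Omega\subset\mathbb{C}^3$, $A^2(\Omega)$ is the Bergman space of holomorphic functions on $\Omega$ that are square-integrable with respect to Lebesgue measure, and $A^2(\overline{\Omega})$ is the closure within $A^2(\Omega)$ of the subspace of those elements of $A^2(\Omega)$ that extend to holomorphic functions on neighborhoods of $\overline{\Omega}$. $\mathcal{W}'_\mu=\{(z_1,z_2,z_3)\in\mathbb{C}\times\mathbb{C}^*\times\mathbb{C}^*:\ |z_1-e^{i\log|z_2z_3|^2}|<1,\ -\mu<\log|z_j|^2<\mu\text{ for }j\in\{2,3\}\}$. Definition of the class $\mathscr{C}_\mu$. Let $\eta:\mathbb{R}^2\to[0,+\infty)$, $(t_2,t_3)\mapsto\eta(t_2,t_3)$, be upper semicontinuous, with $\eta^{-1}(0)\supseteq(-\mu,\mu)\times(-\mu,\mu)$ and with $\eta^{-1}([0,1))$ path-connected, and set $$\mathcal{W}_\eta=\left\{(z_1,z_2,z_3)\in\mathbb{C}\times\mathbb{C}^*\times\mathbb{C}^*:\ \left|z_1-e^{i\log|z_2z_3|^2}\right|^2<1-\eta(\log|z_2|^2,\log|z_3|^2)\right\}.$$ For $z\in\mathbb{C}\times\mathbb{C}^*\times\mathbb{C}^*$ write $\eta^\circ(z)=\eta(\log|z_2|^2,\log|z_3|^2)$, $\eta'_j(z)=\frac{\partial\eta}{\partial t_j}(\log|z_2|^2,\log|z_3|^2)$, $\eta''_{jk}(z)=\frac{\partial^2\eta}{\partial t_j\partial t_k}(\log|z_2|^2,\log|z_3|^2)$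 for $j,k\in\{2,3\}$. The class $\mathscr{C}_\mu$ consists of all $\mathcal{W}_\eta$ for upper semicontinuous $\eta:\mathbb{R}^2\to[0,+\infty)$ with $\eta^{-1}(0)\supseteq(-\mu,\mu)\times(-\mu,\mu)$ and with $\eta^{-1}([0,1))$ path-connected, such that: (I) $\eta$ is smooth in an open neighborhood of $\eta^{-1}([0,1])$; (II) the gradient of $\eta$ does not vanish at any point of $\eta^{-1}(1)$; (III) $\eta^{-1}([0,1])$ is a bounded subset of $\mathbb{R}^2$; and near $\partial\mathcal{W}_\eta$ the inequalities $$\eta^\circ+\eta''_{22}\geq0,\qquad \eta''_{22}\eta''_{33}-(\eta''_{23})^2+\eta^\circ(\eta''_{22}+\eta''_{33}-2\eta''_{23})-(\eta'_2-\eta'_3)^2\geq0$$ hold. (These are the smoothly bounded pseudoconvex worm domains of the paper.) *)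

(* Defs.v *)
From HB Require Import structures.
From mathcomp Require Import all_boot all_order all_algebra.
From mathcomp Require Import complex.
From mathcomp Require Import all_classical all_reals all_analysis.

Set Implicit Arguments.
Unset Strict Implicit.
Unset Printing Implicit Defensive.

Import Order.TTheory GRing.Theory Num.Theory.
Import numFieldNormedType.Exports.
Import complex.ComplexField.Normc.

Local Open Scope classical_set_scope.
Local Open Scope ring_scope.

(* The complex numbers over R, with the normed-field topology that
   MathComp-Analysis attaches to any numFieldType. *)
Definition CC (R : realType) : numFieldType := R[i].

Definition CC3 (R : realType) : normedModType (CC R) := (CC R * CC R * CC R)%type.

Section worm.
Variable R : realType.
Implicit Types (Omega U : set (CC3 R)) (f g : CC3 R -> CC R) (z : CC3 R).

Definition z1 z : CC R := z.1.1.
Definition z2 z : CC R := z.1.2.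
Definition z3 z : CC R := z.2.

Definition expi (theta : R) : CC R := Complex (cos theta) (sin theta).

(* log |w|^2; only meaningful for w != 0, because ln 0 = 0 in the library. *)
Definition logsq (w : CC R) : R := ln (normc w ^+ 2).

Definition CxCsxCs : set (CC3 R) := [set z | z2 z != 0 /\ z3 z != 0].

(* Complex (Frechet) differentiability over CC R at every point of U; it is
   only used with U open, where it depends only on the restriction of f to U. *)
Definition holomorphic_on U f := forall z, U z -> differentiable f z.

Definition holomorphically_extends Omega f U :=
  exists F : CC3 R -> CC R, holomorphic_on U F /\ (forall z, Omega z -> F z = f z).

Local Notation Rm := (measurableTypeR R).
Definition R6 : Type := (Rm * Rm * Rm * Rm * Rm * Rm)%type.

Definition leb6 : {measure set _ -> \bar R} :=
  let l := @lebesgue_measure R in (l \x l \x l \x l \x l \x l)%E.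

Definition R6_to_CC3 (p : R6) : CC3 R :=
  let: (x1, y1, x2, y2, x3, y3) := p in
  (Complex x1 y1, Complex x2 y2, Complex x3 y3).

Definition normsq6 f (p : R6) : \bar R := (normc (f (R6_to_CC3 p)) ^+ 2)%:E.

Definition L2norm Omega f : \bar R :=
  ((\int[leb6]_(p in R6_to_CC3 @^-1` Omega) normsq6 f p) `^ 2^-1)%E.

(* Functions on Omega are represented by total functions; membership in the
   two spaces below depends only on the restriction to (the open set) Omega. *)
Definition A2 Omega : set (CC3 R -> CC R) :=
  [set f | holomorphic_on Omega f /\
           leb6.-integrable (R6_to_CC3 @^-1` Omega) (normsq6 f)].

Definition extends_past_closure Omega f :=
  exists U, [/\ open U, closure Omega `<=` U & holomorphically_extends Omega f U].

Definition A2bar Omega : set (CC3 R -> CC R) :=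
  [set f | A2 Omega f /\
     forall eps : R, 0 < eps -> exists g,
       [/\ A2 Omega g, extends_past_closure Omega g &
           (L2norm Omega (f \- g)%R < eps%:E)%E]].

Definition Wprime (mu : R) : set (CC3 R) :=
  [set z | [/\ CxCsxCs z,
     normc (z1 z - expi (logsq (z2 z * z3 z))) < 1,
     - mu < logsq (z2 z) < mu & - mu < logsq (z3 z) < mu]].

(* With log 0 = -oo the conditions a < log |z_j|^2 exclude z_j = 0, whence the
   explicit CxCsxCs. *)
Definition extra_block (a : R) : set (CC3 R) :=
  [set z | [/\ CxCsxCs z,
     normc (z1 z - expi (2 * a)) < 1,
     a < logsq (z2 z) < a + 2 * pi & a < logsq (z3 z) < a + 2 * pi]].

Definition hat (mu : R) Omega : set (CC3 R) :=
  Omega `|`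
  \bigcup_(a in [set a | - (mu / 2) < a < mu / 2 - 2 * pi]) extra_block a.

Implicit Types (eta : R * R -> R) (t : R * R).

Definition upper_semicontinuous eta :=
  lower_semicontinuous (fun t => (- eta t)%:E).

Definition path_connected (A : set (R * R)) :=
  forall x y, A x -> A y -> exists gamma : R -> R * R,
    [/\ {within `[0, 1], continuous gamma}, gamma 0 = x, gamma 1 = y &
        gamma @` `[0, 1] `<=` A].

Definition e2 : R * R := (1, 0).
Definition e3 : R * R := (0, 1).

Fixpoint Ck_on (k : nat) (N : set (R * R)) eta : Prop :=
  (forall t, N t -> {for t, continuous eta}) /\
  if k is k'.+1 then
    forall v, v = e2 \/ v = e3 ->
      (forall t, N t -> derivable eta t v) /\ Ck_on k' N ('D_v eta)
  else True.

Definition smooth_on (N : set (R * R)) eta := forall k, Ck_on k N eta.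

Definition Weta eta : set (CC3 R) :=
  [set z | CxCsxCs z /\
     normc (z1 z - expi (logsq (z2 z * z3 z))) ^+ 2
       < 1 - eta (logsq (z2 z), logsq (z3 z))].

Definition boundary (A : set (CC3 R)) := closure A `\` interior A.

Definition worm_ineqs eta t :=
  let d v := 'D_v eta t in
  let dd v w := 'D_w ('D_v eta) t in
  0 <= eta t + dd e2 e2 /\
  0 <= dd e2 e2 * dd e3 e3 - (dd e2 e3) ^+ 2
       + eta t * (dd e2 e2 + dd e3 e3 - 2 * dd e2 e3)
       - (d e2 - d e3) ^+ 2.

(* The last clause puts no smoothness requirement on U: when {eta <= 1} is
   closed, shrinking U places it over the neighbourhood N where eta is smooth. *)
Definition admissible (mu : R) eta :=
  (forall t, 0 <= eta t) /\
  upper_semicontinuous eta /\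
  (forall t, - mu < t.1 < mu -> - mu < t.2 < mu -> eta t = 0) /\
  path_connected [set t | 0 <= eta t < 1] /\
  (exists N, [/\ open N, [set t | 0 <= eta t <= 1] `<=` N & smooth_on N eta]) /\
  (forall t, eta t = 1 -> ('D_e2 eta t, 'D_e3 eta t) != (0, 0)) /\
  bounded_set [set t | 0 <= eta t <= 1] /\
  (exists U, [/\ open U, boundary (Weta eta) `<=` U &
     forall z, U z -> CxCsxCs z -> worm_ineqs eta (logsq (z2 z), logsq (z3 z))]).

Definition class_C (mu : R) : set (set (CC3 R)) :=
  [set Weta eta | eta in admissible mu].

End worm.

(* Main.v *)
Require Import Defs.
From HB Require Import structures.
From mathcomp Require Import all_boot all_order all_algebra.
From mathcomp Require Import complex.
From mathcomp Require Import all_classical all_reals all_analysis.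
From mathcomp Require Import measurable_realfun.
From mathcomp Require Import ring lra.

Set Implicit Arguments.
Unset Strict Implicit.
Unset Printing Implicit Defensive.

Import Order.TTheory GRing.Theory Num.Theory.
Import numFieldNormedType.Exports.
Import complex.ComplexField.Normc.

Local Open Scope classical_set_scope.
Local Open Scope ring_scope.

(** A function f in the closure of the functions holomorphic past the boundary is the limit of
such functions G_n, not only in square mean: the Bergman inequality ([bergman_inequality],
[bergman_torus]) bounds the value of a holomorphic function at a point by its square mean, and
since the domain is invariant under rotations of z2 and z3 the bound is uniform on each torus
with z1, |z2|, |z3| fixed. So G_n tends to f uniformly on tori ([A2bar_torus_limit]).

The closure of the domain contains all points (0, z2, z3) with (log |z2|^2, log |z3|^2) in the
square, because every disc |z1 - e^(is)| < 1 has the origin on its boundary. Consider the block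
of index a, where log |z2|^2 and log |z3|^2 range over (a, a + 2 pi) and z1 over the disc with
centre e^(2ia). On the four tori where each of the logarithms is a or a + 2 pi, the angle
s = log |z2 z3|^2 equals 2a modulo 2 pi, so that these tori lie in the domain for every z1 in
the disc of the block. The annular Cauchy integrals in z2 and z3 over these tori
([corner_extension]) therefore turn every f holomorphic on the domain into a holomorphic
function on the block. For G_n this function is G_n itself when z1 is close to 0, since then the
whole product of the two annuli is in the neighbourhood where G_n is holomorphic; by the
identity theorem on intersections of unit discs having the origin on their boundary
([identity_lens]), the functions built on two blocks agree on their intersection, and the one
built on a block agrees with G_n where the block meets the domain. Both agreements pass to the
limit, and the pieces glue to the extension of f ([A2bar_extends]).

The inclusion is proper because of the branch of the square root of z1 that is continued along
the turning disc ([worm_root]): it is holomorphic and bounded on a domain of finite measure. Fix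
z1 = e^(2ia) and |z3|. The root is constant on the circles log |z2|^2 = a and
log |z2|^2 = a + 2 pi, with opposite values, the centre of the disc having made a full turn in
between. For the functions G_n the means over the two circles agree: for z1 near 0 the circle
can be moved across the annulus, and the identity theorem reaches all z1 in the disc. Uniform
convergence on tori gives a contradiction ([worm_root_not_A2bar]).

The two cases of the theorem are one: the truncated domain is the worm domain with a profile
that is 0 on the square and 2 elsewhere ([Wprime_Weta]), and the argument only uses that the
profile is nonnegative, upper semicontinuous, zero on the square, with bounded sublevel set
([worm_profile]). *)

(** * Topology of the complex numbers *)

Section complex_topology.
Variable R : realType.
Notation C := (CC R).
Implicit Types (z w : C) (e : R).

(** The norm of a numerical field takes its values in the field; normc is its real form. *)
Lemma normr_normc z : `|z| = (normc z)%:C%C :> C.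
Proof. by []. Qed.

Lemma normc_ge0 z : 0 <= normc z.
Proof. by case: z => a b; exact: sqrtr_ge0. Qed.

Lemma normc_eq0 z : (normc z == 0) = (z == 0).
Proof. by apply/eqP/eqP => [/eq0_normc //|->]; rewrite normc0. Qed.

Lemma normc_gt0 z : (0 < normc z) = (z != 0).
Proof. by rewrite lt_def normc_ge0 andbT normc_eq0. Qed.

Lemma normcB z w : normc (z - w) = normc (w - z).
Proof. by rewrite -normcN opprB. Qed.

Lemma ler_normcD z w : normc (z + w) <= normc z + normc w.
Proof. exact: le_normcD. Qed.

Lemma ler_normcB z w : normc (z - w) <= normc z + normc w.
Proof. by rewrite -(normcN w); exact: le_normcD. Qed.

Lemma ler_distcD (u z w : C) : normc (z - w) <= normc (z - u) + normc (u - w).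
Proof. by rewrite -[X in normc X](_ : (z - u) + (u - w) = _) ?le_normcD// addrA subrK. Qed.

Lemma lerB_normc z w : normc z - normc w <= normc (z - w).
Proof. by rewrite lerBlDr -{1}[z](subrK w) ler_normcD. Qed.

Lemma ler_dist_normc z w : `|normc z - normc w| <= normc (z - w).
Proof. by rewrite ler_norml lerNl opprB lerB_normc andbT normcB lerB_normc. Qed.

Lemma normcX z n : normc (z ^+ n) = normc z ^+ n.
Proof. by elim: n => [|n ih]; rewrite ?expr0 ?normc1// !exprS normcM ih. Qed.

Lemma normc_real (x : R) : normc x%:C%C = `|x|.
Proof. by rewrite /normc /= expr0n /= addr0 sqrtr_sqr. Qed.

Lemma normc_Re z : `|complex.Re z| <= normc z.
Proof.
case: z => a b; rewrite /= -sqrtr_sqr ler_wsqrtr// lerDl sqr_ge0 //.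
Qed.

Lemma normc_Im z : `|complex.Im z| <= normc z.
Proof. by case: z => a b; rewrite /= -sqrtr_sqr ler_wsqrtr// lerDr sqr_ge0. Qed.

Lemma normc_le_ReIm z : normc z <= `|complex.Re z| + `|complex.Im z|.
Proof.
case: z => a b /=; rewrite -[leRHS]ger0_norm ?addr_ge0// -sqrtr_sqr ler_wsqrtr//.
rewrite sqrrD !real_normK ?num_real// -addrA lerD2l lerDr.
by rewrite mulrn_wge0// mulr_ge0.
Qed.

Lemma ltr0C e : ((0 : C) < e%:C%C) = (0 < e).
Proof. by rewrite ltcR. Qed.

Lemma ball_normcE z e w : ball z e%:C%C w = (normc (z - w) < e).
Proof. by rewrite -ball_normE /ball_ /= normr_normc ltcR. Qed.

Lemma gt0_ComplexP (e : C) : 0 < e -> exists2 r : R, 0 < r & e = r%:C%C.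
Proof.
case: e => a b; rewrite ltcE /= => /andP[/eqP -> a0]; by exists a.
Qed.

Lemma nbhs_normcP z (A : set C) :
  nbhs z A <-> exists2 e : R, 0 < e & forall w, normc (w - z) < e -> A w.
Proof.
split=> [/nbhs_ballP[e /= /gt0_ComplexP[r r0 ->] zA]|[e e0 zA]].
  by exists r => // w wz; apply: zA; rewrite ball_normcE normcB.
apply/nbhs_ballP; exists e%:C%C; first by rewrite /= ltr0C.
by move=> w; rewrite ball_normcE normcB; exact: zA.
Qed.

Lemma cvg_normcP (T : Type) (F : set_system T) {FF : Filter F} (f : T -> C) z :
  f @ F --> z <-> forall e, 0 < e -> \forall x \near F, normc (f x - z) < e.
Proof.
split=> [fz e e0|fz A /nbhs_normcP[e e0 zA]].
  by apply: (fz [set w | normc (w - z) < e]); apply/nbhs_normcP; exists e.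
by apply: filterS (fz _ e0) => x; exact: zA.
Qed.

Lemma cvg_Complex (T : Type) (F : set_system T) {FF : Filter F} (f g : T -> R) (a b : R) :
  f @ F --> a -> g @ F --> b -> (fun x => Complex (f x) (g x) : C) @ F --> (Complex a b : C).
Proof.
move=> fa gb; apply/cvg_normcP => e e0.
near=> x; apply: le_lt_trans (normc_le_ReIm _) _; rewrite /= (splitr e) ltrD//.
- by near: x; have /cvgrPdistC_lt := fa; apply; rewrite divr_gt0.
- by near: x; have /cvgrPdistC_lt := gb; apply; rewrite divr_gt0.
Unshelve. all: by end_near. Qed.

Lemma cvg_ReC (T : Type) (F : set_system T) {FF : Filter F} (f : T -> C) z :
  f @ F --> z -> (fun x => complex.Re (f x)) @ F --> (complex.Re z : R).
Proof.
move=> /cvg_normcP fz; apply/cvgrPdist_lt => e e0.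
apply: filterS (fz _ e0) => x; apply: le_lt_trans; rewrite normcB.
apply: le_trans (normc_Re _); by case: z {fz} => a b; case: (f x).
Qed.

Lemma cvg_ImC (T : Type) (F : set_system T) {FF : Filter F} (f : T -> C) z :
  f @ F --> z -> (fun x => complex.Im (f x)) @ F --> (complex.Im z : R).
Proof.
move=> /cvg_normcP fz; apply/cvgrPdist_lt => e e0.
apply: filterS (fz _ e0) => x; apply: le_lt_trans; rewrite normcB.
apply: le_trans (normc_Im _); by case: z {fz} => a b; case: (f x).
Qed.

Lemma cvg_normc (T : Type) (F : set_system T) {FF : Filter F} (f : T -> C) z :
  f @ F --> z -> (fun x => normc (f x)) @ F --> (normc z : R).
Proof.
move=> /cvg_normcP fz; apply/cvgrPdist_lt => e e0.
apply: filterS (fz _ e0) => x; apply: le_lt_trans.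
by rewrite normcB ler_dist_normc.
Qed.

Lemma cvg_real_complex (T : Type) (F : set_system T) {FF : Filter F} (f : T -> R) (a : R) :
  f @ F --> a -> (fun x => (f x)%:C%C : C) @ F --> (a%:C%C : C).
Proof. by move=> fa; apply: cvg_Complex => //; exact: cvg_cst. Qed.

(** The real and the imaginary parts are Cauchy sequences of real numbers. *)
Lemma cauchy_cvgC (u : nat -> C) :
  (forall e, 0 < e -> exists N, forall k, normc (u (N + k)%N - u N) <= e) ->
  exists l : C, u @ \oo --> l.
Proof.
move=> uc.
have crit (f : C -> R) : (forall z w, `|f z - f w| <= normc (z - w)) ->
    cvg ((fun n => f (u n)) @ \oo).
  move=> fl; apply: cauchy_cvg; apply: cauchy_exP => e e0.
  have [|N Nb] := uc (e / 2); first by rewrite divr_gt0.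
  exists (f (u N)); exists N => // n /= Nn; rewrite /ball /=.
  rewrite distrC -(subnKC Nn); apply: le_lt_trans (fl _ _) _.
  by apply: le_lt_trans (Nb _) _; lra.
have Recvg : cvg ((fun n => complex.Re (u n)) @ \oo).
  by apply: crit => -[? ?] [? ?]; exact: le_trans (normc_Re _).
have Imcvg : cvg ((fun n => complex.Im (u n)) @ \oo).
  by apply: crit => -[? ?] [? ?]; exact: le_trans (normc_Im _).
exists (Complex (limn (fun n => complex.Re (u n))) (limn (fun n => complex.Im (u n)))).
rewrite [X in X @ _](_ : u = fun n => Complex (complex.Re (u n)) (complex.Im (u n))).
  exact: cvg_Complex Recvg Imcvg.
by apply/funext => n; case: (u n).
Qed.

End complex_topology.

(** * Integrals of complex-valued functions over an interval *)

Section riemann_integral.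
Variable R : realType.
Notation C := (CC R).
Implicit Types (h k : R -> C) (a b e M : R).

Definition cont_on h a b := forall x, a <= x <= b -> {for x, continuous h}.

(** Midpoint sums along successive bisections. They converge to the Riemann integral of a
continuous function, are exact on affine functions, and at every stage split at the midpoint,
as the subdivision of rectangles in Goursat's theorem does. *)
Fixpoint midsum h n a b : C :=
  if n is n'.+1 then midsum h n' a ((a + b) / 2) + midsum h n' ((a + b) / 2) b
  else (b - a)%:C%C * h ((a + b) / 2).

Definition rint h a b : C := lim (midsum h n a b @[n --> \oo]).

Let midP a b : a <= b -> a <= (a + b) / 2 <= b.
Proof. by move=> ab; apply/andP; split; lra. Qed.

Lemma sub_cont_on h a b a' b' : cont_on h a b -> a <= a' -> b' <= b -> cont_on h a' b'.
Proof.
by move=> ch aa' bb' x /andP[ax xb]; apply: ch; rewrite (le_trans aa' ax) (le_trans xb bb').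
Qed.

Lemma midsum_eq h k n a b : a <= b -> (forall x, a <= x <= b -> h x = k x) ->
  midsum h n a b = midsum k n a b.
Proof.
elim: n a b => [|n ih] a b ab hk /=; first by rewrite hk ?midP.
have /andP[am mb] := midP ab.
rewrite !ih// => x /andP[x1 x2]; apply: hk; apply/andP; split; lra.
Qed.

Lemma midsumD h k n a b :
  midsum (fun x => h x + k x) n a b = midsum h n a b + midsum k n a b.
Proof.
by elim: n a b => [|n ih] a b /=; [rewrite mulrDr|rewrite !ih addrACA].
Qed.

Lemma midsumZ (c : C) h n a b : midsum (fun x => c * h x) n a b = c * midsum h n a b.
Proof. by elim: n a b => [|n ih] a b /=; [rewrite mulrCA|rewrite !ih mulrDr]. Qed.

Lemma midsum_affine (c d : C) n a b :
  midsum (fun x => c + d * x%:C%C) n a b = (b - a)%:C%C * (c + d * ((a + b) / 2)%:C%C).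
Proof.
elim: n a b => [//|n ih] a b /=; rewrite !ih.
set m := (a + b) / 2; pose t := (b - a) / 4.
have -> : m - a = t *+ 2 by rewrite /m /t mulr2n; field.
have -> : b - m = t *+ 2 by rewrite /m /t mulr2n; field.
have -> : b - a = t *+ 4 by rewrite /m /t; field.
have -> : (a + m) / 2 = m - t by rewrite /m /t; field.
have -> : (m + b) / 2 = m + t by rewrite /m /t; field.
by rewrite !(rmorphB, rmorphD, rmorphMn) /=; ring.
Qed.

Lemma le_midsum h n a b M : a <= b -> (forall x, a <= x <= b -> normc (h x) <= M) ->
  normc (midsum h n a b) <= (b - a) * M.
Proof.
elim: n a b => [|n ih] a b ab hM /=.
  by rewrite normcM normc_real ger0_norm ?subr_ge0// ler_wpM2l ?subr_ge0// hM// midP.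
have /andP[am mb] := midP ab.
apply: le_trans (ler_normcD _ _) _.
rewrite [leRHS](_ : _ = ((a + b) / 2 - a) * M + (b - (a + b) / 2) * M); last by ring.
by apply: lerD; apply: ih => // x /andP[x1 x2]; apply: hM; apply/andP; split; lra.
Qed.

(** The sums at successive depths differ by at most the oscillation of the
function at the scale of the coarser bisection. *)
Lemma midsum_osc h n (k : nat) a b d e : a <= b -> (b - a) / 2 ^+ n <= d ->
  (forall x y, a <= x <= b -> a <= y <= b -> `|x - y| <= d -> normc (h x - h y) <= e) ->
  normc (midsum h (n + k) a b - midsum h n a b) <= (b - a) * e.
Proof.
elim: n a b => [|n ih] a b ab bad hd.
  rewrite add0n /= -[_ * h _](_ : midsum (fun=> h ((a + b) / 2)) k a b = _); last first.
    have -> : (fun=> h ((a + b) / 2)) = (fun x : R => h ((a + b) / 2) + 0 * x%:C%C).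
      by apply/funext => x; rewrite mul0r addr0.
    by rewrite midsum_affine mul0r addr0.
  rewrite -mulN1r -midsumZ -midsumD.
  apply: le_midsum => // x axb; rewrite mulN1r; apply: hd => //; first exact: midP.
  rewrite expr0 divr1 in bad; apply: le_trans bad.
  by move: axb => /andP[ax xb]; rewrite ler_norml; apply/andP; split; lra.
have /andP[am mb] := midP ab.
rewrite addSn /= opprD addrACA; apply: le_trans (ler_normcD _ _) _.
rewrite [leRHS](_ : _ = ((a + b) / 2 - a) * e + (b - (a + b) / 2) * e); last by ring.
apply: lerD; apply: ih => //.
- apply: le_trans bad; rewrite exprS invfM mulrA ler_wpM2r ?invr_ge0 ?exprn_ge0//; lra.
- move=> x y /andP[x1 x2] /andP[y1 y2]; apply: hd; apply/andP; split; lra.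
- apply: le_trans bad; rewrite exprS invfM mulrA ler_wpM2r ?invr_ge0 ?exprn_ge0//; lra.
- move=> x y /andP[x1 x2] /andP[y1 y2]; apply: hd; apply/andP; split; lra.
Qed.

Lemma unif_cont_on h a b e : cont_on h a b -> 0 < e -> exists2 d, 0 < d &
  forall x y, a <= x <= b -> a <= y <= b -> `|x - y| <= d -> normc (h x - h y) <= e.
Proof.
move=> ch e0.
have := @segment_compact R a b; rewrite compact_near_coveringP => /(_ _ (0^'+)
  (fun d x => forall y, `|x - y| <= d -> normc (h x - h y) <= e)).
move=> /(_ _)[].
  move=> x; rewrite /= in_itv /= => axb.
  have /cvg_normcP /(_ (e / 2)) := ch x axb; rewrite divr_gt0// => /(_ isT).
  move=> /nbhs_ballP[r /= r0 xr].
  exists (ball x (r / 2), [set d | d < r / 2]).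
    split; first by apply: nbhsx_ballx; rewrite divr_gt0.
    by apply: nbhs_right_lt; rewrite divr_gt0.
  move=> [x' d] [/= xx' dr] y x'y.
  apply: le_trans (ler_distcD (h x) _ _) _; rewrite (splitr e); apply: lerD.
    by apply/ltW/xr; apply: le_ball xx'; lra.
  rewrite normcB; apply/ltW/xr; rewrite (splitr r); apply: ball_triangle xx' _.
  by rewrite /ball /=; exact: le_lt_trans x'y dr.
move=> d0 /= dd0 H.
exists (d0 / 2); first by rewrite divr_gt0.
move=> x y axb ayb xyd; apply: (H (d0 / 2)) => //=.
- by rewrite sub0r normrN gtr0_norm ?divr_gt0//; lra.
- by rewrite divr_gt0.
Qed.

Lemma midsum_cvg h a b : a <= b -> cont_on h a b ->
  midsum h n a b @[n --> \oo] --> rint h a b.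
Proof.
move=> ab ch.
suff [l hl] : exists l : C, midsum h n a b @[n --> \oo] --> l.
  by rewrite /rint; apply: (cvgP l).
apply: cauchy_cvgC => e e0.
pose e' := e / (b - a + 1) / 2.
have ba1 : 0 < b - a + 1 by rewrite ltr_pwDr// subr_ge0.
have e'0 : 0 < e' by rewrite !divr_gt0.
have [d d0 hd] := unif_cont_on ch e'0.
have [N Nd] : exists N, (b - a) / 2 ^+ N <= d.
  have /cvgrPdist_lt/(_ _ d0)[N _ /(_ N)] :
      (b - a) * 2^-1 ^+ n @[n --> \oo] --> (b - a) * 0.
    by apply: cvgM; [exact: cvg_cst|apply: cvg_expr; rewrite ger0_norm ?invr_ge0// invf_lt1// ltr1n].
  rewrite /= leqnn mulr0 sub0r normrN exprVn => /(_ isT) Nd.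
  by exists N; apply/ltW: (le_lt_trans (ler_norm _) Nd).
exists N => k; apply: le_trans (midsum_osc _ ab Nd hd) _.
have -> : e = e' * 2 * (b - a + 1) by rewrite /e'; field; rewrite gt_eqF.
nra.
Qed.

Lemma rintP h a b l : a <= b -> midsum h n a b @[n --> \oo] --> l -> rint h a b = l.
Proof. by move=> ab /cvg_lim; apply; exact: norm_hausdorff. Qed.

Lemma rint_eq h k a b : a <= b -> (forall x, a <= x <= b -> h x = k x) ->
  rint h a b = rint k a b.
Proof.
move=> ab hk; rewrite /rint; congr (lim (_ @ \oo)).
by apply/funext => n; exact: midsum_eq.
Qed.

Lemma rintD h k a b : a <= b -> cont_on h a b -> cont_on k a b ->
  rint (fun x => h x + k x) a b = rint h a b + rint k a b.
Proof.
move=> ab ch ck; apply: rintP => //.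
by under eq_fun do rewrite midsumD; apply: cvgD; exact: midsum_cvg.
Qed.

Lemma rintZ (c : C) h a b : a <= b -> cont_on h a b ->
  rint (fun x => c * h x) a b = c * rint h a b.
Proof.
move=> ab ch; apply: rintP => //.
by under eq_fun do rewrite midsumZ; apply: cvgM; [exact: cvg_cst|exact: midsum_cvg].
Qed.

Lemma rintN h a b : a <= b -> cont_on h a b ->
  rint (fun x => - h x) a b = - rint h a b.
Proof.
by move=> ab ch; rewrite -mulN1r -rintZ//; apply: rint_eq => // x _; rewrite mulN1r.
Qed.

Lemma rintB h k a b : a <= b -> cont_on h a b -> cont_on k a b ->
  rint (fun x => h x - k x) a b = rint h a b - rint k a b.
Proof.
move=> ab ch ck.
have ckN : cont_on (fun x => - k x) a b by move=> x axb; apply: cvgN; exact: ck.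
by rewrite (rintD ab ch ckN) rintN.
Qed.

Lemma rint_affine (c d : C) a b : a <= b ->
  rint (fun x => c + d * x%:C%C) a b = (b - a)%:C%C * (c + d * ((a + b) / 2)%:C%C).
Proof.
move=> ab; apply: rintP => //.
by under eq_fun do rewrite midsum_affine; exact: cvg_cst.
Qed.

Lemma rint_cst (c : C) a b : a <= b -> rint (fun=> c) a b = (b - a)%:C%C * c.
Proof.
move=> ab; have := rint_affine c 0 ab; rewrite mul0r addr0 => <-.
by apply: rint_eq => // x _; rewrite mul0r addr0.
Qed.

Lemma rint_mid h a b : a <= b -> cont_on h a b ->
  rint h a b = rint h a ((a + b) / 2) + rint h ((a + b) / 2) b.
Proof.
move=> ab ch; have /andP[am mb] := midP ab.
apply: rintP => //; rewrite -(cvg_shiftn 1).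
under eq_fun do rewrite addn1 /=.
by apply: cvgD; apply: midsum_cvg => //; apply: sub_cont_on ch _ _.
Qed.

Lemma le_rint h a b M : a <= b -> cont_on h a b ->
  (forall x, a <= x <= b -> normc (h x) <= M) -> normc (rint h a b) <= (b - a) * M.
Proof.
move=> ab ch hM.
apply: (cvgr_to_le (cvg_normc (midsum_cvg ab ch))).
by near=> n; exact: le_midsum.
Unshelve. all: by end_near. Qed.

End riemann_integral.

(** * Goursat's theorem *)

Section goursat.
Variable R : realType.
Notation C := (CC R).
Implicit Types (f g : C -> C) (p z w : C) (e : R).

Lemma ComplexE (x y : R) : (Complex x y : C) = x%:C%C + 'i%C * y%:C%C.
Proof.
by apply/eqP; rewrite eq_complex /= !(mul0r, mul1r, addr0, add0r, subr0) !eqxx.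
Qed.

Lemma differentiableCP (V : normedModType C) (f : V -> C) (p : V) :
  differentiable f p <-> exists L : {linear V -> C}, continuous L /\
  forall e, 0 < e -> \forall z \near p, `|f z - f p - L (z - p)| <= e%:C%C * `|z - p|.
Proof.
have shiftP (L : {linear V -> C}) : (f \o shift p = cst (f p) + L +o_ 0 id) <->
    forall e, 0 < e -> \forall z \near p, `|f z - f p - L (z - p)| <= e%:C%C * `|z - p|.
  pose P e (z : V) : Prop := `|f z - f p - L (z - p)| <= e%:C%C * `|z - p|.
  have PE e (z : V) : P e (z + p) = (`|(f \o shift p - (cst (f p) + L)) z| <= e%:C%C * `|id z|).
    by rewrite /P !fctE /= addrK opprD addrA.
  split=> [/eqaddoP H e e0|H].
    have e0' : (0 : C) < e%:C%C by rewrite ltr0C.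
    rewrite (near_shift 0 p); apply: filterS (H _ e0') => z.
    by rewrite -PE /P /= subr0.
  apply/eqaddoP => _/gt0_ComplexP[e e0 ->].
  have := H _ e0; rewrite (near_shift 0 p); apply: filterS => z.
  by rewrite -PE /P /= subr0.
split=> [df|[L [cL /shiftP Lf]]].
  exists ('d f p); have [cd /shiftP H] := (diff_locallyP p f).1 df.
  by split.
by apply/diff_locallyP; rewrite (diff_unique cL Lf).
Qed.

Lemma differentiable1P f p : differentiable f p <-> exists l : C,
  forall e, 0 < e -> \forall z \near p, normc (f z - f p - l * (z - p)) <= e * normc (z - p).
Proof.
rewrite differentiableCP; split=> [[L [_ Lf]]|[l lf]].
  exists (L 1) => e /Lf; apply: filterS => z.
  rewrite !normr_normc -rmorphM /= lecR.
  suff -> : L (z - p) = L 1 * (z - p) by [].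
  by have := linearZZ L (z - p) 1; rewrite [(z - p) *: 1]mulr1 => ->; rewrite mulrC.
exists ( *:%R l : C -> C); split.
  by move=> x; apply: (@cvgM C C (nbhs x) _ (fun=> l) id l x); [exact: cvg_cst|exact: cvg_id].
by move=> e /lf; apply: filterS => z; rewrite !normr_normc -rmorphM /= lecR.
Qed.

Lemma differentiable1_continuous f p : differentiable f p -> {for p, continuous f}.
Proof. exact: differentiable_continuous. Qed.

Lemma continuous_affine (k l : C) : continuous (fun z : C => k + l * z).
Proof.
move=> z; apply: (@cvgD C C C (nbhs z) _ (fun=> k) (fun z => l * z) k (l * z)).
  exact: cvg_cst.
by apply: (@cvgM C C (nbhs z) _ (fun=> l) id l z); [exact: cvg_cst|exact: cvg_id].
Qed.

Definition horiz f (y : R) : R -> C := fun x => f (Complex x y).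
Definition vert f (x : R) : R -> C := fun y => f (Complex x y).

(** The integral of f(z)dz along the boundary of [a,b]x[c,d]. *)
Definition bdry f (a b c d : R) : C :=
  rint (horiz f c) a b - rint (horiz f d) a b
  + 'i%C * (rint (vert f b) c d - rint (vert f a) c d).

Definition cont_rect f a b c d := forall x y : R, a <= x <= b -> c <= y <= d ->
  {for (Complex x y : C), continuous f}.

Lemma cont_horiz f a b c d y : cont_rect f a b c d -> c <= y <= d ->
  cont_on (horiz f y) a b.
Proof.
move=> cf yd x xb.
apply: (@cvg_comp _ _ _ (fun t : R => Complex t y : C) f _ _ _ _ (cf _ _ xb yd)).
by apply: cvg_Complex; [exact: cvg_id|exact: cvg_cst].
Qed.

Lemma cont_vert f a b c d x : cont_rect f a b c d -> a <= x <= b ->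
  cont_on (vert f x) c d.
Proof.
move=> cf xb y yd.
apply: (@cvg_comp _ _ _ (fun t : R => Complex x t : C) f _ _ _ _ (cf _ _ xb yd)).
by apply: cvg_Complex; [exact: cvg_cst|exact: cvg_id].
Qed.

Lemma bdry_quarter f a b c d : a <= b -> c <= d -> cont_rect f a b c d ->
  let m := (a + b) / 2 in let n := (c + d) / 2 in
  bdry f a b c d = bdry f a m c n + bdry f m b c n + (bdry f a m n d + bdry f m b n d).
Proof.
move=> ab cd cf m n.
have am : a <= m <= b by rewrite /m; apply/andP; split; lra.
have cn : c <= n <= d by rewrite /n; apply/andP; split; lra.
have aa : a <= a <= b by rewrite lexx.
have bb : a <= b <= b by rewrite lexx andbT.
have cc : c <= c <= d by rewrite lexx.
have dd : c <= d <= d by rewrite lexx andbT.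
rewrite /bdry.
rewrite (rint_mid ab (cont_horiz cf cc)) (rint_mid ab (cont_horiz cf dd)).
rewrite (rint_mid cd (cont_vert cf aa)) (rint_mid cd (cont_vert cf bb)) -/m -/n.
ring.
Qed.

Lemma bdry_affine (k l : C) a b c d : a <= b -> c <= d ->
  bdry (fun z => k + l * z) a b c d = 0.
Proof.
move=> ab cd; rewrite /bdry.
have H y : rint (horiz (fun z => k + l * z) y) a b =
    (b - a)%:C%C * (k + l * 'i%C * y%:C%C + l * ((a + b) / 2)%:C%C).
  rewrite -rint_affine//; apply: rint_eq => // x _; rewrite /horiz.
  by rewrite ComplexE; ring.
have V x : rint (vert (fun z => k + l * z) x) c d =
    (d - c)%:C%C * (k + l * x%:C%C + l * 'i%C * ((c + d) / 2)%:C%C).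
  rewrite -rint_affine//; apply: rint_eq => // y _; rewrite /vert.
  by rewrite ComplexE; ring.
rewrite !H !V; set u := ((a + b) / 2)%:C%C; set v := ((c + d) / 2)%:C%C.
by rewrite !rmorphB /=; ring.
Qed.

Lemma bdryB f g a b c d : a <= b -> c <= d -> cont_rect f a b c d -> cont_rect g a b c d ->
  bdry (fun z => f z - g z) a b c d = bdry f a b c d - bdry g a b c d.
Proof.
move=> ab cd cf cg.
have aa : a <= a <= b by rewrite lexx.
have bb : a <= b <= b by rewrite lexx andbT.
have cc : c <= c <= d by rewrite lexx.
have dd : c <= d <= d by rewrite lexx andbT.
rewrite /bdry (rintB ab (cont_horiz cf cc) (cont_horiz cg cc)).
rewrite (rintB ab (cont_horiz cf dd) (cont_horiz cg dd)).
rewrite (rintB cd (cont_vert cf bb) (cont_vert cg bb)).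
rewrite (rintB cd (cont_vert cf aa) (cont_vert cg aa)).
ring.
Qed.

Lemma normc_i : normc ('i%C : C) = 1.
Proof. by rewrite /normc /= expr0n expr1n add0r sqrtr1. Qed.

Lemma le_bdry f a b c d M : a <= b -> c <= d -> cont_rect f a b c d ->
  (forall x y : R, a <= x <= b -> c <= y <= d -> normc (f (Complex x y)) <= M) ->
  normc (bdry f a b c d) <= 2 * ((b - a) + (d - c)) * M.
Proof.
move=> ab cd cf fM.
have aa : a <= a <= b by rewrite lexx.
have bb : a <= b <= b by rewrite lexx andbT.
have cc : c <= c <= d by rewrite lexx.
have dd : c <= d <= d by rewrite lexx andbT.
have Hc := le_rint ab (cont_horiz cf cc) (fun x xab => fM x c xab cc).
have Hd := le_rint ab (cont_horiz cf dd) (fun x xab => fM x d xab dd).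
have Va := le_rint cd (cont_vert cf aa) (fun y ycd => fM a y aa ycd).
have Vb := le_rint cd (cont_vert cf bb) (fun y ycd => fM b y bb ycd).
apply: le_trans (ler_normcD _ _) _; rewrite normcM normc_i mul1r.
have := ler_normcB (rint (horiz f c) a b) (rint (horiz f d) a b).
have := ler_normcB (rint (vert f b) c d) (rint (vert f a) c d).
nra.
Qed.

Lemma nested_point (u : nat -> R) (w : R) : 0 <= w ->
  (forall n, u n <= u n.+1 /\ u n.+1 + w / 2 ^+ n.+1 <= u n + w / 2 ^+ n) ->
  exists x, forall n, u n <= x <= u n + w / 2 ^+ n.
Proof.
move=> w0 un.
have incr m k : u m <= u (m + k)%N.
  by elim: k => [|k ih]; rewrite ?addn0// addnS (le_trans ih)//; case: (un (m + k)%N).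
have decr m k : u (m + k)%N + w / 2 ^+ (m + k) <= u m + w / 2 ^+ m.
  by elim: k => [|k ih]; rewrite ?addn0// addnS (le_trans _ ih)//; case: (un (m + k)%N).
have bnd m n : u n <= u m + w / 2 ^+ m.
  have pos k : 0 <= w / 2 ^+ k by rewrite divr_ge0// exprn_ge0.
  have [mn|/ltnW nm] := leqP m n.
    by have := decr m (n - m)%N; rewrite subnKC//; have := pos n; lra.
  by have := incr n (m - n)%N; rewrite subnKC//; have := pos m; lra.
have hs : has_sup (range u).
  split; first by exists (u 0%N), 0%N.
  by exists (u 0%N + w / 2 ^+ 0%N) => _ [n _ <-]; exact: bnd.
exists (sup (range u)) => n; apply/andP; split.
  by apply: ub_le_sup; [exact: hs.2|exists n].
by apply: ge_sup; [exact: hs.1|move=> _ [m _ <-]; exact: bnd].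
Qed.

(** Goursat's theorem. A rectangle with nonzero boundary integral contains a
quarter that carries at least a fourth of it; the rectangles obtained in this
way shrink to a point, where the affine approximation of the function, whose
boundary integrals vanish, leaves too small a remainder. *)
Lemma goursat f a b c d : a <= b -> c <= d ->
  (forall x y : R, a <= x <= b -> c <= y <= d -> differentiable f (Complex x y : C)) ->
  bdry f a b c d = 0.
Proof.
move=> ab cd df.
have cf : cont_rect f a b c d.
  by move=> x y xb yd; apply: differentiable1_continuous; exact: df.
apply/eqP; rewrite -normc_eq0 eq_le normc_ge0 andbT leNgt; apply/negP => B0.
pose L := (b - a) + (d - c).
have L0 : 0 <= L by rewrite addr_ge0// subr_ge0.
(* With this e the whole rectangle is good at stage 0. *)
pose e := normc (bdry f a b c d) / (L ^+ 2 + 1).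
have L21 : 0 < L ^+ 2 + 1 by rewrite ltr_wpDl// sqr_ge0.
have e0 : 0 < e by rewrite divr_gt0.
have eL : e * L ^+ 2 < normc (bdry f a b c d).
  rewrite /e mulrAC ltr_pdivrMr//; nra.
pose w n := (b - a) / 2 ^+ n; pose h n := (d - c) / 2 ^+ n.
have wS n : w n = w n.+1 + w n.+1.
  by rewrite /w exprS; field; rewrite expf_neq0.
have hS n : h n = h n.+1 + h n.+1.
  by rewrite /h exprS; field; rewrite expf_neq0.
have w0 n : 0 <= w n by rewrite divr_ge0 ?subr_ge0// exprn_ge0.
have h0 n : 0 <= h n by rewrite divr_ge0 ?subr_ge0// exprn_ge0.
pose good n (q : R * R) := [/\ a <= q.1, q.1 + w n <= b, c <= q.2, q.2 + h n <= d &
  e * (w n + h n) ^+ 2 < normc (bdry f q.1 (q.1 + w n) q.2 (q.2 + h n))].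
pose nested n (q q' : R * R) := [/\ q.1 <= q'.1, q'.1 + w n.+1 <= q.1 + w n,
  q.2 <= q'.2 & q'.2 + h n.+1 <= q.2 + h n].
have step (nq : nat * (R * R)) : exists q', good nq.1 nq.2 ->
    good nq.1.+1 q' /\ nested nq.1 nq.2 q'.
  case: nq => n q /=; have [gq|ngq] := pselect (good n q); last by exists q.
  suff [q' q'P] : exists q', good n.+1 q' /\ nested n q q' by exists q'.
  case: gq => q1 q2 q3 q4; rewrite /nested; have := w0 n.+1; have := h0 n.+1.
  rewrite (wS n) (hS n) in q2 q4 *.
  set W := w n.+1 in q2 q4 *; set H := h n.+1 in q2 q4 * => H0 W0.
  have cq : cont_rect f q.1 (q.1 + (W + W)) q.2 (q.2 + (H + H)).
    move=> x y /andP[x1 x2] /andP[y1 y2]; apply: cf; apply/andP; split.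
    - exact: le_trans x1.
    - exact: le_trans q2.
    - exact: le_trans y1.
    - exact: le_trans q4.
  rewrite bdry_quarter ?lerDl ?addr_ge0//.
  have -> : (q.1 + (q.1 + (W + W))) / 2 = q.1 + W by field.
  have -> : (q.2 + (q.2 + (H + H))) / 2 = q.2 + H by field.
  rewrite ![_ + (W + W)]addrA ![_ + (H + H)]addrA in q2 q4 * => sumq.
  have [q'|nq'] := pselect (exists q', good n.+1 q' /\
    [/\ q.1 <= q'.1, q'.1 + W <= q.1 + W + W, q.2 <= q'.2 & q'.2 + H <= q.2 + H + H]).
    by [].
  (* If all four quarters were small, so would be the integral along the large boundary. *)
  have small x y : (x = q.1 \/ x = q.1 + W) -> (y = q.2 \/ y = q.2 + H) ->
      normc (bdry f x (x + W) y (y + H)) <= e * (W + H) ^+ 2.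
    move=> xE yE; rewrite leNgt; apply/negP => big; apply: nq'; exists (x, y).
    rewrite /good /= -/W -/H.
    by case: xE big => ->; case: yE => -> big; split; split => //;
      move: q1 q2 q3 q4 H0 W0; clear; lra.
  exfalso; move: sumq; apply/negP; rewrite -leNgt.
  apply: le_trans (ler_normcD _ _) _.
  apply: le_trans (lerD (ler_normcD _ _) (ler_normcD _ _)) _.
  have := small q.1 q.2 (or_introl erefl) (or_introl erefl).
  have := small (q.1 + W) q.2 (or_intror erefl) (or_introl erefl).
  have := small q.1 (q.2 + H) (or_introl erefl) (or_intror erefl).
  have := small (q.1 + W) (q.2 + H) (or_intror erefl) (or_intror erefl).
  lra.
have {step}[g gP] := choice step.
pose u := fix u n : R * R := if n is n'.+1 then g (n', u n') else (a, c).
have ug n : good n (u n).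
  elim: n => [|n ih]; last by have [] := gP (n, u n) ih.
  rewrite /good.
  have -> : w 0%N = b - a by rewrite /w expr0 divr1.
  have -> : h 0%N = d - c by rewrite /h expr0 divr1.
  by rewrite /= addrCA subrr addr0 [c + (_ - _)]addrCA subrr addr0; split.
have un n : nested n (u n) (u n.+1) by have [] := gP (n, u n) (ug n).
have [x xP] : exists x, forall n, (u n).1 <= x <= (u n).1 + (b - a) / 2 ^+ n.
  by apply: nested_point; [rewrite subr_ge0|move=> n; case: (un n)].
have [y yP] : exists y, forall n, (u n).2 <= y <= (u n).2 + (d - c) / 2 ^+ n.
  by apply: nested_point; [rewrite subr_ge0|move=> n; case: (un n)].
have xab : a <= x <= b.
  by have := xP 0%N; rewrite /= expr0 divr1 addrC subrK.
have ycd : c <= y <= d.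
  by have := yP 0%N; rewrite /= expr0 divr1 addrC subrK.
have /differentiable1P[l /(_ (e / 4))] := df _ _ xab ycd.
rewrite divr_gt0// => /(_ isT) /nbhs_normcP[r r0 lr].
have [n nr] : exists n, w n + h n < r.
  have /cvgrPdist_lt/(_ _ r0)[N _ /(_ N)] : L * 2^-1 ^+ n @[n --> \oo] --> L * 0.
    apply: cvgM; [exact: cvg_cst|apply: cvg_expr].
    by rewrite ger0_norm ?invr_ge0// invf_lt1// ltr1n.
  rewrite /= leqnn mulr0 sub0r normrN exprVn => /(_ isT) Nd.
  by exists N; rewrite /w /h -mulrDl; apply: le_lt_trans Nd; exact: ler_norm.
have [q1 q2 q3 q4] := ug n; apply/negP; rewrite -leNgt.
set A := (u n).1 in q1 q2 *; set B := (u n).2 in q3 q4 *.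
have AW : A <= A + w n by rewrite lerDl.
have BH : B <= B + h n by rewrite lerDl.
have cq : cont_rect f A (A + w n) B (B + h n).
  move=> s t /andP[s1 s2] /andP[t1 t2]; apply: cf; apply/andP; split.
  - exact: le_trans s1.
  - exact: le_trans q2.
  - exact: le_trans t1.
  - exact: le_trans q4.
pose p : C := Complex x y.
pose T z := (f p - l * p) + l * z.
have cT : cont_rect T A (A + w n) B (B + h n).
  by move=> s t _ _; exact: continuous_affine.
have cfT : cont_rect (fun z => f z - T z) A (A + w n) B (B + h n).
  by move=> s t sI tI; apply: continuousB; [exact: cq|exact: cT].
have -> : bdry f A (A + w n) B (B + h n) = bdry (fun z => f z - T z) A (A + w n) B (B + h n).
  by rewrite bdryB// bdry_affine// subr0.
suff fT s t : A <= s <= A + w n -> B <= t <= B + h n ->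
    normc (f (Complex s t) - T (Complex s t)) <= e / 4 * (w n + h n).
  have := le_bdry AW BH cfT fT; move: e0 (w0 n) (h0 n); clear.
  set W := w n; set H := h n => e0 W0 H0 /le_trans; apply.
  have : 0 <= e * (W + H) ^+ 2 by rewrite mulr_ge0 ?sqr_ge0// ltW.
  have -> : 2 * (A + W - A + (B + H - B)) * (e / 4 * (W + H)) = e * (W + H) ^+ 2 / 2 by field.
  by clear; lra.
move=> sI tI.
have spn : normc (Complex s t - p) <= w n + h n.
  apply: le_trans (normc_le_ReIm _) _; rewrite /p /=.
  have := xP n; have := yP n; rewrite -/A -/B -/(w n) -/(h n) => /andP[y1 y2] /andP[x1 x2].
  move: sI tI => /andP[s1 s2] /andP[t1 t2].
  by apply: lerD; rewrite ler_norml; apply/andP; split;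
    move: y1 y2 x1 x2 s1 s2 t1 t2; clear; lra.
have -> : f (Complex s t) - T (Complex s t) = f (Complex s t) - f p - l * (Complex s t - p).
  by rewrite /T; ring.
apply: le_trans (lr _ (le_lt_trans spn nr)) _.
by rewrite ler_wpM2l// divr_ge0// ltW.
Qed.

End goursat.

(** * The complex exponential *)

Section complex_exponential.
Variable R : realType.
Notation C := (CC R).
Implicit Types (w h z c : C) (x y e r t : R).

Lemma expiD x y : expi (x + y) = expi x * expi y :> C.
Proof.
by apply/eqP; rewrite eq_complex /= cosD sinD addrC [X in _ && (_ == X)]addrC mulrC !eqxx.
Qed.

Lemma expi0 : expi 0 = 1 :> C.
Proof. by rewrite /expi cos0 sin0. Qed.

Lemma normc_expi x : normc (expi x : C) = 1.
Proof. by rewrite /normc /= cos2Dsin2 sqrtr1. Qed.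

Lemma expi2pi : expi (2 * pi) = 1 :> C.
Proof. by rewrite /expi mulr_natl cos2pi sin2pi. Qed.

Lemma expiN x : expi (- x) = (expi x)^-1 :> C.
Proof.
have ex0 : expi x != 0 :> C by rewrite -normc_eq0 normc_expi oner_eq0.
by apply: (mulIf ex0); rewrite mulVf// -expiD addNr expi0.
Qed.

Lemma continuous_expi : continuous (@expi R).
Proof. by move=> x; apply: cvg_Complex; [exact: continuous_cos|exact: continuous_sin]. Qed.

Definition cexp w : C := (expR (complex.Re w))%:C%C * expi (complex.Im w).

Lemma cexpD w h : cexp (w + h) = cexp w * cexp h.
Proof.
case: w h => a b [k l]; rewrite /cexp /= expRD expiD rmorphM /=; ring.
Qed.

Lemma derive_remainder (f : R -> R) (l : R) e : is_derive (0 : R) (1 : R) f l -> 0 < e ->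
  \forall x \near (0 : R), `|f x - f 0 - l * x| <= e * `|x|.
Proof.
move=> [df dfl] e0; move: df => /cvgrPdist_le/(_ _ e0).
rewrite -[lim _]/('D_1 f 0) dfl near_withinE /= => H.
near=> x; have [->|x0] := eqVneq x 0; first by rewrite mulr0 !subrr normr0 mulr0.
have : x != 0 -> `|l - x^-1 *: (f (x *: 1 + 0) - f 0)| <= e by near: x; exact: H.
move=> /(_ x0); rewrite addr0 [x *: 1]mulr1 distrC.
have nx0 : 0 < `|x| by rewrite normr_gt0.
rewrite -(ler_pM2r nx0) -normrM; congr (_ <= _).
by rewrite mulrBl [_ *: _ * _]mulrAC mulVf// mul1r.
Unshelve. all: by end_near. Qed.

(** The factors of the polar form have the expansions of exp, cos and sin at 0. *)
Lemma cexp_derive0 e : 0 < e -> \forall h \near (0 : C), normc (cexp h - 1 - h) <= e * normc h.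
Proof.
(* The error terms below add up to at most 6 d times the norm of h. *)
move=> e0; pose d := Num.min (e / 10) 1.
have d0 : 0 < d by rewrite lt_min divr_gt0//= ltr01.
have de : d <= e / 10 by rewrite ge_min lexx.
have d1 : d <= 1 by rewrite ge_min lexx orbT.
have Hexp := derive_remainder (is_derive_expR 0) d0.
have Hcos := derive_remainder (is_derive_cos 0) d0.
have Hsin := derive_remainder (is_derive_sin 0) d0.
have Hexp1 : \forall x \near (0 : R), `|expR x - expR 0| <= d.
  by have /cvgrPdistC_le := @continuous_expR R 0; apply.
have /cvg_ReC Re0 : (id : C -> C) @ (0 : C) --> (0 : C) by exact: cvg_id.
have /cvg_ImC Im0 : (id : C -> C) @ (0 : C) --> (0 : C) by exact: cvg_id.
near=> h.
have h1 : `|expR (complex.Re h) - expR 0 - expR 0 * complex.Re h| <= d * `|complex.Re h|.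
  by near: h; exact: Re0 Hexp.
have h2 : `|expR (complex.Re h) - expR 0| <= d by near: h; exact: Re0 Hexp1.
have h3 : `|cos (complex.Im h) - cos 0 - - sin 0 * complex.Im h| <= d * `|complex.Im h|.
  by near: h; exact: Im0 Hcos.
have h4 : `|sin (complex.Im h) - sin 0 - cos 0 * complex.Im h| <= d * `|complex.Im h|.
  by near: h; exact: Im0 Hsin.
have N0 := normc_ge0 h; apply: le_trans (normc_le_ReIm _) _.
move: (normc_Re h) (normc_Im h) N0 h1 h2 h3 h4; move: (normc h) => N.
case: (h) => x y; rewrite /cexp /= mul0r subr0 mul0r addr0 oppr0 addr0.
rewrite !(expR0, cos0, sin0, mul1r, subr0, oppr0, mul0r, addr0) => xN yN N0 h1 h2 h3 h4.
have E2 : expR x <= 2 by move: h2; rewrite ler_norml; lra.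
have -> : expR x * cos y - 1 - x = (expR x - 1 - x) + expR x * (cos y - 1) by ring.
have -> : expR x * sin y - y = expR x * (sin y - y) + (expR x - 1) * y by ring.
apply: le_trans (lerD (ler_normD _ _) (ler_normD _ _)) _.
rewrite !normrM (ger0_norm (expR_ge0 _)).
have A : expR x * `|cos y - 1| <= 2 * (d * N).
  by apply: ler_pM => //; rewrite ?expR_ge0//; apply: le_trans h3 _; rewrite ler_pM2l.
have B : expR x * `|sin y - y| <= 2 * (d * N).
  by apply: ler_pM => //; rewrite ?expR_ge0//; apply: le_trans h4 _; rewrite ler_pM2l.
have D : `|expR x - 1| * `|y| <= d * N by apply: ler_pM.
have E : d * `|x| <= d * N by rewrite ler_pM2l.
have : d * N <= e / 10 * N by rewrite ler_wpM2r.
have : 0 <= e * N by rewrite mulr_ge0// ltW.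
by move: h1 A B D E; clear; lra.
Unshelve. all: by end_near. Qed.

Lemma differentiable_cexp w : differentiable cexp w.
Proof.
apply/differentiable1P; exists (cexp w) => e e0.
have c0 : 0 < normc (cexp w) + 1 by rewrite ltr_wpDl// normc_ge0.
have := cexp_derive0 (divr_gt0 e0 c0); rewrite (near_shift w (0 : C)); apply: filterS => z /=.
rewrite sub0r => zw.
have -> : cexp z - cexp w - cexp w * (z - w) = cexp w * (cexp (z - w) - 1 - (z - w)).
  by rewrite -{1}(subrK w z) addrC cexpD; ring.
rewrite normcM; apply: le_trans (ler_wpM2l (normc_ge0 _) zw) _.
rewrite mulrA ler_wpM2r ?normc_ge0// mulrCA ler_piMr// ?(ltW e0)//.
by rewrite ler_pdivrMr// mul1r lerDl.
Qed.

End complex_exponential.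

(** * Means over circles *)

Section circle_means.
Variable R : realType.
Notation C := (CC R).
Implicit Types (f h : C -> C) (z c : C) (e r s t a b : R).

(** Continuity under the integral sign: by compactness of [a, b], continuity at the points
above p is uniform in the variable of integration. *)
Lemma rint_param (T : topologicalType) (F : set_system T) (k : T -> R -> C) (p : T) a b :
  Filter F -> F --> p -> a <= b -> cont_on (k p) a b ->
  (\forall q \near F, cont_on (k q) a b) ->
  (forall t, a <= t <= b -> {for (p, t), continuous (fun qt : T * R => k qt.1 qt.2)}) ->
  rint (k q) a b @[q --> F] --> rint (k p) a b.
Proof.
move=> FF Fp ab ckp ck kc; apply/cvg_normcP => e e0.
pose e' := e / (2 * (b - a + 1)).
have ba : 0 <= b - a by rewrite subr_ge0.
have e'0 : 0 < e' by rewrite divr_gt0// mulr_gt0// ltr_pwDr.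
have near_k : \forall q \near F, `[a, b] `<=` (fun t => normc (k q t - k p t) <= e').
  have := @segment_compact R a b; rewrite compact_near_coveringP; apply => t.
  rewrite /= in_itv /= => tab; have /cvg_normcP/(_ (e' / 2)) := kc t tab.
  rewrite divr_gt0// => /(_ isT) [[A B] /= [pA tB] AB].
  exists (B, A); first by split => //; exact: Fp.
  move=> [t' q] [/= Bt' Aq]; apply: le_trans (ler_distcD (k p t) _ _) _.
  rewrite (splitr e'); apply: lerD; first by apply: ltW; exact: (AB (q, t')).
  by rewrite normcB; apply: ltW; apply: (AB (p, t')); split => //=; exact: nbhs_singleton.
near=> q; have cq : cont_on (k q) a b by near: q.
have kq : `[a, b] `<=` (fun t => normc (k q t - k p t) <= e') by near: q.
rewrite -rintB//.
have ckB : cont_on (fun t => k q t - k p t) a b.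
  by move=> t tab; apply: continuousB; [exact: cq|exact: ckp].
have kq' t : a <= t <= b -> normc (k q t - k p t) <= e'.
  by move=> tab; apply: kq; rewrite /= in_itv.
apply: le_lt_trans (le_rint ab ckB kq') _.
have -> : e = e' * (2 * (b - a + 1)) by rewrite /e'; field; rewrite gt_eqF// ltr_pwDr.
by move: ba e'0; set u := b - a; set v := e'; clear; nra.
Unshelve. all: by end_near. Qed.

Definition circ c r t : C := c + r%:C%C * expi t.

Definition cmean h c r : C := (2 * pi)^-1%:C%C * rint (fun t => h (circ c r t)) 0 (2 * pi).

Lemma pi2_ge0 : 0 <= 2 * pi :> R.
Proof. by rewrite mulr_ge0// pi_ge0. Qed.

Lemma pi2_gt0 : 0 < 2 * pi :> R.
Proof. by rewrite mulr_gt0// pi_gt0. Qed.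

Lemma normc_circ c r t : 0 <= r -> normc (circ c r t - c) = r.
Proof.
by move=> r0; rewrite /circ addrC addKr normcM normc_expi normc_real mulr1 ger0_norm.
Qed.

Lemma continuous_circ c : continuous (fun rt : R * R => circ c rt.1 rt.2).
Proof.
move=> [r t].
apply: (@continuousD C C _ (fun=> c) (fun rt : R * R => rt.1%:C%C * expi rt.2)).
  exact: cst_continuous.
apply: (@continuousM C _ (fun rt : R * R => rt.1%:C%C : C) (fun rt : R * R => expi rt.2)).
  by apply: cvg_real_complex; exact: cvg_fst.
by apply: (@cvg_comp _ _ _ snd (@expi R)); [exact: cvg_snd|exact: continuous_expi].
Qed.

Lemma continuous_circ1 c r : continuous (circ c r).
Proof.
move=> t.
apply: (@continuousD C C _ (fun=> c) (fun t => r%:C%C * expi t)).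
  exact: cst_continuous.
apply: (@continuousM C _ (fun=> r%:C%C : C) (@expi R)); first exact: cst_continuous.
exact: continuous_expi.
Qed.

Lemma cont_circ h c r : 0 <= r -> (forall z, normc (z - c) = r -> {for z, continuous h}) ->
  cont_on (fun t => h (circ c r t)) 0 (2 * pi).
Proof.
move=> r0 ch t _; apply: (@cvg_comp _ _ _ (circ c r) h); first exact: continuous_circ1.
by apply: ch; exact: normc_circ.
Qed.

Lemma le_cmean_cont h c r M : cont_on (fun t => h (circ c r t)) 0 (2 * pi) ->
  (forall t, 0 <= t <= 2 * pi -> normc (h (circ c r t)) <= M) -> normc (cmean h c r) <= M.
Proof.
move=> ch hM; rewrite normcM normc_real ger0_norm ?invr_ge0 ?pi2_ge0//.
rewrite mulrC ler_pdivrMr ?pi2_gt0// [M * _]mulrC -[X in X * M]subr0.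
by apply: le_rint; rewrite ?pi2_ge0.
Qed.

Lemma le_cmean h c r M : 0 <= r -> (forall z, normc (z - c) = r -> {for z, continuous h}) ->
  (forall z, normc (z - c) = r -> normc (h z) <= M) -> normc (cmean h c r) <= M.
Proof.
move=> r0 ch hM; apply: le_cmean_cont; first exact: cont_circ.
by move=> t _; apply/hM/normc_circ.
Qed.

Lemma eq_cmean f h c r : 0 <= r -> (forall z, normc (z - c) = r -> f z = h z) ->
  cmean f c r = cmean h c r.
Proof.
move=> r0 fh; rewrite /cmean; congr (_ * _); apply: rint_eq => [|t _].
  exact: pi2_ge0.
by apply: fh; exact: normc_circ.
Qed.

Lemma cmeanB f h c r : 0 <= r ->
  (forall z, normc (z - c) = r -> {for z, continuous f}) ->
  (forall z, normc (z - c) = r -> {for z, continuous h}) ->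
  cmean (fun z => f z - h z) c r = cmean f c r - cmean h c r.
Proof.
move=> r0 cf ch; rewrite /cmean -mulrBr; congr (_ * _).
by apply: rintB; rewrite ?pi2_ge0//; exact: cont_circ.
Qed.

Lemma cmeanZ (l : C) h c r : 0 <= r ->
  (forall z, normc (z - c) = r -> {for z, continuous h}) ->
  cmean (fun z => l * h z) c r = l * cmean h c r.
Proof.
move=> r0 ch; rewrite /cmean [RHS]mulrCA; congr (_ * _).
by apply: rintZ; rewrite ?pi2_ge0//; exact: cont_circ.
Qed.

Lemma cmean_cst (l : C) c r : cmean (fun=> l) c r = l.
Proof.
rewrite /cmean rint_cst ?pi2_ge0// subr0 mulrA -rmorphM /= mulVf ?mul1r//.
by rewrite gt_eqF// pi2_gt0.
Qed.

Lemma cmean0 h c : cmean h c 0 = h c.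
Proof.
rewrite -[RHS](cmean_cst (h c) c 0); apply: eq_cmean => // z /eqP.
by rewrite normc_eq0 subr_eq0 => /eqP ->.
Qed.

Lemma cvg_cmean (F : set_system R) h c r : Filter F -> F --> r -> 0 <= r ->
  (forall z, normc (z - c) = r -> {for z, continuous h}) ->
  (\forall s \near F, 0 <= s /\ forall z, normc (z - c) = s -> {for z, continuous h}) ->
  cmean h c s @[s --> F] --> cmean h c r.
Proof.
move=> FF Fr r0 chr chF; apply: cvgM; first exact: cvg_cst.
apply: rint_param => //; first exact: pi2_ge0.
- exact: cont_circ.
- by apply: filterS chF => s [s0 chs]; exact: cont_circ.
- move=> t _; apply: (@cvg_comp _ _ _ (fun rt : R * R => circ c rt.1 rt.2) h).
    exact: continuous_circ.
  by apply: chr; exact: normc_circ.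
Qed.

(** In logarithmic coordinates around the centre an annulus becomes a
rectangle on which the function is periodic: the horizontal sides cancel in
Goursat's theorem. *)
Lemma cmean_const_open h c r s : 0 < r -> r <= s ->
  (forall z, r <= normc (z - c) <= s -> differentiable h z) -> cmean h c r = cmean h c s.
Proof.
move=> r0 rs dh; have s0 := lt_le_trans r0 rs.
pose u w := h (c + cexp w).
have du x y : ln r <= x <= ln s -> 0 <= y <= 2 * pi -> differentiable u (Complex x y : C).
  move=> /andP[rx xs] _.
  apply: (@differentiable_comp _ _ _ _ (fun w : C => c + cexp w) h).
    by apply: differentiableD; [exact: differentiable_cst|exact: differentiable_cexp].
  apply: dh; rewrite addrC addKr /cexp normcM normc_expi normc_real mulr1.
  rewrite ger0_norm ?expR_ge0//= -(lnK r0) -(lnK s0) !ler_expR.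
  by rewrite rx.
have := goursat _ pi2_ge0 du; rewrite ler_ln// => /(_ rs).
rewrite /bdry [X in X - _](_ : _ = rint (horiz u (2 * pi)) (ln r) (ln s)); last first.
  apply: rint_eq; first by rewrite ler_ln.
  by move=> x _; rewrite /horiz /u /cexp /= expi0 expi2pi.
rewrite subrr add0r => /eqP; rewrite mulf_eq0 -normc_eq0 normc_i oner_eq0 /= subr_eq0.
move=> /eqP V; rewrite /cmean; congr (_ * _).
have vE q : 0 < q -> rint (fun t => h (circ c q t)) 0 (2 * pi) = rint (vert u (ln q)) 0 (2 * pi).
  move=> q0; apply: rint_eq => [|t _]; first exact: pi2_ge0.
  by rewrite /vert /u /cexp /circ [complex.Re _]/= [complex.Im _]/= lnK.
by rewrite (vE r r0) (vE s s0) V.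
Qed.

(** The extreme circles only require continuity; this allows for isolated
points of unknown differentiability, and for the degenerate circle r = 0. *)
Lemma cmean_const h c r s : 0 <= r -> r <= s ->
  (forall z, r <= normc (z - c) <= s -> {for z, continuous h}) ->
  (forall z, r < normc (z - c) < s -> differentiable h z) -> cmean h c r = cmean h c s.
Proof.
move=> r0; rewrite le_eqVlt => /orP[/eqP -> //|rs] ch dh.
pose m := (r + s) / 2.
have rm : r < m by rewrite /m; lra.
have ms : m < s by rewrite /m; lra.
transitivity (cmean h c m).
  have R1 : cmean h c q @[q --> r^'+] --> cmean h c r.
    apply: cvg_cmean => //; first exact: cvg_at_right_filter.
      by move=> z zr; apply: ch; rewrite zr lexx ltW.
    near=> q; have rq : r < q by near: q; exact: nbhs_right_gt.
    have qs : q < s by near: q; exact: nbhs_right_lt.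
    split; first exact: le_trans (ltW rq).
    by move=> z zq; apply: ch; rewrite zq !ltW.
  apply: (@cvg_unique _ (@norm_hausdorff _ _) _ _ _ _ R1).
  apply: cvg_near_cst; near=> q.
  have rq : r < q by near: q; exact: nbhs_right_gt.
  have qm : q < m by near: q; exact: nbhs_right_lt.
  apply: cmean_const_open; [exact: le_lt_trans rq|exact: ltW|].
  by move=> z /andP[qz zm]; apply: dh; rewrite (lt_le_trans rq qz) (le_lt_trans zm ms).
have S1 : cmean h c q @[q --> s^'-] --> cmean h c s.
  apply: cvg_cmean => //; first exact: cvg_at_left_filter.
  - by rewrite (le_trans r0)// ltW.
  - by move=> z zr; apply: ch; rewrite zr lexx ltW.
  near=> q; have rq : r < q by near: q; exact: nbhs_left_gt.
  have qs : q < s by near: q; exact: nbhs_left_lt.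
  split; first exact: le_trans (ltW rq).
  by move=> z zq; apply: ch; rewrite zq !ltW.
apply/esym; apply: (@cvg_unique _ (@norm_hausdorff _ _) _ _ _ _ S1).
apply: cvg_near_cst; near=> q.
have mq : m < q by near: q; exact: nbhs_left_gt.
have qs : q < s by near: q; exact: nbhs_left_lt.
apply/esym; apply: cmean_const_open; [exact: le_lt_trans rm|exact: ltW|].
by move=> z /andP[qz zm]; apply: dh; rewrite (lt_le_trans rm qz) (le_lt_trans zm qs).
Unshelve. all: by end_near. Qed.

End circle_means.

(** * Cauchy's formula *)

Section cauchy_formula.
Variable R : realType.
Notation C := (CC R).
Implicit Types (f h : C -> C) (z c w : C) (e r s M : R).

Lemma continuous_normcP (T : topologicalType) (f : T -> C) (x : T) :
  {for x, continuous f} <-> forall e, 0 < e -> \forall y \near x, normc (f y - f x) < e.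
Proof. exact: (@cvg_normcP R T (nbhs x)). Qed.

Lemma near_eq_differentiable (V : normedModType C) (f g : V -> C) (p : V) :
  (\forall z \near p, f z = g z) -> differentiable f p -> differentiable g p.
Proof.
move=> fg /differentiableCP[L [cL Lf]]; apply/differentiableCP; exists L; split=> // e e0.
have fgp : f p = g p by exact: nbhs_singleton fg.
by apply: filterS2 fg (Lf _ e0) => z <-; rewrite fgp.
Qed.

Lemma differentiable_subC (k p : C) : differentiable (fun w : C => w - k) p.
Proof.
apply/differentiable1P; exists 1 => e e0; near=> w.
have -> : w - k - (p - k) - 1 * (w - p) = 0 by ring.
by rewrite normc0 mulr_ge0 ?normc_ge0// ltW.
Unshelve. all: by end_near.
Qed.

Lemma near_neqC (p z : C) : p != z -> \forall w \near p, w != z.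
Proof.
move=> pz; apply/nbhs_normcP; exists (normc (p - z)); first by rewrite normc_gt0 subr_eq0.
move=> w wp; apply: contraTneq wp => ->; by rewrite -leNgt normcB.
Qed.

(** The Cauchy kernel for means over circles centred at c: there dw / (2 i pi) is w - c times
the normalized angular measure, whence the numerator. *)
Definition cker z c w : C := (w - c) / (w - z).

Lemma differentiable_cker z c w : w != z -> differentiable (cker z c) w.
Proof.
move=> wz; apply: (@differentiableM _ _ (fun w : C => w - c) (fun w : C => (w - z)^-1)).
  exact: differentiable_subC.
apply: (@differentiableV _ _ (fun w : C => w - z)); first exact: differentiable_subC.
by rewrite subr_eq0.
Qed.

Lemma continuous_cker z c w : w != z -> {for w, continuous (cker z c)}.
Proof. by move=> wz; apply/differentiable1_continuous/differentiable_cker. Qed.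

Lemma circ_neq z c r w : normc (z - c) != r -> normc (w - c) = r -> w != z.
Proof. by move=> zr wr; apply: contra_neq zr => <-. Qed.

(** Shrinking the circle to its centre, where the kernel vanishes. *)
Lemma cmean_cker_in z c r : 0 <= r -> r < normc (z - c) -> cmean (cker z c) c r = 0.
Proof.
move=> r0 rz; transitivity (cmean (cker z c) c 0); last by rewrite cmean0 /cker subrr mul0r.
apply/esym/cmean_const; first by [].
- exact: r0.
- by move=> w /andP[w0 wr]; apply: continuous_cker; apply: contraTneq wr => ->; rewrite -ltNge.
- move=> w /andP[w0 wr]; apply: differentiable_cker; apply: contraTneq wr => ->.
  by rewrite -leNgt ltW.
Qed.

Lemma cker1 z c w : w != z -> cker z c w = 1 + (z - c) / (w - z).
Proof. by move=> wz; rewrite /cker; field; rewrite subr_eq0. Qed.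

(** Enlarging the circle, since the kernel tends to 1 at infinity. *)
Lemma cmean_cker_out z c r : normc (z - c) < r -> cmean (cker z c) c r = 1.
Proof.
set d := normc (z - c) => dr; have d0 : 0 <= d by exact: normc_ge0.
have r0 : 0 < r by exact: le_lt_trans dr.
apply/eqP; rewrite -subr_eq0 -normc_eq0 eq_le normc_ge0 andbT; apply/ler_addgt0Pl => e e0.
rewrite addr0.
(* On the circle of radius s the kernel is at distance at most e from 1. *)
pose s := r + d + d / e.
have rs : r <= s by rewrite /s -addrA lerDl addr_ge0// divr_ge0// ltW.
have s0 : 0 < s by exact: lt_le_trans rs.
have ds : d < s by exact: lt_le_trans rs.
rewrite (cmean_const_open (c := c) r0 rs); last first.
  move=> w /andP[rw _]; apply: differentiable_cker.
  by apply: contraTneq rw => ->; rewrite -ltNge.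
have ck w : normc (w - c) = s -> {for w, continuous (cker z c)}.
  by move=> ws; apply/continuous_cker/circ_neq/ws; rewrite lt_eqF.
have c1 w : normc (w - c) = s -> {for w, continuous (fun=> 1 : C)}.
  by move=> _; exact: cst_continuous.
rewrite -(cmean_cst 1 c s) -(cmeanB (ltW s0) ck c1).
apply: le_cmean; first exact: ltW.
  by move=> w ws; exact: (continuousB (ck w ws) (c1 w ws)).
move=> w ws.
have wz : w != z by apply: circ_neq ws; rewrite lt_eqF.
rewrite cker1// addrC addKr normcM normcV -/d ler_pdivrMr ?normc_gt0 ?subr_eq0//.
have : normc (w - z) >= s - d.
  by rewrite -ws (_ : w - z = (w - c) - (z - c)) ?lerB_normc//; ring.
have : d = e * (d / e) by rewrite mulrC divfK// gt_eqF.
rewrite /s => dE wzs; rewrite {1}dE ler_pM2l//; apply: le_trans wzs.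
by move: r0 d0; clear; lra.
Qed.

(** The difference quotient at z is continuous on the circle through z and holomorphic
elsewhere, so that its means, weighted by w - c, agree on the two bounding circles. *)
Lemma cauchy_annulus f c z r s : 0 <= r -> r < normc (z - c) < s ->
  (forall w, r <= normc (w - c) <= s -> differentiable f w) ->
  f z = cmean (fun w => f w * cker z c w) c s - cmean (fun w => f w * cker z c w) c r.
Proof.
move=> r0 /andP[rz zs] df; set d := normc (z - c) in rz zs.
have s0 : 0 <= s by rewrite (le_trans r0)// ltW// (lt_trans rz).
have zrs : r <= normc (z - c) <= s by rewrite -/d !ltW.
have [l lf] := (differentiable1P f z).1 (df z zrs).
pose q w := if w == z then l else (f w - f z) / (w - z).
pose g w := q w * (w - c).
have dq w : r <= normc (w - c) <= s -> w != z -> differentiable q w.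
  move=> wrs wz; apply: (@near_eq_differentiable _ (fun w => (f w - f z) * (w - z)^-1)).
    by apply: filterS (near_neqC wz) => w' /negPf w'z; rewrite /q w'z.
  apply: (@differentiableM _ _ (fun w : C => f w - f z) (fun w : C => (w - z)^-1)).
    by apply: (@differentiableB _ _ _ f (fun=> f z)); [exact: df|exact: differentiable_cst].
  apply: (@differentiableV _ _ (fun w : C => w - z)); first exact: differentiable_subC.
  by rewrite subr_eq0.
have cq w : r <= normc (w - c) <= s -> {for w, continuous q}.
  move=> wrs; have [->|wz] := eqVneq w z; last exact/differentiable1_continuous/dq.
  apply/continuous_normcP => e e0; have e20 : 0 < e / 2 by rewrite divr_gt0.
  apply: filterS (lf _ e20) => w'; rewrite /q eqxx; case: eqVneq => [_ _|w'z].
    by rewrite subrr normc0.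
  have w'z0 : w' - z != 0 by rewrite subr_eq0.
  rewrite -ler_pdivrMr ?normc_gt0// -normcV -normcM mulrBl mulfK// => /le_lt_trans; apply.
  by move: e0; clear; lra.
have dg w : r <= normc (w - c) <= s -> w != z -> differentiable g w.
  move=> wrs wz; apply: (@differentiableM _ _ q (fun w : C => w - c)).
    exact: dq.
  exact: differentiable_subC.
have cg w : r <= normc (w - c) <= s -> {for w, continuous g}.
  move=> wrs; apply: (@continuousM _ _ q (fun w : C => w - c)); first exact: cq.
  exact/differentiable1_continuous/differentiable_subC.
have gE : cmean g c r = cmean g c s.
  transitivity (cmean g c d); apply: cmean_const.
  - exact: r0.
  - exact: ltW.
  - by move=> w /andP[rw wd]; apply: cg; rewrite rw (le_trans wd)// ltW.
  - move=> w /andP[rw wd]; apply: dg; first by rewrite !ltW// (lt_trans wd).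
    by apply: contraTneq wd => ->; rewrite -/d ltxx.
  - exact: normc_ge0.
  - exact: ltW.
  - by move=> w /andP[dw ws]; apply: cg; rewrite ws andbT (le_trans _ dw)// ltW.
  - move=> w /andP[dw ws]; apply: dg; first by rewrite !ltW// (lt_trans rz).
    by apply: contraTneq dw => ->; rewrite -/d ltxx.
have gT t : 0 <= t -> d != t -> r <= t <= s ->
    cmean g c t = cmean (fun w => f w * cker z c w) c t - f z * cmean (cker z c) c t.
  move=> t0 dt rts.
  have ck w : normc (w - c) = t -> {for w, continuous (cker z c)}.
    by move=> wt; apply/continuous_cker/circ_neq/wt.
  have cf w : normc (w - c) = t -> {for w, continuous f}.
    by move=> wt; apply/differentiable1_continuous/df; rewrite wt.
  have cfk w : normc (w - c) = t -> {for w, continuous (fun w => f w * cker z c w)}.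
    by move=> wt; apply: continuousM; [exact: cf|exact: ck].
  have czk w : normc (w - c) = t -> {for w, continuous (fun w => f z * cker z c w)}.
    by move=> wt; apply: continuousM; [exact: cst_continuous|exact: ck].
  rewrite -(cmeanZ (f z) t0 ck) -(cmeanB t0 cfk czk).
  apply: eq_cmean => [//|w wt]; have wz : w != z by exact: circ_neq wt.
  by rewrite /g /q (negPf wz) /cker; ring.
have rs : r <= s by rewrite ltW// (lt_trans rz).
rewrite (gT r r0) ?gt_eqF ?lexx// (gT s s0) ?lt_eqF ?lexx ?andbT// in gE.
rewrite (cmean_cker_in r0 rz) (cmean_cker_out zs) mulr0 mulr1 subr0 in gE.
by rewrite gE opprB addrC subrK.
Qed.

Lemma cauchy_disc f c z r : normc (z - c) < r ->
  (forall w, normc (w - c) <= r -> differentiable f w) ->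
  f z = cmean (fun w => f w * cker z c w) c r.
Proof.
move=> zr df; have r0 : 0 < r by apply: le_lt_trans zr; exact: normc_ge0.
have [zc|zc] := eqVneq z c.
  rewrite zc -(cmean0 f c) (@cmean_const _ f c 0 r (lexx 0) (ltW r0)).
  - apply: eq_cmean; first exact: ltW.
    move=> w wr; rewrite /cker divff ?mulr1//.
    by rewrite -normc_gt0 wr.
  - by move=> w /andP[_ wr]; apply/differentiable1_continuous/df.
  - by move=> w /andP[_ /ltW wr]; exact: df.
have zr0 : 0 < normc (z - c) < r by rewrite zr normc_gt0 subr_eq0 zc.
have df0 w : 0 <= normc (w - c) <= r -> differentiable f w by move=> /andP[_]; exact: df.
by rewrite (cauchy_annulus (lexx 0) zr0 df0) cmean0 /cker subrr mul0r mulr0 subr0.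
Qed.

End cauchy_formula.

(** * Holomorphy in three variables *)

Section holomorphy_in_three_variables.
Variable R : realType.
Notation C := (CC R).
Notation C3 := (CC3 R).
Implicit Types (p z h : C3) (f : C3 -> C) (e r M : R) (u v w : C).

Definition norm3 z : R := Num.max (Num.max (normc (z1 z)) (normc (z2 z))) (normc (z3 z)).

Lemma normr_norm3 z : `|z| = (norm3 z)%:C%C :> C.
Proof.
have maxC (a b : R) : Num.max (a%:C%C : C) (b%:C%C) = (Num.max a b)%:C%C.
  by rewrite /Num.max /Order.max ltcR; case: ifP.
case: z => -[u v] w; rewrite /norm3 /z1 /z2 /z3 [fst _]/= [snd _]/=.
rewrite -(maxC (Num.max (normc u) (normc v))) -(maxC (normc u)) -!normr_normc.
by rewrite prod_normE [fst _]/= [snd _]/= prod_normE.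
Qed.

Lemma norm3_ge0 z : 0 <= norm3 z.
Proof. by rewrite !le_max normc_ge0. Qed.

Lemma norm3_lt z e : (norm3 z < e) = [&& normc (z1 z) < e, normc (z2 z) < e & normc (z3 z) < e].
Proof. by rewrite !gt_max andbA. Qed.

Lemma normc_z1 z : normc (z1 z) <= norm3 z. Proof. by rewrite !le_max lexx. Qed.
Lemma normc_z2 z : normc (z2 z) <= norm3 z. Proof. by rewrite !le_max lexx orbT. Qed.
Lemma normc_z3 z : normc (z3 z) <= norm3 z. Proof. by rewrite !le_max lexx !orbT. Qed.

Lemma nbhs_norm3P p (A : set C3) :
  nbhs p A <-> exists2 e : R, 0 < e & forall z, norm3 (z - p) < e -> A z.
Proof.
split=> [/nbhs_normP[e /= /gt0_ComplexP[r r0 ->] pA]|[e e0 pA]].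
  by exists r => // z zp; apply: pA; rewrite /ball_ /= distrC normr_norm3 ltcR.
apply/(@nbhs_normP _ _ p A); exists e%:C%C; first by rewrite /= ltr0C.
by move=> z; rewrite /ball_ /= distrC normr_norm3 ltcR; exact: pA.
Qed.

Lemma continuous_z1 : continuous (@z1 R).
Proof.
by move=> p; apply/continuous_normcP => e e0; apply/nbhs_norm3P; exists e => // z;
  apply: le_lt_trans; exact: (normc_z1 (z - p)).
Qed.

Lemma continuous_z2 : continuous (@z2 R).
Proof.
by move=> p; apply/continuous_normcP => e e0; apply/nbhs_norm3P; exists e => // z;
  apply: le_lt_trans; exact: (normc_z2 (z - p)).
Qed.

Lemma continuous_z3 : continuous (@z3 R).
Proof.
by move=> p; apply/continuous_normcP => e e0; apply/nbhs_norm3P; exists e => // z;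
  apply: le_lt_trans; exact: (normc_z3 (z - p)).
Qed.

Definition lin3 (a b c : C) z : C := a * z1 z + b * z2 z + c * z3 z.

Lemma lin3_linear a b c : linear (lin3 a b c).
Proof.
move=> k [[u1 u2] u3] [[v1 v2] v3]; rewrite /lin3 /z1 /z2 /z3 /=.
rewrite /GRing.scale /=; ring.
Qed.

HB.instance Definition _ a b c := GRing.isLinear.Build C C3 C _ (lin3 a b c) (lin3_linear a b c).

Lemma continuous_lin3 a b c : continuous (lin3 a b c).
Proof.
move=> z; apply: (@continuousD C C C3 (fun z => a * z1 z + b * z2 z) (fun z => c * z3 z)).
  apply: (@continuousD C C C3 (fun z => a * z1 z) (fun z => b * z2 z)).
    by apply: (@continuousM C C3 (fun=> a)); [exact: cst_continuous|exact: continuous_z1].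
  by apply: (@continuousM C C3 (fun=> b)); [exact: cst_continuous|exact: continuous_z2].
by apply: (@continuousM C C3 (fun=> c)); [exact: cst_continuous|exact: continuous_z3].
Qed.

Lemma linear_lin3 (L : {linear C3 -> C}) :
  exists a b c, forall z, L z = lin3 a b c z.
Proof.
exists (L (1, 0, 0)), (L (0, 1, 0)), (L (0, 0, 1)) => -[[u1 u2] u3].
have -> : (u1, u2, u3) = u1 *: ((1, 0, 0) : C3) + u2 *: ((0, 1, 0) : C3) + u3 *: ((0, 0, 1) : C3).
  transitivity ((u1 * 1 + u2 * 0 + u3 * 0, u1 * 0 + u2 * 1 + u3 * 0,
                 u1 * 0 + u2 * 0 + u3 * 1) : C3); last by [].
  by rewrite !(mulr0, mulr1, addr0, add0r).
by rewrite !linearD !linearZ /= /lin3 /z1 /z2 /z3 /=; rewrite /GRing.scale /=; ring.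
Qed.

Lemma differentiable3P f p : differentiable f p <-> exists a b c, forall e, 0 < e ->
  \forall z \near p, normc (f z - f p - lin3 a b c (z - p)) <= e * norm3 (z - p).
Proof.
rewrite differentiableCP; split=> [[L [_ Lf]]|[a [b [c lf]]]].
  have [a [b [c LE]]] := linear_lin3 L.
  exists a, b, c => e /Lf; apply: filterS => z.
  by rewrite LE normr_normc normr_norm3 -rmorphM /= lecR.
exists (lin3 a b c); split; first exact: continuous_lin3.
by move=> e /lf; apply: filterS => z; rewrite normr_normc normr_norm3 -rmorphM /= lecR.
Qed.

Lemma differentiable3_continuous f p : differentiable f p -> {for p, continuous f}.
Proof. exact: differentiable_continuous. Qed.

(** Second-order Taylor estimate on the disc of half the radius, from the expansion
of the Cauchy kernel. *)
Lemma taylor1 (g : C -> C) M : (forall w : C, normc w <= 1 -> differentiable g w) ->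
  (forall w : C, normc w = 1 -> normc (g w) <= M) ->
  exists a : C, forall w : C, normc w <= 1 / 2 -> normc (g w - g 0 - w * a) <= 2 * M * normc w ^+ 2.
Proof.
move=> dg gM; exists (cmean (fun u => g u / u) 0 1) => w w2.
have w1 : normc (w - 0) < 1 by rewrite subr0; move: w2; lra.
have dg0 u : normc (u - 0) <= 1 -> differentiable g u by rewrite subr0; exact: dg.
have z1 : normc ((0 : C) - 0) < 1 by rewrite subrr normc0.
have circle (u : C) : normc (u - 0) = 1 -> u != 0 /\ u != w.
  move=> u1; split; last by apply: circ_neq u1; rewrite lt_eqF.
  by apply: circ_neq u1; rewrite lt_eqF.
have cg u : normc (u - 0) = 1 -> {for u, continuous g}.
  by move=> u1; apply/differentiable1_continuous/dg0; rewrite u1.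
have cgk v u : normc (v - 0) < 1 -> normc (u - 0) = 1 -> {for u, continuous (fun u => g u * cker v 0 u)}.
  move=> v1 u1; apply: continuousM; first exact: cg.
  by apply/continuous_cker/circ_neq/u1; rewrite lt_eqF.
have cgi u : normc (u - 0) = 1 -> {for u, continuous (fun u => g u / u)}.
  move=> u1; have [u0 _] := circle u u1.
  by apply: continuousM; [exact: cg|apply: continuousV => //; exact: cvg_id].
have cwi u : normc (u - 0) = 1 -> {for u, continuous (fun u => w * (g u / u))}.
  by move=> u1; apply: continuousM; [exact: cst_continuous|exact: cgi].
have cB u : normc (u - 0) = 1 ->
    {for u, continuous (fun u => g u * cker w 0 u - g u * cker 0 0 u)}.
  by move=> u1; apply: continuousB; exact: cgk.
rewrite (cauchy_disc w1 dg0) (cauchy_disc z1 dg0) -(cmeanZ w ler01 cgi).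
rewrite -(cmeanB ler01 (fun u => cgk w u w1) (fun u => cgk 0 u z1)) -(cmeanB ler01 cB cwi).
apply: le_cmean; first exact: ler01.
  by move=> u u1; apply: continuousB; [exact: cB|exact: cwi].
move=> u u1; have [u0 uw] := circle u u1.
have -> : g u * cker w 0 u - g u * cker 0 0 u - w * (g u / u) = g u * (w ^+ 2 / (u * (u - w))).
  by rewrite /cker !subr0; field; rewrite subr_eq0 uw u0.
rewrite subr0 in u1.
have uw2 : 1 / 2 <= normc (u - w) by have := lerB_normc u w; rewrite u1; move: w2; clear; lra.
rewrite [normc (g u * _)]normcM [normc (_ / _)]normcM normcX normcV [normc (u * _)]normcM u1 mul1r.
have uw0 : 0 < normc (u - w) by rewrite (lt_le_trans _ uw2)// divr_gt0.
have M0 : 0 <= M by apply: le_trans (gM u u1); exact: normc_ge0.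
rewrite mulrA ler_pdivrMr//; apply: (@le_trans _ _ (M * normc w ^+ 2)).
  by rewrite ler_wpM2r ?sqr_ge0// gM.
have -> : 2 * M * normc w ^+ 2 * normc (u - w) = (M * normc w ^+ 2) * (2 * normc (u - w)) by ring.
have Mw0 : 0 <= M * normc w ^+ 2 by rewrite mulr_ge0 ?sqr_ge0.
by apply: ler_peMr => //; move: uw2; clear; lra.
Qed.

Lemma norm3Z w z : norm3 (w *: z) = normc w * norm3 z.
Proof.
have : `|w *: z| = `|w| * `|z| by rewrite normrZ.
by rewrite !normr_norm3 normr_normc -rmorphM => -[].
Qed.

Lemma norm3_eq0 z : norm3 z = 0 -> z = 0.
Proof. by move=> z0; apply/eqP; rewrite -normr_eq0 normr_norm3 z0. Qed.

Lemma norm30 : norm3 0 = 0.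
Proof. by rewrite -(scale0r (0 : C3)) norm3Z normc0 mul0r. Qed.

Lemma restrict_line f p k w a b c :
  (forall e, 0 < e -> \forall z \near p + w *: k,
     normc (f z - f (p + w *: k) - lin3 a b c (z - (p + w *: k))) <= e * norm3 (z - (p + w *: k))) ->
  forall e, 0 < e -> \forall v \near w,
    normc (f (p + v *: k) - f (p + w *: k) - lin3 a b c k * (v - w)) <= e * normc (v - w).
Proof.
move=> lf e e0; have k1 : 0 < norm3 k + 1 by rewrite ltr_wpDl// norm3_ge0.
have /nbhs_norm3P[r r0 pr] := lf _ (divr_gt0 e0 k1).
apply/nbhs_normcP; exists (r / (norm3 k + 1)); first by rewrite divr_gt0.
move=> v vw.
have dE : p + v *: k - (p + w *: k) = (v - w) *: k by rewrite opprD addrACA subrr add0r scalerBl.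
have knn := norm3_ge0 k.
have le1 : norm3 ((v - w) *: k) <= normc (v - w) * (norm3 k + 1).
  by rewrite norm3Z ler_wpM2l ?normc_ge0// lerDl.
have := pr (p + v *: k); rewrite dE linearZ /= [_ *: lin3 _ _ _ _]mulrC => pr'.
apply: le_trans (pr' _) _.
  by apply: le_lt_trans le1 _; rewrite -ltr_pdivlMr.
apply: le_trans (ler_wpM2l (ltW (divr_gt0 e0 k1)) le1) _.
by rewrite [_ * (norm3 k + 1)]mulrC mulrA divfK ?gt_eqF.
Qed.

Lemma differentiable_line f p k w :
  differentiable f (p + w *: k) -> differentiable (fun v => f (p + v *: k)) w.
Proof.
move=> /differentiable3P[a [b [c lf]]]; apply/differentiable1P; exists (lin3 a b c k).
exact: restrict_line lf.
Qed.

(** Taylor's estimate in one variable along each complex line through p; uniqueness of the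
derivative on the line identifies the linear term with the differential of f. *)
Lemma taylor3 f p r M : 0 < r -> (forall z, norm3 (z - p) <= r -> differentiable f z) ->
  (forall z, norm3 (z - p) <= r -> normc (f z) <= M) ->
  exists a b c, forall z, norm3 (z - p) <= r / 2 ->
    normc (f z - f p - lin3 a b c (z - p)) <= 2 * M / r ^+ 2 * norm3 (z - p) ^+ 2.
Proof.
move=> r0 df fM.
have dfp : differentiable f p by apply: df; rewrite subrr norm30 ltW.
have M0 : 0 <= M by apply: le_trans (normc_ge0 (f p)) (fM p _); rewrite subrr norm30 ltW.
have [a [b [c lf]]] := (differentiable3P f p).1 dfp.
exists a, b, c => z; set h := z - p; set N := norm3 h => zr.
have [N0|N0] := eqVneq N 0.
  have hz : h = 0 by exact: norm3_eq0.
  have -> : z = p by apply/eqP; rewrite -subr_eq0 -/h hz.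
  by rewrite hz linear0 !subrr normc0 N0 expr0n mulr0.
have {}N0 : 0 < N by rewrite lt_def N0 norm3_ge0.
(* The direction is scaled so that the unit disc of the line reaches distance r from p. *)
pose k := (r / N)%:C%C *: h; pose g w := f (p + w *: k).
have Nk : norm3 k = r.
  by rewrite norm3Z normc_real ger0_norm ?divr_ge0// ?ltW// -/N divfK// gt_eqF.
have line w : normc w <= 1 -> norm3 (p + w *: k - p) <= r.
  by move=> w1; rewrite addrC addKr norm3Z Nk ler_piMl// ltW.
have dg w : normc w <= 1 -> differentiable g w.
  by move=> w1; apply: differentiable_line; apply/df/line.
have gM w : normc w = 1 -> normc (g w) <= M.
  by move=> w1; apply/fM/line; rewrite w1.
have [a' ga'] := taylor1 dg gM.
have g0 : p + (0 : C) *: k = p by rewrite scale0r addr0.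
suff a'E : a' = lin3 a b c k.
  have nN : normc ((N / r)%:C%C : C) = N / r.
    by rewrite normc_real ger0_norm// divr_ge0// ltW.
  have Nr : N / r <= 1 / 2 by rewrite ler_pdivrMr// mul1r mulrC.
  have kE : (N / r)%:C%C *: k = h.
    rewrite /k scalerA -rmorphM /= mulrA divfK ?gt_eqF// divff ?gt_eqF//.
    by rewrite rmorph1 scale1r.
  have := ga' (N / r)%:C%C; rewrite nN => /(_ Nr).
  have -> : (N / r)%:C%C * a' = lin3 a b c h by rewrite a'E -[in RHS]kE [RHS]linearZ.
  rewrite /g g0 kE /h [p + _]addrC subrK => /le_trans; apply.
  by rewrite expr_div_n [_ * (N ^+ 2 / _)]mulrA [leRHS]mulrAC.
apply/eqP; rewrite -subr_eq0 -normc_eq0 eq_le normc_ge0 andbT; apply/ler_addgt0Pl => e e0.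
rewrite addr0; have e20 : 0 < e / 2 by rewrite divr_gt0.
have lf0 : forall e0, 0 < e0 -> \forall z \near p + (0 : C) *: k,
     normc (f z - f (p + (0 : C) *: k) - lin3 a b c (z - (p + (0 : C) *: k))) <=
     e0 * norm3 (z - (p + (0 : C) *: k)) by rewrite g0.
have /nbhs_normcP[d d0 dl] := restrict_line lf0 e20.
have M1 : 0 < 4 * (M + 1) by rewrite mulr_gt0// ltr_wpDl.
pose t := Num.min (1 / 2) (Num.min (d / 2) (e / (4 * (M + 1)))).
have t0 : 0 < t by rewrite !lt_min !divr_gt0.
have t1 : t <= 1 / 2 by rewrite ge_min lexx.
have t2 : t <= d / 2 by rewrite !ge_min lexx orbT.
have t3 : t <= e / (4 * (M + 1)) by rewrite !ge_min lexx !orbT.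
have nt : normc (t%:C%C : C) = t by rewrite normc_real gtr0_norm.
have := dl t%:C%C; rewrite subr0 nt => /(_ _)/[!g0] A.
have {}A : normc (g t%:C%C - g 0 - lin3 a b c k * t%:C%C) <= e / 2 * t.
  by rewrite /g g0; apply: A; move: t2 d0; clear; lra.
have B : normc (g t%:C%C - g 0 - t%:C%C * a') <= 2 * M * t ^+ 2.
  by have := ga' t%:C%C; rewrite nt; apply.
have : normc (t%:C%C * (a' - lin3 a b c k)) <= e * t.
  have -> : t%:C%C * (a' - lin3 a b c k) = (g t%:C%C - g 0 - lin3 a b c k * t%:C%C) -
      (g t%:C%C - g 0 - t%:C%C * a') by ring.
  apply: le_trans (ler_normcB _ _) _; apply: le_trans (lerD A B) _.
  have : t * (4 * (M + 1)) <= e by rewrite -ler_pdivlMr.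
  by move: t0 M0 e0; clear; nra.
by rewrite normcM nt mulrC ler_pM2r.
Qed.

End holomorphy_in_three_variables.

(** * Limits and integrals of holomorphic functions *)

Section limits_of_holomorphic_functions.
Variable R : realType.
Notation C := (CC R).
Notation C3 := (CC3 R).
Implicit Types (p z h : C3) (f : C3 -> C) (e r s t M a b : R) (u v w : C).

Lemma norm3E u v w :
  norm3 ((u, v, w) : C3) = Num.max (Num.max (normc u) (normc v)) (normc w).
Proof. by []. Qed.

(** Coefficients of the differentials form Cauchy sequences because the Taylor
estimate is uniform. *)
Lemma cvg_coefficient (F : nat -> C3 -> C) (f : C3 -> C) (l : nat -> C) p (k : C3) r M :
  0 < r -> 0 <= M -> (forall t, 0 < t <= r -> F n (p + t%:C%C *: k) @[n --> \oo] --> f (p + t%:C%C *: k)) ->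
  F n p @[n --> \oo] --> f p ->
  (forall n t, 0 < t <= r -> normc (F n (p + t%:C%C *: k) - F n p - t%:C%C * l n) <= M * t ^+ 2) ->
  exists l0 : C, l n @[n --> \oo] --> l0.
Proof.
move=> r0 M0 Fc Fp FM; apply: cauchy_cvgC => e e0.
have M1 : 0 < 4 * (M + 1) by rewrite mulr_gt0// ltr_wpDl.
(* At distance t the quadratic error is at most e t / 4, and pointwise convergence controls
the values at the two points. *)
pose t := Num.min r (e / (4 * (M + 1))).
have t0 : 0 < t by rewrite lt_min r0 divr_gt0.
have tr : t <= r by rewrite ge_min lexx.
have te : t * (4 * (M + 1)) <= e by rewrite -ler_pdivlMr// ge_min lexx orbT.
have t0r : 0 < t <= r by rewrite t0.
have e8 : 0 < e / 8 * t by rewrite mulr_gt0// divr_gt0.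
have /cvg_normcP/(_ _ e8)[N1 _ H1] := Fc t t0r.
have /cvg_normcP/(_ _ e8)[N2 _ H2] := Fp.
exists (maxn N1 N2) => j; set N := maxn N1 N2.
have P1 := H1 N (leq_maxl _ _).
have P2 := H2 N (leq_maxr _ _).
have Q1 := H1 (N + j)%N (leq_trans (leq_maxl _ _) (leq_addr _ _)).
have Q2 := H2 (N + j)%N (leq_trans (leq_maxr _ _) (leq_addr _ _)).
have E1 := FM N t t0r; have E2 := FM (N + j)%N t t0r.
move: P1 P2 Q1 Q2 E1 E2 => /=; set q := p + _.
set A := F N q; set B := F N p; set D := F (N + j)%N q; set E := F (N + j)%N p.
move=> P1 P2 Q1 Q2 E1 E2.
suff : normc (t%:C%C * (l (N + j)%N - l N)) <= t * e.
  by rewrite normcM normc_real gtr0_norm// ler_pM2l.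
have -> : t%:C%C * (l (N + j)%N - l N) =
    ((A - B - t%:C%C * l N) - (D - E - t%:C%C * l (N + j)%N)) +
    (((D - f q) - (A - f q)) - ((E - f p) - (B - f p))) by ring.
apply: le_trans (ler_normcD _ _) _.
apply: le_trans (lerD (ler_normcB _ _) (ler_normcB _ _)) _.
apply: le_trans (lerD (lerD E1 E2) (lerD (ler_normcB _ _) (ler_normcB _ _))) _.
by move: P1 P2 Q1 Q2 te t0 M0 e0; clear; nra.
Qed.

Lemma norm3_real_scale t (k : C3) : norm3 (t%:C%C *: k) = `|t| * norm3 k.
Proof. by rewrite norm3Z normc_real. Qed.

(** The differentials converge because the quadratic Taylor estimates hold with one constant;
the estimate then passes to the limit. *)
Lemma differentiable_lim (F : nat -> C3 -> C) f p r M : 0 < r ->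
  (forall n z, norm3 (z - p) <= r -> differentiable (F n) z) ->
  (forall n z, norm3 (z - p) <= r -> normc (F n z) <= M) ->
  (forall z, norm3 (z - p) <= r -> F n z @[n --> \oo] --> f z) ->
  differentiable f p.
Proof.
move=> r0 dF FM Ff.
have pp : norm3 (p - p) <= r by rewrite subrr norm30 ltW.
have M0 : 0 <= M by apply: le_trans (FM 0%N p pp); exact: normc_ge0.
pose K := 2 * M / r ^+ 2.
have K0 : 0 <= K by apply: divr_ge0; [exact: mulr_ge0|exact: sqr_ge0].
have /choice[L LP] n : exists L : C * C * C, forall z, norm3 (z - p) <= r / 2 ->
    normc (F n z - F n p - lin3 L.1.1 L.1.2 L.2 (z - p)) <= K * norm3 (z - p) ^+ 2.
  by have [a [b [c H]]] := taylor3 r0 (dF n) (FM n); exists (a, b, c).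
have cvgL (k : C3) : norm3 k = 1 -> exists l0 : C, lin3 (L n).1.1 (L n).1.2 (L n).2 k @[n --> \oo] --> l0.
  move=> k1.
  have tk t : 0 < t <= r / 2 -> norm3 (p + t%:C%C *: k - p) = t.
    by move=> /andP[t0 _]; rewrite addrC addKr norm3_real_scale k1 mulr1 gtr0_norm.
  apply: (@cvg_coefficient F f _ p k (r / 2) K) => //.
  - by rewrite divr_gt0.
  - move=> t tr; apply: Ff; rewrite tk//; case/andP: tr => _ tr.
    by move: tr r0; clear; lra.
  - exact: Ff.
  move=> n t tr; have := LP n (p + t%:C%C *: k); rewrite tk//.
  by rewrite [p + _]addrC addrK linearZ; apply; case/andP: tr.
have [a La] : exists a : C, (L n).1.1 @[n --> \oo] --> a.
  have [|a] := cvgL ((1, 0, 0) : C3).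
    by rewrite norm3E normc0 normc1 !max_l.
  by rewrite /lin3 /z1 /z2 /z3 /=; under eq_fun do rewrite mulr1 !mulr0 !addr0; exists a.
have [b Lb] : exists b : C, (L n).1.2 @[n --> \oo] --> b.
  have [|b] := cvgL ((0, 1, 0) : C3).
    by rewrite norm3E normc0 normc1 max_l// max_r.
  by rewrite /lin3 /z1 /z2 /z3 /=; under eq_fun do rewrite mulr1 !mulr0 addr0 add0r; exists b.
have [c Lc] : exists c : C, (L n).2 @[n --> \oo] --> c.
  have [|c] := cvgL ((0, 0, 1) : C3).
    by rewrite norm3E normc0 normc1 max_r// max_l.
  by rewrite /lin3 /z1 /z2 /z3 /=; under eq_fun do rewrite mulr1 !mulr0 !add0r; exists c.
have quad z : norm3 (z - p) <= r / 2 ->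
    normc (f z - f p - lin3 a b c (z - p)) <= K * norm3 (z - p) ^+ 2.
  move=> zr; have zr' : norm3 (z - p) <= r by move: zr r0; clear; lra.
  have cvgz : F n z - F n p - lin3 (L n).1.1 (L n).1.2 (L n).2 (z - p) @[n --> \oo]
      --> f z - f p - lin3 a b c (z - p).
    apply: cvgB; first by apply: cvgB; exact: Ff.
    exact: (cvgD (cvgD (cvgM La (cvg_cst _)) (cvgM Lb (cvg_cst _))) (cvgM Lc (cvg_cst _))).
  apply: (cvgr_to_le (cvg_normc cvgz)).
  by near=> n; exact: LP.
apply/differentiable3P; exists a, b, c => e e0; apply/nbhs_norm3P.
have K1 : 0 < K + 1 by rewrite ltr_wpDl.
exists (Num.min (r / 2) (e / (K + 1))); first by rewrite lt_min !divr_gt0.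
move=> z; rewrite lt_min => /andP[zr ze]; apply: le_trans (quad z (ltW zr)) _.
rewrite expr2 mulrA ler_wpM2r ?norm3_ge0//.
move: ze; rewrite ltr_pdivlMr// => ze; have := norm3_ge0 (z - p).
by move: ze K0; clear; nra.
Unshelve. all: by end_near. Qed.

Lemma differentiable_midsum (k : C3 -> R -> C) n a b p : a <= b ->
  (forall t, a <= t <= b -> differentiable (k^~ t) p) ->
  differentiable (fun z => midsum (k z) n a b) p.
Proof.
elim: n a b => [|n ih] a b ab dk /=.
  apply: (@differentiableM _ _ (fun=> (b - a)%:C%C) (fun z => k z ((a + b) / 2))).
    exact: differentiable_cst.
  by apply: dk; apply/andP; split; move: ab; clear; lra.
apply: (@differentiableD _ _ _ (fun z => midsum (k z) n a _) (fun z => midsum (k z) n _ b)).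
  apply: ih => [|t /andP[t1 t2]]; first by move: ab; clear; lra.
  by apply: dk; apply/andP; split; move: ab t1 t2; clear; lra.
apply: ih => [|t /andP[t1 t2]]; first by move: ab; clear; lra.
by apply: dk; apply/andP; split; move: ab t1 t2; clear; lra.
Qed.

(** The midpoint sums are holomorphic, uniformly bounded and converge to the integral. *)
Lemma differentiable_rint (k : C3 -> R -> C) a b p r M : a <= b -> 0 < r ->
  (forall z t, norm3 (z - p) <= r -> a <= t <= b -> differentiable (k^~ t) z) ->
  (forall z t, norm3 (z - p) <= r -> a <= t <= b -> normc (k z t) <= M) ->
  (forall z, norm3 (z - p) <= r -> cont_on (k z) a b) ->
  differentiable (fun z => rint (k z) a b) p.
Proof.
move=> ab r0 dk kM ck.
apply: (@differentiable_lim (fun n z => midsum (k z) n a b) _ p r ((b - a) * M)) => //.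
- by move=> n z zr; apply: differentiable_midsum => // t tab; exact: dk.
- by move=> n z zr; apply: le_midsum => // t tab; exact: kM.
- by move=> z zr; apply: midsum_cvg => //; exact: ck.
Qed.

End limits_of_holomorphic_functions.

(** * The identity theorem *)

Section identity_theorem.
Variable R : realType.
Notation C := (CC R).
Implicit Types (f g h : C -> C) (c p q u v w z xi zeta : C) (e r s t d M : R).

Lemma circle_bounded h c r : 0 <= r ->
  (forall z, normc (z - c) = r -> {for z, continuous h}) ->
  exists2 M, 0 <= M & forall t, 0 <= t <= 2 * pi -> normc (h (circ c r t)) <= M.
Proof.
move=> r0 ch.
have cn : {within `[0, 2 * pi], continuous (fun t => normc (h (circ c r t)))}.
  apply: continuous_in_subspaceT => t; rewrite inE /= in_itv /= => t2.
  exact: (cvg_normc (cont_circ r0 ch t2)).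
have [t0 _ t0M] := EVT_max (@pi2_ge0 R) cn.
exists (normc (h (circ c r t0))); first exact: normc_ge0.
by move=> t t2; apply: t0M; rewrite in_itv.
Qed.

Lemma differentiable_exp h n u : differentiable h u -> differentiable (fun v => h v ^+ n) u.
Proof.
move=> dh; elim: n => [|n ih].
  by under eq_fun do rewrite expr0; exact: differentiable_cst.
under eq_fun do rewrite exprS.
exact: (@differentiableM _ _ h (fun v => h v ^+ n)).
Qed.

(** Dividing h by a power of w - c leaves it holomorphic; the maximum principle
for the quotient gains an arbitrary power of a factor smaller than 1. *)
Lemma identity_disc h c r d : 0 < d -> (forall w, normc (w - c) <= r -> differentiable h w) ->
  (forall w, normc (w - c) < d -> h w = 0) -> forall w, normc (w - c) < r -> h w = 0.
Proof.
move=> d0 dh h0 w wr.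
have r0 : 0 < r by apply: le_lt_trans wr; exact: normc_ge0.
have [wc|wc] := ltP (normc (w - c)) d; first exact: h0.
have N0 : 0 < normc (w - c) by exact: lt_le_trans wc.
pose k n v := h v * (v - c)^-1 ^+ n.
have dk n v : normc (v - c) <= r -> differentiable (k n) v.
  move=> vr; have [->|vc] := eqVneq v c.
    apply: (@near_eq_differentiable _ _ (fun=> 0)); last exact: differentiable_cst.
    by apply/nbhs_normcP; exists d => // u ud; rewrite /k h0// mul0r.
  apply: (@differentiableM _ _ h (fun v => (v - c)^-1 ^+ n)); first exact: dh.
  apply: (@differentiable_exp (fun v => (v - c)^-1)).
  apply: (@differentiableV _ _ (fun v => v - c)); first exact: differentiable_subC.
  by rewrite subr_eq0.
have ch z : normc (z - c) = r -> {for z, continuous h}.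
  by move=> zr; apply/differentiable1_continuous/dh; rewrite zr.
have [M M0 hM] := circle_bounded (ltW r0) ch.
have rw0 : 0 < r - normc (w - c) by rewrite subr_gt0.
pose B := M * (r / (r - normc (w - c))).
have kB n : normc (h w) <= B * (normc (w - c) / r) ^+ n.
  have : normc (k n w) <= r ^- n * B.
    rewrite (cauchy_disc wr (dk n)); apply: le_cmean_cont.
      apply: (@cont_circ R (fun v => k n v * cker w c v) c r (ltW r0)) => z zr; apply: continuousM.
        by apply/differentiable1_continuous/dk; rewrite zr.
      by apply/continuous_cker/circ_neq/zr; rewrite lt_eqF.
    move=> t t2; have zr := normc_circ c t (ltW r0).
    rewrite normcM [normc (k _ _)]normcM normcX normcV zr /cker normcM normcV zr.
    have zw : r - normc (w - c) <= normc (circ c r t - w).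
      rewrite -{1}zr (_ : circ c r t - w = (circ c r t - c) - (w - c)) ?lerB_normc//; ring.
    have -> : r ^- n * B = (M * r^-1 ^+ n) * (r * (r - normc (w - c))^-1).
      by rewrite /B exprVn; ring.
    apply: ler_pM.
    - by rewrite mulr_ge0 ?normc_ge0// exprn_ge0// invr_ge0 ltW.
    - by rewrite mulr_ge0 ?invr_ge0 ?normc_ge0// ltW.
    - by rewrite ler_wpM2r ?hM// exprn_ge0// invr_ge0 ltW.
    - by rewrite ler_wpM2l ?(ltW r0)// lef_pV2// posrE (lt_le_trans rw0).
  rewrite normcM normcX normcV exprVn ler_pdivrMr ?exprn_gt0// => /le_trans; apply.
  by rewrite expr_div_n mulrAC mulrC [_ ^- n * _]mulrC.
apply/eqP; rewrite -normc_eq0 eq_le normc_ge0 andbT.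
have : B * (normc (w - c) / r) ^+ n @[n --> \oo] --> B * 0.
  apply: cvgM; first exact: cvg_cst.
  apply: cvg_expr; rewrite ger0_norm ?divr_ge0 ?normc_ge0 ?(ltW r0)//.
  by rewrite ltr_pdivrMr// mul1r.
rewrite mulr0 => /cvgr_to_ge; apply.
by near=> n; exact: kB.
Unshelve. all: by end_near. Qed.

(** A chain of discs of radius r along the segment. *)
Lemma identity_segment h p q r d : 0 < r -> 0 < d ->
  (forall t w, 0 <= t <= 1 -> normc (w - (p + t%:C%C * (q - p))) <= r -> differentiable h w) ->
  (forall w, normc (w - p) < d -> h w = 0) -> h q = 0.
Proof.
move=> r0 d0 dh h0.
pose N := (Num.truncn (normc (q - p) / r)).+1.
have NN : normc (q - p) / r < N%:R by exact: truncnS_gt.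
have N0 : 0 < N%:R :> R by rewrite ltr0n.
have step : normc (q - p) / N%:R < r.
  by rewrite ltr_pdivrMr// mulrC -ltr_pdivrMr.
pose x k : C := p + (k%:R / N%:R)%:C%C * (q - p).
have xS k : x k.+1 - x k = (N%:R^-1)%:C%C * (q - p).
  rewrite /x opprD addrACA subrr add0r -mulrBl -rmorphB /= -mulrBl.
  by rewrite -natr1 addrAC subrr add0r mul1r.
have dx k w : (k <= N)%N -> normc (w - x k) <= r -> differentiable h w.
  move=> kN; apply: dh; rewrite divr_ge0//= ler_pdivrMr// mul1r ler_nat.
  by [].
have zero k : (k <= N)%N -> forall w, normc (w - x k) < r -> h w = 0.
  elim: k => [_|k ih kN].
    apply: (@identity_disc h (x 0%N) r d) => //; first by move=> w; exact: dx.
    by move=> w; rewrite /x mul0r mul0r addr0; exact: h0.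
  pose e := r - normc (q - p) / N%:R.
  apply: (@identity_disc h (x k.+1) r e); first by rewrite subr_gt0.
    by move=> w; exact: dx.
  move=> w we; apply: (ih (ltnW kN)); apply: le_lt_trans (ler_distcD (x k.+1) _ _) _.
  rewrite xS normcM normc_real ger0_norm ?invr_ge0 ?(ltW N0)// [_ * normc _]mulrC.
  by rewrite -ltrBrDr.
apply: (zero N (leqnn N)); rewrite /x divff ?gt_eqF// rmorph1 mul1r.
by rewrite [p + _]addrC subrK subrr normc0.
Qed.

Lemma disc_convex xi p q t : normc (p - xi) < 1 -> normc (q - xi) < 1 -> 0 <= t <= 1 ->
  normc (p + t%:C%C * (q - p) - xi) <= Num.max (normc (p - xi)) (normc (q - xi)).
Proof.
move=> p1 q1 /andP[t0 t1].
have -> : p + t%:C%C * (q - p) - xi = (1 - t)%:C%C * (p - xi) + t%:C%C * (q - xi).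
  by rewrite rmorphB rmorph1 /=; ring.
apply: le_trans (ler_normcD _ _) _; rewrite !normcM !normc_real ger0_norm ?subr_ge0//.
rewrite ger0_norm//; set A := normc (p - xi); set B := normc (q - xi).
have : A <= Num.max A B by rewrite le_max lexx.
have : B <= Num.max A B by rewrite le_max lexx orbT.
by move: (Num.max A B) t0 t1; clear => m t0 t1 ? ?; nra.
Qed.

(** The intersection of the two discs is convex and has 0 on its boundary: inside it a segment
leads to q from points where f and g agree. *)
Lemma identity_lens f g xi zeta d q : normc xi = 1 -> normc zeta = 1 -> 0 < d ->
  (forall w, normc (w - xi) < 1 -> differentiable f w) ->
  (forall w, normc (w - zeta) < 1 -> differentiable g w) ->
  (forall w, normc w < d -> normc (w - xi) < 1 -> normc (w - zeta) < 1 -> f w = g w) ->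
  normc (q - xi) < 1 -> normc (q - zeta) < 1 -> f q = g q.
Proof.
move=> xi1 zeta1 d0 df dg fg qxi qzeta.
pose e := Num.min 1 (d / (2 * (normc q + 1))).
have q0 : 0 < 2 * (normc q + 1) by rewrite mulr_gt0// ltr_wpDl// normc_ge0.
have e0 : 0 < e by rewrite lt_min ltr01 divr_gt0.
have e1 : e <= 1 by rewrite ge_min lexx.
have ed : e * (2 * (normc q + 1)) <= d by rewrite -ler_pdivlMr// ge_min lexx orbT.
(* A point of the lens on the segment from 0 to q, within d / 2 of 0. *)
pose p : C := e%:C%C * q.
have pin z : normc z = 1 -> normc (q - z) < 1 -> normc (p - z) < 1.
  move=> nz qz; have -> : p - z = e%:C%C * (q - z) + (1 - e)%:C%C * (- z).
    by rewrite /p rmorphB rmorph1 /=; ring.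
  apply: le_lt_trans (ler_normcD _ _) _; rewrite !normcM !normc_real normcN nz mulr1.
  rewrite gtr0_norm// ger0_norm ?subr_ge0//.
  by move: e0 qz; clear; nra.
have pxi := pin _ xi1 qxi; have pzeta := pin _ zeta1 qzeta.
have pd : normc p <= d / 2.
  by rewrite normcM normc_real gtr0_norm//; move: ed (normc_ge0 q) e0; clear; nra.
pose A := Num.max (normc (p - xi)) (normc (q - xi)).
pose B := Num.max (normc (p - zeta)) (normc (q - zeta)).
have A1 : A < 1 by rewrite gt_max pxi.
have B1 : B < 1 by rewrite gt_max pzeta.
pose r := Num.min ((1 - A) / 2) ((1 - B) / 2).
have r0 : 0 < r by rewrite lt_min !divr_gt0// subr_gt0.
have rA : A + r < 1.
  have : r <= (1 - A) / 2 by rewrite ge_min lexx.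
  by move: A1; clear; lra.
have rB : B + r < 1.
  have : r <= (1 - B) / 2 by rewrite ge_min lexx orbT.
  by move: B1; clear; lra.
have inlens t w : 0 <= t <= 1 -> normc (w - (p + t%:C%C * (q - p))) <= r ->
    normc (w - xi) < 1 /\ normc (w - zeta) < 1.
  move=> t01 wr; split; apply: le_lt_trans (ler_distcD (p + t%:C%C * (q - p)) _ _) _.
    apply: le_lt_trans (lerD wr (disc_convex pxi qxi t01)) _.
    by rewrite -/A addrC.
  apply: le_lt_trans (lerD wr (disc_convex pzeta qzeta t01)) _.
  by rewrite -/B addrC.
apply/eqP; rewrite -subr_eq0; apply/eqP.
apply: (@identity_segment (fun w => f w - g w) p q r (Num.min r (d / 2))) => //.
- by rewrite lt_min r0 divr_gt0.
- move=> t w t01 /(inlens t w t01)[w1 w2].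
  by apply: (@differentiableB _ _ _ f g); [exact: df|exact: dg].
- move=> w; rewrite lt_min => /andP[wr wd].
  have t01 : 0 <= (0 : R) <= 1 by rewrite lexx ler01.
  have wr0 : normc (w - (p + (0 : R)%:C%C * (q - p))) <= r by rewrite mul0r addr0 ltW.
  have [w1 w2] := inlens 0 w t01 wr0.
  apply/eqP; rewrite subr_eq0; apply/eqP/fg => //.
  by have := lerB_normc w p; move: pd wd; clear; lra.
Qed.

End identity_theorem.

(** * Lebesgue measure and translations *)

Section lebesgue_measure_on_C3.
Variable R : realType.
Notation C := (CC R).
Notation C3 := (CC3 R).
Notation Rm := (measurableTypeR R).
Notation T6 := (Rm * Rm * Rm * Rm * Rm * Rm)%type.
Implicit Types (p z : C3) (e r : R) (U : set C3).

Let I (q e : R) : set Rm := `]q - e, q + e[.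

Let box6 (q1 q2 q3 q4 q5 q6 e : R) : set T6 :=
  I q1 e `*` I q2 e `*` I q3 e `*` I q4 e `*` I q5 e `*` I q6 e.

(** An open set is the union of the countably many rational cubes that it contains. *)
Lemma measurable_preimage_open U : open U -> measurable (@R6_to_CC3 R @^-1` U : set T6).
Proof.
move=> oU.
pose idx := (rat * rat * rat * rat * rat * rat * nat)%type.
pose B (i : idx) : set T6 := let: (q1, q2, q3, q4, q5, q6, n) := i in
  box6 (ratr q1) (ratr q2) (ratr q3) (ratr q4) (ratr q5) (ratr q6) n.+1%:R^-1.
pose F i : set T6 := if pselect (B i `<=` @R6_to_CC3 R @^-1` U) then B i else set0.
rewrite (_ : _ @^-1` _ = \bigcup_i F i); last first.
  apply/seteqP; split => [p /= Up|p [i _]]; last first.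
    by rewrite /F; case: pselect => // BU /BU.
  case: p Up => [[[[[x1 y1] x2] y2] x3] y3] Up.
  have /nbhs_norm3P[e e0 eU] := open_nbhs_nbhs (conj oU Up).
  have [n ne] : exists n, n.+1%:R^-1 < e / 4.
    have e40 : 0 < e / 4 by rewrite divr_gt0.
    exists (Num.truncn (e / 4)^-1); rewrite invf_plt ?posrE//; exact: truncnS_gt.
  set d := n.+1%:R^-1 in ne; have d0 : 0 < d by rewrite invr_gt0.
  have rat_near (x : R) : exists q : rat, x - d < ratr q < x + d.
    have : x - d < x + d by move: d0; clear; lra.
    by move=> /rat_in_itvoo[q]; rewrite in_itv /= => qx; exists q.
  have [q1 h1] := rat_near x1; have [q2 h2] := rat_near y1.
  have [q3 h3] := rat_near x2; have [q4 h4] := rat_near y2.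
  have [q5 h5] := rat_near x3; have [q6 h6] := rat_near y3.
  exists (q1, q2, q3, q4, q5, q6, n) => //.
  have Ix (x : R) q : x - d < ratr q < x + d -> I (ratr q) d x.
    by move=> /andP[? ?]; rewrite /I /= in_itv /=; apply/andP; split; lra.
  rewrite /F; case: pselect => [BU|]; first by do 5 (split; last exact: Ix); exact: Ix.
  case; move=> [[[[[a1 b1] a2] b2] a3] b3] [[[[[k1 k2] k3] k4] k5] k6] /=.
  apply: eU; rewrite norm3_lt.
  have le2 (x y : R) q : x - d < ratr q < x + d -> I (ratr q) d y -> `|y - x| < e / 2.
    rewrite /I /= in_itv /= => /andP[? ?] /andP[? ?].
    by rewrite ltr_norml; apply/andP; split; move: ne d0; lra.
  apply/and3P; split; apply: le_lt_trans (normc_le_ReIm _) _; rewrite (splitr e) /=; apply: ltrD;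
    by [exact: le2 h1 k1|exact: le2 h2 k2|exact: le2 h3 k3|exact: le2 h4 k4
       |exact: le2 h5 k5|exact: le2 h6 k6].
apply: countable_bigcupT_measurable; first exact: countableP.
move=> i; suff mB : measurable (B i).
  by rewrite /F; case: pselect => ?; [exact: mB|exact: measurable0].
case: i => [[[[[[q1 q2] q3] q4] q5] q6] n].
by do 5 (apply: measurableX; last exact: measurable_itv); exact: measurable_itv.
Qed.

Lemma measurable_fun_continuous6 U (h : C3 -> R) : open U ->
  (forall z, U z -> {for z, continuous h}) ->
  measurable_fun (@R6_to_CC3 R @^-1` U : set T6) (h \o @R6_to_CC3 R).
Proof.
move=> oU ch; apply: (measurability _ (RGenOpens.measurableE R)).
move=> _ [_ [a [b ->] <-]].
rewrite (_ : _ `&` _ = @R6_to_CC3 R @^-1` (U `&` h @^-1` `]a, b[%classic)); last by [].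
apply: measurable_preimage_open; rewrite openE => z [Uz hz].
apply: filterI; first exact: open_nbhs_nbhs.
by apply: ch => //; apply: open_nbhs_nbhs; split => //; exact: interval_open.
Qed.

Definition shift1 (a : R) (x : Rm) : Rm := x + a.

Lemma measurable_shift1 a : measurable_fun setT (shift1 a).
Proof. by apply: continuous_measurable_fun => x; apply: cvgD; [exact: cvg_id|exact: cvg_cst]. Qed.

Lemma lebesgue_measure_shift a (A : set Rm) : measurable A ->
  lebesgue_measure (shift1 a @^-1` A) = lebesgue_measure A.
Proof.
move=> mA; rewrite -/(pushforward lebesgue_measure (shift1 a) A).
have mf := measurable_shift1 a.
apply/esym/lebesgue_measure_unique => //= _ [[x y]] _ <-.
rewrite /pushforward (_ : _ @^-1` _ = `]x - a, y - a]%classic); last first.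
  by apply/seteqP; split => t /=; rewrite !in_itv /= /shift1 ltrBlDr lerBrDr.
rewrite /= !lebesgue_measure_itv/= !lte_fin ltrD2r; case: ifP => // _.
by rewrite -!EFinB; congr EFin; ring.
Qed.

End lebesgue_measure_on_C3.

Section product_invariance.
Context d1 d2 (T1 : measurableType d1) (T2 : measurableType d2) (R : realType).
Variables (m1 : {sigma_finite_measure set T1 -> \bar R}).
Variables (m2 : {sigma_finite_measure set T2 -> \bar R}).
Variables (s1 : T1 -> T1) (s2 : T2 -> T2).
Hypotheses (ms1 : measurable_fun setT s1) (ms2 : measurable_fun setT s2).
Hypothesis inv1 : forall A, measurable A -> m1 (s1 @^-1` A) = m1 A.
Hypothesis inv2 : forall A, measurable A -> m2 (s2 @^-1` A) = m2 A.

Definition prodmap (q : T1 * T2) : T1 * T2 := (s1 q.1, s2 q.2).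

Lemma measurable_prodmap : measurable_fun setT prodmap.
Proof.
apply/measurable_fun_pairP; split.
  exact: (measurableT_comp ms1 measurable_fst).
exact: (measurableT_comp ms2 measurable_snd).
Qed.

(** The product measure is determined by its values on rectangles. *)
Lemma product_measure_invariant (A : set (T1 * T2)) : measurable A ->
  (m1 \x m2)%E (prodmap @^-1` A) = (m1 \x m2)%E A.
Proof.
move=> mA; rewrite -/(pushforward (m1 \x m2)%E prodmap A).
have mf := measurable_prodmap.
apply/esym/product_measure_unique => // B D mB mD.
change ((m1 \x m2)%E ((s1 @^-1` B) `*` (s2 @^-1` D)) = (m1 B * m2 D)%E).
have mB' : measurable (s1 @^-1` B) by rewrite -[X in measurable X]setTI; exact: ms1.
have mD' : measurable (s2 @^-1` D) by rewrite -[X in measurable X]setTI; exact: ms2.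
by rewrite product_measure1E//; congr (_ * _)%E; [exact: inv1|exact: inv2].
Qed.

End product_invariance.

Section invariant_integral.
Context d (T : measurableType d) (R : realType) (m : {measure set T -> \bar R}).
Variables (s : T -> T) (ms : measurable_fun setT s).
Hypothesis inv : forall A, measurable A -> m (s @^-1` A) = m A.

Lemma integral_invariant (A : set T) (f : T -> \bar R) : measurable A ->
  measurable_fun A f -> (forall q, A q -> (0 <= f q)%E) ->
  (\int[m]_(q in s @^-1` A) f (s q) = \int[m]_(q in A) f q)%E.
Proof.
move=> mA mf f0.
have f0' : {in A, forall q, (0 <= f q)%E} by move=> q; rewrite inE; exact: f0.
rewrite -(ge0_integral_pushforward ms m mA mf f0').
apply: eq_measure_integral => B mB _; exact: inv.
Qed.

End invariant_integral.

Section sigma_finite_product.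
Context d1 d2 (T1 : measurableType d1) (T2 : measurableType d2) (R : realType).
Variables (m1 : {sigma_finite_measure set T1 -> \bar R}).
Variables (m2 : {sigma_finite_measure set T2 -> \bar R}).

(** The product measure, named so as to carry its sigma-finiteness. *)
Definition sfprod : set (T1 * T2)%type -> \bar R := product_measure1 m1 m2.

Lemma sigma_finite_sfprod : sigma_finite setT sfprod.
Proof.
exact: (isSigmaFinite.sigma_finiteT
  (lebesgue_integral_fubini.measure_function_Measure_isSigmaFinite__to__measure_function_isSigmaFinite
     m1 m2)).
Qed.

HB.instance Definition _ := Measure.on sfprod.
HB.instance Definition _ := Measure_isSigmaFinite.Build _ _ _ sfprod sigma_finite_sfprod.

End sigma_finite_product.

Section lebesgue_translation.
Variable R : realType.
Notation C := (CC R).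
Notation C3 := (CC3 R).
Notation Rm := (measurableTypeR R).
Implicit Types (p z v : C3) (e r : R) (U : set C3).

(** The factors are adjoined one at a time: what is proved for a product of two spaces is
applied five times. *)
Definition Rm2 : measurableType _ := (Rm * Rm)%type.
Definition Rm3 : measurableType _ := (Rm2 * Rm)%type.
Definition Rm4 : measurableType _ := (Rm3 * Rm)%type.
Definition Rm5 : measurableType _ := (Rm4 * Rm)%type.
Definition Rm6 : measurableType _ := (Rm5 * Rm)%type.

Definition leb : {measure set Rm6 -> \bar R} := leb6 R.

Definition toC3 : Rm6 -> C3 := @R6_to_CC3 R.

Definition shift6 (v : C3) : Rm6 -> Rm6 :=
  let s (a : R) := @shift1 R a in
  prodmap (prodmap (prodmap (prodmap (prodmap
    (s (complex.Re (z1 v))) (s (complex.Im (z1 v))))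
    (s (complex.Re (z2 v)))) (s (complex.Im (z2 v))))
    (s (complex.Re (z3 v)))) (s (complex.Im (z3 v))).

Lemma toC3_shift v q : toC3 (shift6 v q) = toC3 q + v.
Proof.
case: q => [[[[[x1 y1] x2] y2] x3] y3]; case: v => [[[a1 b1] [a2 b2]] [a3 b3]].
reflexivity.
Qed.

Lemma measurable_shift6 v : measurable_fun setT (shift6 v).
Proof.
have ms := @measurable_shift1 R; rewrite /shift6 /=.
apply: (@measurable_prodmap _ _ Rm5 Rm); last exact: ms.
apply: (@measurable_prodmap _ _ Rm4 Rm); last exact: ms.
apply: (@measurable_prodmap _ _ Rm3 Rm); last exact: ms.
apply: (@measurable_prodmap _ _ Rm2 Rm); last exact: ms.
by apply: (@measurable_prodmap _ _ Rm Rm); exact: ms.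
Qed.

Let l : {sigma_finite_measure set Rm -> \bar R} := lebesgue_measure.

Let prod_shift d (T : measurableType d) (m : {sigma_finite_measure set T -> \bar R})
    (s : T -> T) (a : R) : measurable_fun setT s ->
    (forall A, measurable A -> m (s @^-1` A) = m A) ->
  forall A : set (T * Rm), measurable A ->
    (m \x l)%E (prodmap s (@shift1 R a) @^-1` A) = (m \x l)%E A.
Proof.
move=> ms inv A mA; apply: (product_measure_invariant ms (@measurable_shift1 R a) inv) => // B.
exact: lebesgue_measure_shift.
Qed.

Lemma leb_shift v (A : set Rm6) : measurable A -> leb (shift6 v @^-1` A) = leb A.
Proof.
have ms := @measurable_shift1 R.
have inv1 a := @lebesgue_measure_shift R a.
have inv2 a b := @prod_shift _ _ l _ b (ms a) (inv1 a).
have m2 a b := measurable_prodmap (ms a) (ms b).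
have inv3 a b c := @prod_shift _ Rm2 (sfprod l l) _ c (m2 a b) (inv2 a b).
have m3 a b c := measurable_prodmap (m2 a b) (ms c).
have inv4 a b c d := @prod_shift _ Rm3 (sfprod (sfprod l l) l) _ d (m3 a b c) (inv3 a b c).
have m4 a b c d := measurable_prodmap (m3 a b c) (ms d).
have inv5 a b c d e :=
  @prod_shift _ Rm4 (sfprod (sfprod (sfprod l l) l) l) _ e (m4 a b c d) (inv4 a b c d).
have m5 a b c d e := measurable_prodmap (m4 a b c d) (ms e).
have inv6 a b c d e f := @prod_shift _ Rm5
  (sfprod (sfprod (sfprod (sfprod l l) l) l) l) _ f (m5 a b c d e) (inv5 a b c d e).
exact: inv6.
Qed.

Lemma integral_shift6 v (A : set Rm6) (f : Rm6 -> \bar R) : measurable A ->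
  measurable_fun A f -> (forall q, A q -> (0 <= f q)%E) ->
  (\int[leb]_(q in shift6 v @^-1` A) f (shift6 v q) = \int[leb]_(q in A) f q)%E.
Proof. exact: (integral_invariant (@measurable_shift6 v) (@leb_shift v)). Qed.

Lemma measurable_open_toC3 U : open U -> measurable (toC3 @^-1` U).
Proof. exact: measurable_preimage_open. Qed.

Lemma measurable_continuous_toC3 U (h : C3 -> R) : open U ->
  (forall z, U z -> {for z, continuous h}) -> measurable_fun (toC3 @^-1` U) (h \o toC3).
Proof. exact: measurable_fun_continuous6. Qed.

End lebesgue_translation.

(** * Integrals depending on a parameter in a measure space *)

Section fatou_for_riemann_integrals.
Context d (T : measurableType d) (R : realType) (m : {measure set T -> \bar R}).
Notation C := (CC R).
Implicit Types (D : set T) (F : T -> C) (a b : R).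

Definition cmeasurable D F :=
  measurable_fun D (fun x => complex.Re (F x)) /\ measurable_fun D (fun x => complex.Im (F x)).

Lemma cmeasurableD D F G : cmeasurable D F -> cmeasurable D G ->
  cmeasurable D (fun x => F x + G x).
Proof.
move=> [F1 F2] [G1 G2]; split.
  rewrite (_ : (fun _ => _) = (fun x => complex.Re (F x) + complex.Re (G x))).
    exact: measurable_funD.
  by apply/funext => x; case: (F x) => ? ?; case: (G x).
rewrite (_ : (fun _ => _) = (fun x => complex.Im (F x) + complex.Im (G x))).
  exact: measurable_funD.
by apply/funext => x; case: (F x) => ? ?; case: (G x).
Qed.

Lemma cmeasurableZ D F (k : R) : cmeasurable D F -> cmeasurable D (fun x => k%:C%C * F x).
Proof.
move=> [F1 F2]; split.
  rewrite (_ : (fun _ => _) = (fun x => k * complex.Re (F x))).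
    by apply: measurable_funM => //; exact: measurable_cst.
  by apply/funext => x; case: (F x) => ? ? /=; rewrite mul0r subr0.
rewrite (_ : (fun _ => _) = (fun x => k * complex.Im (F x))).
  by apply: measurable_funM => //; exact: measurable_cst.
by apply/funext => x; case: (F x) => ? ? /=; rewrite mul0r addr0.
Qed.

Lemma measurable_normc D F : cmeasurable D F -> measurable_fun D (fun x => (normc (F x))%:E).
Proof.
move=> [F1 F2]; apply/measurable_EFinP.
rewrite (_ : (fun _ => _) =
    (fun x => Num.sqrt (complex.Re (F x) ^+ 2 + complex.Im (F x) ^+ 2))); last first.
  by apply/funext => x; case: (F x).
apply: (measurableT_comp (f := @Num.sqrt R)); last first.
  by apply: measurable_funD; exact: measurable_funX.
by apply: continuous_measurable_fun; exact: sqrt_continuous.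
Qed.

Variables (D : set T) (mD : measurable D) (G : T -> R -> C) (a b : R) (K : \bar R).
Hypothesis ab : a <= b.
Hypothesis mG : forall t, a <= t <= b -> cmeasurable D (G^~ t).
Hypothesis cG : forall x, D x -> cont_on (G x) a b.
Hypothesis GK : forall t, a <= t <= b -> (\int[m]_(x in D) (normc (G x t))%:E <= K)%E.

Let cmeasurable_midsum n a' b' : a <= a' -> a' <= b' -> b' <= b ->
  cmeasurable D (fun x => midsum (G x) n a' b').
Proof.
elim: n a' b' => [|n ih] a' b' aa' ab' bb' /=.
  by apply: cmeasurableZ; apply: mG; apply/andP; split; lra.
by apply: cmeasurableD; apply: ih => //; lra.
Qed.

Let K0 : (0 <= K)%E.
Proof.
have aab : a <= a <= b by rewrite lexx.
apply: le_trans (GK aab); apply: integral_ge0 => x _.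
by rewrite lee_fin normc_ge0.
Qed.

Let integral_midsum n a' b' : a <= a' -> a' <= b' -> b' <= b ->
  (\int[m]_(x in D) (normc (midsum (G x) n a' b'))%:E <= (b' - a')%:E * K)%E.
Proof.
elim: n a' b' => [|n ih] a' b' aa' ab' bb' /=.
  have mid : a <= (a' + b') / 2 <= b by apply/andP; split; lra.
  have ba0 : 0 <= b' - a' by rewrite subr_ge0.
  rewrite (eq_integral (fun x => (b' - a')%:E * (normc (G x ((a' + b') / 2)))%:E)%E); last first.
    by move=> x _; rewrite normcM normc_real ger0_norm.
  rewrite ge0_integralZl//; last 2 first.
  - by apply: measurable_normc; exact: mG.
  - by move=> x _; rewrite lee_fin normc_ge0.
  by apply: lee_wpmul2l; [rewrite lee_fin|exact: GK].
set c := (a' + b') / 2.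
have ac : a' <= c by rewrite /c; lra.
have cb : c <= b' by rewrite /c; lra.
have m1 := @cmeasurable_midsum n a' c aa' ac (le_trans cb bb').
have m2 := @cmeasurable_midsum n c b' (le_trans aa' ac) cb bb'.
apply: (@le_trans _ _ (\int[m]_(x in D)
    ((normc (midsum (G x) n a' c))%:E + (normc (midsum (G x) n c b'))%:E))%E).
  apply: ge0_le_integral => //.
  - by move=> x _; rewrite lee_fin normc_ge0.
  - by apply: measurable_normc; exact: cmeasurableD.
  - by apply: emeasurable_funD; exact: measurable_normc.
  - by move=> x _; rewrite -EFinD lee_fin; exact: le_normcD.
rewrite ge0_integralD//; last 4 first.
- by move=> x _; rewrite lee_fin normc_ge0.
- exact: measurable_normc.
- by move=> x _; rewrite lee_fin normc_ge0.
- exact: measurable_normc.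
have -> : (b' - a')%:E = ((c - a')%:E + (b' - c)%:E)%E by rewrite -EFinD; congr EFin; ring.
rewrite ge0_muleDl ?lee_fin ?subr_ge0//; apply: leeD.
  exact: ih aa' ac (le_trans cb bb').
exact: ih (le_trans aa' ac) cb bb'.
Qed.

(** Fatou's lemma along the midpoint sums, each of which involves finitely many of the slices
whose integrals are bounded by K. *)
Lemma le_integral_rint :
  (\int[m]_(x in D) (normc (rint (G x) a b))%:E <= (b - a)%:E * K)%E.
Proof.
pose S n x := (normc (midsum (G x) n a b))%:E.
have mS n : measurable_fun D (S n).
  by apply: measurable_normc; exact: cmeasurable_midsum.
have S0 n x : D x -> (0 <= S n x)%E by rewrite lee_fin normc_ge0.
rewrite (eq_integral (fun x => limn_einf (S ^~ x))); last first.
  move=> x; rewrite inE => Dx; apply/esym; apply: (cvg_limn_einf_sup _).1.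
  by apply: cvg_EFin; [near=> n|apply: cvg_normc; apply: midsum_cvg => //; exact: cG].
apply: le_trans (fatou m mD mS S0) _.
rewrite limn_einf_lim; apply: lime_le; first exact: is_cvg_einfs.
near=> n; apply: (@le_trans _ _ (\int[m]_(x in D) S n x)%E).
  by apply: ereal_inf_lbound; exists n => /=.
exact: integral_midsum.
Unshelve. all: by end_near. Qed.

End fatou_for_riemann_integrals.

(** * The Bergman inequality *)

Section bergman_estimate.
Variable R : realType.
Notation C := (CC R).
Notation C3 := (CC3 R).
Implicit Types (p z c k : C3) (e r s t : R) (O U V : set C3) (u v w : C) (f phi : C3 -> C).

Lemma cmeasurable_continuous O phi : open O -> (forall c, O c -> {for c, continuous phi}) ->
  cmeasurable (@toC3 R @^-1` O) (phi \o @toC3 R).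
Proof.
move=> oO cphi; split.
  by apply: (@measurable_continuous_toC3 R O (fun z => complex.Re (phi z))) => // z Oz;
    apply: cvg_ReC; exact: cphi.
by apply: (@measurable_continuous_toC3 R O (fun z => complex.Im (phi z))) => // z Oz;
  apply: cvg_ImC; exact: cphi.
Qed.

Lemma continuous_translate k c : {for c, continuous (fun z : C3 => z + k)}.
Proof. by apply: cvgD; [exact: cvg_id|exact: cvg_cst]. Qed.

(** Cauchy's formula along the direction k, over circles moving with c: averaging it over c
compares the two integrals by translation invariance. The kernel is bounded by 2 because
lam c is at most half the radius. *)
Lemma integral_mean_step phi (lam : C3 -> C) k O O' r : 0 < r -> open O -> open O' ->
  (forall c, O c -> normc (lam c) <= r / 2) ->
  (forall c, O c -> {for c, continuous lam}) ->
  (forall c w, O c -> normc w <= r -> differentiable phi (c + w *: k)) ->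
  (forall c w, O c -> normc w = r -> O' (c + w *: k)) ->
  (forall c, O' c -> {for c, continuous phi}) ->
  (\int[leb R]_(q in @toC3 R @^-1` O) (normc (phi (toC3 q + lam (toC3 q) *: k)))%:E <=
   2%:E * \int[leb R]_(q in @toC3 R @^-1` O') (normc (phi (toC3 q)))%:E)%E.
Proof.
move=> r0 oO oO' lamr clam dphi OO' cphi.
pose g (c : C3) (t : R) : C := phi (c + circ 0 r t *: k) * cker (lam c) 0 (circ 0 r t).
pose G q (t : R) : C := (2 * pi)^-1%:C%C * g (toC3 q) t.
set J := (\int[leb R]_(q in @toC3 R @^-1` O') (normc (phi (toC3 q)))%:E)%E.
have mO := measurable_open_toC3 oO; have mO' := measurable_open_toC3 oO'.
have ncirc t : normc (circ (0 : C) r t) = r by rewrite -[X in normc X]subr0 normc_circ ?ltW.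
have lamne c t : O c -> circ 0 r t != lam c.
  move=> Oc; apply/eqP => E; have := lamr c Oc; rewrite -E ncirc; move: r0; clear; lra.
have cg t c : O c -> {for c, continuous (g^~ t)}.
  move=> Oc; apply: continuousM.
    apply: (continuous_comp (@continuous_translate _ c)).
    by apply: cphi; apply: OO'.
  apply: (@continuousM _ _ (fun=> circ 0 r t - 0)); first exact: cst_continuous.
  apply: continuousV; first by rewrite subr_eq0; exact: lamne.
  by apply: continuousB; [exact: cst_continuous|exact: clam].
have dline c w : O c -> normc (w - 0) <= r -> differentiable (fun v : C => phi (c + v *: k)) w.
  by rewrite subr0 => Oc wr; apply: differentiable_line; exact: dphi.
have lam1 c : O c -> normc (lam c - 0) < r.
  by move=> Oc; rewrite subr0; apply: le_lt_trans (lamr c Oc) _; move: r0; clear; lra.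
have cgt c : O c -> cont_on (g c) 0 (2 * pi).
  move=> Oc; 
  apply: (@cont_circ R (fun w => phi (c + w *: k) * cker (lam c) 0 w) 0 r (ltW r0)) => w wr.
  apply: continuousM.
    by apply/differentiable1_continuous/dline; rewrite // wr.
  apply/continuous_cker/circ_neq/wr; rewrite lt_eqF//; exact: lam1.
have phiE c : O c -> phi (c + lam c *: k) = rint (fun t => (2 * pi)^-1%:C%C * g c t) 0 (2 * pi).
  move=> Oc; rewrite rintZ ?pi2_ge0//; last exact: cgt.
  exact: (cauchy_disc (lam1 c Oc) (fun w => dline c w Oc)).
rewrite (eq_integral (fun q => (normc (rint (G q) 0 (2 * pi)))%:E)); last first.
  by move=> q; rewrite inE => Oq; rewrite phiE.
have pi0 : 0 < 2 * pi :> R by exact: pi2_gt0.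
apply: le_trans (@le_integral_rint _ _ _ (leb R) _ mO G 0 (2 * pi) ((2 * pi)^-1%:E * (2%:E * J))%E
  (ltW pi0) _ _ _) _.
- move=> t _; apply: cmeasurableZ.
  exact: (@cmeasurable_continuous O (g^~ t) oO (cg t)).
- move=> q Oq t t01.
  by apply: (@continuousM _ _ (fun=> (2 * pi)^-1%:C%C)); [exact: cst_continuous|exact: cgt].
- move=> t _.
  have i0 : 0 <= (2 * pi)^-1 :> R by rewrite invr_ge0 ltW.
  pose v : C3 := circ 0 r t *: k.
  have shO : @toC3 R @^-1` O `<=` shift6 v @^-1` (@toC3 R @^-1` O').
    by move=> q Oq; change (O' (toC3 (shift6 v q))); rewrite toC3_shift; exact: OO'.
  have mphi : measurable_fun (@toC3 R @^-1` O') (fun q => (normc (phi (toC3 q)))%:E).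
    exact: (measurable_normc (cmeasurable_continuous oO' cphi)).
  have mphiv : measurable_fun (shift6 v @^-1` (@toC3 R @^-1` O'))
      (fun q => (normc (phi (toC3 (shift6 v q))))%:E).
    apply: (@measurable_comp _ _ _ _ _ _ (@toC3 R @^-1` O') _ _ (shift6 v) mO' _ mphi).
      by move=> _ [q /= + <-].
    exact: measurable_funTS (measurable_shift6 _).
  have mO'v : measurable (shift6 v @^-1` (@toC3 R @^-1` O')).
    by rewrite -[X in measurable X]setTI; exact: measurable_shift6.
  apply: (@le_trans _ _ (\int[leb R]_(q in @toC3 R @^-1` O)
      ((2 * pi)^-1%:E * (2%:E * (normc (phi (toC3 (shift6 v q))))%:E)))%E).
    apply: ge0_le_integral => //.
    + by move=> q _; rewrite lee_fin normc_ge0.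
    + apply: measurable_normc; apply: cmeasurableZ.
      exact: (@cmeasurable_continuous O (g^~ t) oO (cg t)).
    + do 2 apply: measurable_funeM.
      exact: measurable_funS mphiv.
    + move=> q Oq; rewrite -!EFinM lee_fin normcM normc_real ger0_norm// ler_wpM2l//.
      rewrite /g normcM toC3_shift -/v mulrC ler_wpM2r ?normc_ge0//.
      rewrite /cker normcM normcV subr0 ncirc ler_pdivrMr; last first.
        by rewrite normc_gt0 subr_eq0; exact: lamne.
      have := lerB_normc (circ 0 r t) (lam (toC3 q)); rewrite ncirc.
      have := lamr _ Oq; lra.
  have s1 : (\int[leb R]_(q in @toC3 R @^-1` O) (normc (phi (toC3 (shift6 v q))))%:E <= J)%E.
    rewrite /J -(integral_shift6 v mO' mphi); last by move=> q _; rewrite lee_fin normc_ge0.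
    by apply: ge0_subset_integral => // q _; rewrite lee_fin normc_ge0.
  have mphiO : measurable_fun (@toC3 R @^-1` O) (fun q => (normc (phi (toC3 (shift6 v q))))%:E).
    exact: measurable_funS mphiv.
  rewrite ge0_integralZl//; last 2 first.
  + exact: measurable_funeM.
  + by move=> q _; rewrite -EFinM lee_fin mulr_ge0// normc_ge0.
  apply: lee_wpmul2l; first by rewrite lee_fin.
  rewrite ge0_integralZl//; last by move=> q _; rewrite lee_fin normc_ge0.
  by apply: lee_wpmul2l.
rewrite muleA -EFinM subr0 divff ?mul1e//.
by rewrite gt_eqF.
Qed.

End bergman_estimate.

Section bergman_inequality.
Variable R : realType.
Notation C := (CC R).
Notation C3 := (CC3 R).
Implicit Types (p z c k : C3) (e r s t a b : R) (O U V : set C3) (u v w : C) (f phi : C3 -> C).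

Lemma differentiable_lin3 (k l m : C) c : differentiable (lin3 k l m) c.
Proof.
apply/differentiable3P; exists k, l, m => e e0; near=> z.
by rewrite linearB subrr normc0 mulr_ge0 ?norm3_ge0// ltW.
Unshelve. all: by end_near. Qed.

Lemma differentiable_z1 c : differentiable (@z1 R) c.
Proof.
rewrite (_ : @z1 R = lin3 1 0 0); first exact: differentiable_lin3.
by apply/funext => z; rewrite /lin3 mul1r !mul0r !addr0.
Qed.

Lemma differentiable_z2 c : differentiable (@z2 R) c.
Proof.
rewrite (_ : @z2 R = lin3 0 1 0); first exact: differentiable_lin3.
by apply/funext => z; rewrite /lin3 mul1r !mul0r addr0 add0r.
Qed.

Lemma differentiable_z3 c : differentiable (@z3 R) c.
Proof.
rewrite (_ : @z3 R = lin3 0 0 1); first exact: differentiable_lin3.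
by apply/funext => z; rewrite /lin3 mul1r !mul0r !add0r.
Qed.

Lemma differentiable_comp3 phi (g1 g2 g3 : C3 -> C) c :
  differentiable g1 c -> differentiable g2 c -> differentiable g3 c ->
  differentiable phi (g1 c, g2 c, g3 c) ->
  differentiable (fun z => phi (g1 z, g2 z, g3 z)) c.
Proof.
move=> d1 d2 d3 dphi.
have d123 : differentiable (fun z => (g1 z, g2 z, g3 z) : C3) c.
  exact: (differentiable_pair (differentiable_pair d1 d2) d3).
exact: (@differentiable_comp _ _ _ _ (fun z => (g1 z, g2 z, g3 z) : C3) phi c d123 dphi).
Qed.

Lemma differentiable_slice1 phi u v w : differentiable phi ((u, v, w) : C3) ->
  differentiable (fun u => phi ((u, v, w) : C3)) u.
Proof.
move=> d; apply: (@differentiable_comp _ _ _ _ (fun u => (u, v, w) : C3) phi u _ d).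
by apply: differentiable_pair; [apply: differentiable_pair|]; first [exact: ex_diff|exact: differentiable_cst].
Qed.

Lemma differentiable_slice2 phi u v w : differentiable phi ((u, v, w) : C3) ->
  differentiable (fun v => phi ((u, v, w) : C3)) v.
Proof.
move=> d; apply: (@differentiable_comp _ _ _ _ (fun v => (u, v, w) : C3) phi v _ d).
by apply: differentiable_pair; [apply: differentiable_pair|]; first [exact: ex_diff|exact: differentiable_cst].
Qed.

Lemma differentiable_slice3 phi u v w : differentiable phi ((u, v, w) : C3) ->
  differentiable (fun w => phi ((u, v, w) : C3)) w.
Proof.
move=> d; apply: (@differentiable_comp _ _ _ _ (fun w => (u, v, w) : C3) phi w _ d).
by apply: differentiable_pair; [apply: differentiable_pair|]; first [exact: ex_diff|exact: differentiable_cst].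
Qed.

Definition polydisc p a b e : set C3 :=
  [set z | [/\ normc (z1 z - z1 p) < a, normc (z2 z - z2 p) < b & normc (z3 z - z3 p) < e]].

Lemma open_polydisc p a b e : open (polydisc p a b e).
Proof.
have near_lt (g : C3 -> C) (q : C) (s : R) z : {for z, continuous g} ->
    normc (g z - q) < s -> \forall y \near z, normc (g y - q) < s.
  move=> /continuous_normcP cg gs; have s0 : 0 < s - normc (g z - q) by rewrite subr_gt0.
  apply: filterS (cg _ s0) => y; rewrite ltrBrDr; apply: le_lt_trans.
  exact: ler_distcD.
rewrite openE => z [h1 h2 h3]; near=> y; split; near: y.
- exact: (near_lt (@z1 R) _ _ z (@continuous_z1 R z)).
- exact: (near_lt (@z2 R) _ _ z (@continuous_z2 R z)).
- exact: (near_lt (@z3 R) _ _ z (@continuous_z3 R z)).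
Unshelve. all: by end_near. Qed.

Let I r (a : R) : set (measurableTypeR R) := `]a - r / 2, a + r / 2[%classic.
Let B2 r a1 b1 : set (Rm2 R) := I r a1 `*` I r b1.
Let B3 r a1 b1 a2 : set (Rm3 R) := B2 r a1 b1 `*` I r a2.
Let B4 r a1 b1 a2 b2 : set (Rm4 R) := B3 r a1 b1 a2 `*` I r b2.
Let B5 r a1 b1 a2 b2 a3 : set (Rm5 R) := B4 r a1 b1 a2 b2 `*` I r a3.

Definition cube r a1 b1 a2 b2 a3 b3 : set (Rm6 R) := B5 r a1 b1 a2 b2 a3 `*` I r b3.

Lemma measurable_cube r a1 b1 a2 b2 a3 b3 : measurable (cube r a1 b1 a2 b2 a3 b3).
Proof. by do 5 (apply: measurableX; last exact: measurable_itv); exact: measurable_itv. Qed.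

Lemma leb_cube r a1 b1 a2 b2 a3 b3 : 0 < r -> leb R (cube r a1 b1 a2 b2 a3 b3) = (r ^+ 6)%:E.
Proof.
move=> r0.
have mI a : measurable (I r a) by exact: measurable_itv.
have lI a : lebesgue_measure (I r a) = r%:E.
  rewrite /I lebesgue_measure_itv /= lte_fin ifT; last lra.
  by rewrite -EFinB; congr EFin; field.
have mB2 : measurable (B2 r a1 b1) by exact: measurableX.
have mB3 : measurable (B3 r a1 b1 a2) by exact: measurableX.
have mB4 : measurable (B4 r a1 b1 a2 b2) by exact: measurableX.
have mB5 : measurable (B5 r a1 b1 a2 b2 a3) by exact: measurableX.
pose l : {sigma_finite_measure set _ -> \bar R} := @lebesgue_measure R.
have e2 : sfprod l l (B2 r a1 b1) = (r * r)%:E.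
  apply: etrans (product_measure1E l l (mI a1) (mI b1)) _.
  by rewrite EFinM; congr (_ * _)%E; [exact: lI|exact: lI].
have e3 : sfprod (sfprod l l) l (B3 r a1 b1 a2) = (r * r * r)%:E.
  apply: etrans (product_measure1E (sfprod l l) l mB2 (mI a2)) _.
  by rewrite EFinM; congr (_ * _)%E; [exact: e2|exact: lI].
have e4 : sfprod (sfprod (sfprod l l) l) l (B4 r a1 b1 a2 b2) = (r * r * r * r)%:E.
  apply: etrans (product_measure1E (sfprod (sfprod l l) l) l mB3 (mI b2)) _.
  by rewrite EFinM; congr (_ * _)%E; [exact: e3|exact: lI].
have e5 : sfprod (sfprod (sfprod (sfprod l l) l) l) l (B5 r a1 b1 a2 b2 a3) = (r * r * r * r * r)%:E.
  apply: etrans (product_measure1E (sfprod (sfprod (sfprod l l) l) l) l mB4 (mI a3)) _.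
  by rewrite EFinM; congr (_ * _)%E; [exact: e4|exact: lI].
have e6 : sfprod (sfprod (sfprod (sfprod (sfprod l l) l) l) l) l (cube r a1 b1 a2 b2 a3 b3) = (r * r * r * r * r * r)%:E.
  apply: etrans (product_measure1E (sfprod (sfprod (sfprod (sfprod l l) l) l) l) l mB5 (mI b3)) _.
  by rewrite EFinM; congr (_ * _)%E; [exact: e5|exact: lI].
have -> : r ^+ 6 = r * r * r * r * r * r by ring.
exact: e6.
Qed.

(** Every disc of radius r contains a square of side r. *)
Lemma leb_polydisc p r : 0 < r -> ((r ^+ 6)%:E <= leb R (@toC3 R @^-1` polydisc p r r r))%E.
Proof.
move=> r0; case: p => -[[a1 b1] [a2 b2]] [a3 b3].
rewrite -(leb_cube a1 b1 a2 b2 a3 b3 r0); apply: le_measure; rewrite ?inE.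
- exact: measurable_cube.
- by apply: measurable_open_toC3; exact: open_polydisc.
move=> [[[[[x1 y1] x2] y2] x3] y3] [[[[[h1 h2] h3] h4] h5] h6].
have near_I x a : I r a x -> `|x - a| < r / 2.
  by rewrite /I /= in_itv /= => /andP[? ?]; rewrite ltr_norml; apply/andP; split; lra.
by split; apply: le_lt_trans (normc_le_ReIm _) _; rewrite (splitr r); apply: ltrD;
  exact: near_I.
Qed.

End bergman_inequality.

Section bergman_inequality_main.
Variable R : realType.
Notation C := (CC R).
Notation C3 := (CC3 R).
Implicit Types (p z c k : C3) (e r s t a b : R) (O U V : set C3) (u v w : C) (f phi : C3 -> C).

(** The variables of f ^+ 2 are replaced one after the other by those of p; each replacement
costs a factor 2 and shrinks one radius of the polydisc, until the integrand is constant. *)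
Lemma bergman_inequality f p r : 0 < r ->
  (forall z, polydisc p (2 * r) (2 * r) (2 * r) z -> differentiable f z) ->
  (((r / 2) ^+ 6 * normc (f p) ^+ 2)%:E <=
   8%:E * \int[leb R]_(q in @toC3 R @^-1` polydisc p (2 * r) (2 * r) (2 * r))
            (normc (f (toC3 q)) ^+ 2)%:E)%E.
Proof.
move=> r0 df; set d := r / 2.
have d0 : 0 < d by rewrite divr_gt0.
pose phi3 z : C := f z * f z.
pose k1 : C3 := (1, 0, 0); pose k2 : C3 := (0, 1, 0); pose k3 : C3 := (0, 0, 1).
pose lam1 z : C := z1 p - z1 z; pose lam2 z : C := z2 p - z2 z; pose lam3 z : C := z3 p - z3 z.
pose phi2 z : C := phi3 (z + lam3 z *: k3).
pose phi1 z : C := phi2 (z + lam2 z *: k2).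
pose phi0 z : C := phi1 (z + lam1 z *: k1).
pose O3 := polydisc p (2 * r) (2 * r) (2 * r); pose O2 := polydisc p (2 * r) (2 * r) d.
pose O1 := polydisc p (2 * r) d d; pose O0 := polydisc p d d d.
have zk1 z w : z + w *: k1 = (z1 z + w, z2 z, z3 z).
  change ((z1 z + w * 1, z2 z + w * 0, z3 z + w * 0) = (z1 z + w, z2 z, z3 z) :> C3).
  by rewrite mulr1 !mulr0 !addr0.
have zk2 z w : z + w *: k2 = (z1 z, z2 z + w, z3 z).
  change ((z1 z + w * 0, z2 z + w * 1, z3 z + w * 0) = (z1 z, z2 z + w, z3 z) :> C3).
  by rewrite mulr1 !mulr0 !addr0.
have zk3 z w : z + w *: k3 = (z1 z, z2 z, z3 z + w).
  change ((z1 z + w * 0, z2 z + w * 0, z3 z + w * 1) = (z1 z, z2 z, z3 z + w) :> C3).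
  by rewrite mulr1 !mulr0 !addr0.
have phi2E : phi2 = fun z => phi3 (z1 z, z2 z, z3 p).
  by apply/funext => z; rewrite /phi2 zk3 /lam3 addrC subrK.
have phi1E : phi1 = fun z => phi3 (z1 z, z2 p, z3 p).
  by apply/funext => z; rewrite /phi1 zk2 phi2E /lam2 [_ + _]addrC subrK.
have phi0E z : phi0 z = phi3 p.
  rewrite /phi0 zk1 phi1E /lam1 [_ + _]addrC /z1 /z2 /z3 /= subrK.
  by case: (p) => [[]].
have d2r : d < 2 * r by rewrite /d; move: r0; clear; lra.
have cpos u : normc (u - u) < 2 * r by rewrite subrr normc0 mulr_gt0.
have dphi3 z : O3 z -> differentiable phi3 z.
  by move=> Oz; apply: differentiableM; exact: df.
have dphi2 z : O2 z -> differentiable phi2 z.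
  move=> [h1 h2 h3]; rewrite phi2E.
  apply: (@differentiable_comp3 _ phi3 (@z1 R) (@z2 R) (fun=> z3 p)).
  - exact: differentiable_z1.
  - exact: differentiable_z2.
  - exact: differentiable_cst.
  - by apply: dphi3; split => //; exact: cpos.
have dphi1 z : O1 z -> differentiable phi1 z.
  move=> [h1 h2 h3]; rewrite phi1E.
  apply: (@differentiable_comp3 _ phi3 (@z1 R) (fun=> z2 p) (fun=> z3 p)).
  - exact: differentiable_z1.
  - exact: differentiable_cst.
  - exact: differentiable_cst.
  - by apply: dphi3; split => //; exact: cpos.
have near_p u v w : normc (u - v) < d -> normc w <= r -> normc (u + w - v) < 2 * r.
  move=> h1 h2; rewrite addrAC; apply: le_lt_trans (ler_normcD _ _) _.
  by rewrite /d in h1; move: h1 h2 r0; clear; lra.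
have clam (g : C3 -> C) (u : C) c : {for c, continuous g} -> {for c, continuous (fun z => u - g z)}.
  by move=> cg; apply: continuousB; [exact: cst_continuous|exact: cg].
have I2 : (\int[leb R]_(q in @toC3 R @^-1` O2) (normc (phi2 (toC3 q)))%:E <=
   2%:E * \int[leb R]_(q in @toC3 R @^-1` O3) (normc (phi3 (toC3 q)))%:E)%E.
  apply: (@integral_mean_step R phi3 lam3 k3 O2 O3 r r0).
  - exact: open_polydisc.
  - exact: open_polydisc.
  - by move=> c [_ _ /ltW]; rewrite -/d /lam3 normcB.
  - by move=> c _; apply: clam; exact: continuous_z3.
  - by move=> c w [h1 h2 h3] wr; apply: dphi3; rewrite zk3; split => //; exact: near_p.
  - by move=> c w [h1 h2 h3] wr; rewrite zk3; split => //; apply: near_p => //; rewrite wr.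
  - by move=> c Oc; apply/differentiable3_continuous/dphi3.
have I1 : (\int[leb R]_(q in @toC3 R @^-1` O1) (normc (phi1 (toC3 q)))%:E <=
   2%:E * \int[leb R]_(q in @toC3 R @^-1` O2) (normc (phi2 (toC3 q)))%:E)%E.
  apply: (@integral_mean_step R phi2 lam2 k2 O1 O2 r r0).
  - exact: open_polydisc.
  - exact: open_polydisc.
  - by move=> c [_ /ltW + _]; rewrite -/d /lam2 normcB.
  - by move=> c _; apply: clam; exact: continuous_z2.
  - by move=> c w [h1 h2 h3] wr; apply: dphi2; rewrite zk2; split => //; exact: near_p.
  - by move=> c w [h1 h2 h3] wr; rewrite zk2; split => //; apply: near_p => //; rewrite wr.
  - by move=> c Oc; apply/differentiable3_continuous/dphi2.
have I0 : (\int[leb R]_(q in @toC3 R @^-1` O0) (normc (phi0 (toC3 q)))%:E <=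
   2%:E * \int[leb R]_(q in @toC3 R @^-1` O1) (normc (phi1 (toC3 q)))%:E)%E.
  apply: (@integral_mean_step R phi1 lam1 k1 O0 O1 r r0).
  - exact: open_polydisc.
  - exact: open_polydisc.
  - by move=> c [/ltW + _ _]; rewrite -/d /lam1 normcB.
  - by move=> c _; apply: clam; exact: continuous_z1.
  - by move=> c w [h1 h2 h3] wr; apply: dphi1; rewrite zk1; split => //; exact: near_p.
  - by move=> c w [h1 h2 h3] wr; rewrite zk1; split => //; apply: near_p => //; rewrite wr.
  - by move=> c Oc; apply/differentiable3_continuous/dphi1.
have J0 : (((r / 2) ^+ 6 * normc (f p) ^+ 2)%:E <=
    \int[leb R]_(q in @toC3 R @^-1` O0) (normc (phi0 (toC3 q)))%:E)%E.
  under eq_integral do rewrite phi0E.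
  rewrite integral_cst; last by apply: measurable_open_toC3; exact: open_polydisc.
  rewrite EFinM muleC /phi3 normcM -expr2; apply: lee_wpmul2l.
    by rewrite lee_fin sqr_ge0.
  exact: leb_polydisc.
apply: (le_trans J0); apply: (le_trans I0).
have -> : 8%:E = (2%:E * (2%:E * 2%:E))%E :> \bar R.
  by rewrite -!EFinM; congr EFin; ring.
rewrite -!muleA; apply: lee_wpmul2l; first by rewrite lee_fin.
apply: (le_trans I1); apply: lee_wpmul2l; first by rewrite lee_fin.
rewrite (_ : (\int[leb R]_(q in _) (normc (f (toC3 q)) ^+ 2)%:E)%E =
  (\int[leb R]_(q in @toC3 R @^-1` O3) (normc (phi3 (toC3 q)))%:E)%E) //.
by apply: eq_integral => q _; rewrite /phi3 normcM expr2.
Qed.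

End bergman_inequality_main.

(** * Approximation on tori *)

Section torus_approximation.
Variable R : realType.
Notation C := (CC R).
Notation C3 := (CC3 R).
Implicit Types (p q z : C3) (e r : R) (Omega U : set C3) (u v w : C) (f g : C3 -> C).

Definition same_torus p q :=
  [/\ z1 q = z1 p, normc (z2 q) = normc (z2 p) & normc (z3 q) = normc (z3 p)].

Definition holomorphic_past_closure Omega G :=
  exists U, [/\ open U, closure Omega `<=` U & holomorphic_on U G].

Definition torus_invariant Omega := forall p q, same_torus p q -> Omega p -> Omega q.

Lemma integral_leb6 (A : set (Rm6 R)) (g : Rm6 R -> \bar R) :
  (\int[leb6 R]_(x in A) g x = \int[leb R]_(x in A) g x)%E.
Proof. reflexivity. Qed.

Lemma L2normE Omega f :
  (\int[leb6 R]_(x in @R6_to_CC3 R @^-1` Omega) normsq6 f x =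
   \int[leb R]_(x in @toC3 R @^-1` Omega) (normc (f (toC3 x)) ^+ 2)%:E)%E.
Proof. exact: (integral_leb6 (@toC3 R @^-1` Omega) (fun x => (normc (f (toC3 x)) ^+ 2)%:E)). Qed.

Lemma open_sub_polydisc Omega p : open Omega -> Omega p ->
  exists2 r, 0 < r & polydisc p (2 * r) (2 * r) (2 * r) `<=` Omega.
Proof.
move=> oO Op; have /nbhs_norm3P[e e0 eO] := open_nbhs_nbhs (conj oO Op).
exists (e / 2); first by rewrite divr_gt0.
move=> z [h1 h2 h3]; apply: eO; rewrite norm3_lt.
have E : 2 * (e / 2) = e by field.
by move: h1 h2 h3; rewrite E => h1 h2 h3; apply/and3P; split.
Qed.

Lemma torus_invariant_polydisc Omega p q r : torus_invariant Omega ->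
  z2 p != 0 -> z3 p != 0 -> same_torus p q ->
  polydisc p r r r `<=` Omega -> polydisc q r r r `<=` Omega.
Proof.
move=> iO p2 p3 [q1 q2 q3] pO z [h1 h2 h3].
have unit_ratio u v : u != 0 -> normc v = normc u -> normc (v / u) = 1.
  by move=> u0 E; rewrite normcM normcV E divff// normc_eq0.
have ratio_neq0 u v : u != 0 -> normc v = normc u -> v / u != 0.
  move=> u0 E; rewrite -normc_eq0 (unit_ratio _ _ u0 E); exact: oner_neq0.
have rot u v w : u != 0 -> normc v = normc u -> normc (w / (v / u) - u) = normc (w - v).
  move=> u0 E; rewrite -[RHS]divr1 -[X in _ / X](unit_ratio _ _ u0 E) -normcV -normcM.
  have v0 : v != 0 by rewrite -normc_eq0 E normc_eq0.
  by congr normc; field; rewrite u0 v0.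
apply: (iO (z1 z, z2 z / (z2 q / z2 p), z3 z / (z3 q / z3 p))).
  split; first by [].
  - change (normc (z2 z) = normc (z2 z / (z2 q / z2 p))).
    by rewrite normcM normcV unit_ratio// invr1 mulr1.
  - change (normc (z3 z) = normc (z3 z / (z3 q / z3 p))).
    by rewrite normcM normcV unit_ratio// invr1 mulr1.
apply: pO; split.
- by change (normc (z1 z - z1 p) < r); rewrite -q1.
- by change (normc (z2 z / (z2 q / z2 p) - z2 p) < r); rewrite rot.
- by change (normc (z3 z / (z3 q / z3 p) - z3 p) < r); rewrite rot.
Qed.

(** Rotating the second and third coordinates preserves the size of the largest polydisc
inside the domain, so that the estimate is uniform over tori. *)
Lemma bergman_torus Omega p : open Omega -> torus_invariant Omega -> Omega p ->
  z2 p != 0 -> z3 p != 0 -> exists2 c, 0 < c & forall f e, holomorphic_on Omega f ->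
    (L2norm Omega f < e%:E)%E -> forall q, same_torus p q -> normc (f q) <= c * e.
Proof.
move=> oO iO Op p2 p3; have [r r0 rO] := open_sub_polydisc oO Op.
pose A := (r / 2) ^+ 6 / 8; have A0 : 0 < A by rewrite divr_gt0// exprn_gt0// divr_gt0.
exists (Num.sqrt A^-1); first by rewrite sqrtr_gt0 invr_gt0.
move=> f e hf Le q pq.
have qO := torus_invariant_polydisc iO p2 p3 pq rO.
have := bergman_inequality r0 (fun z Pz => hf z (qO z Pz)).
set I := (\int[leb R]_(x in _) _)%E => BI.
have e0 : 0 < e by rewrite -lte_fin; apply: le_lt_trans Le; exact: poweR_ge0.
set J := (\int[leb6 R]_(x in @R6_to_CC3 R @^-1` Omega) normsq6 f x)%E in Le.
have J0 : (0 <= J)%E by apply: integral_ge0 => x _; rewrite lee_fin sqr_ge0.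
have Je : (J <= (e ^+ 2)%:E)%E.
  rewrite leNgt; apply/negP => /ltW eJ.
  have h : (0 <= (2 : R)^-1) by [].
  have := @gt0_ler_poweR R _ h (e ^+ 2)%:E J.
  rewrite !in_itv /= lee_fin sqr_ge0 J0 !leey => /(_ erefl erefl eJ).
  rewrite powR12_sqrt ?sqr_ge0// sqrtr_sqr gtr0_norm// => eL.
  by have := lt_le_trans Le eL; rewrite ltxx.
have IJ : (I <= J)%E.
  rewrite /J L2normE; apply: ge0_subset_integral.
  - by apply: measurable_open_toC3; exact: open_polydisc.
  - exact: measurable_open_toC3.
  - apply: (measurableT_comp (f := EFin)) => //.
    apply: (@measurable_continuous_toC3 R Omega (fun z => normc (f z) ^+ 2)) => // z Oz.
    rewrite (_ : (fun z => _) = (fun z => normc (f z) * normc (f z))); last first.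
      by apply/funext => y; rewrite expr2.
    have cf : (fun y => normc (f y)) @ z --> normc (f z).
      by apply: cvg_normc; exact: differentiable3_continuous (hf z Oz).
    exact: (cvgM cf cf).
  - by move=> x _; rewrite lee_fin sqr_ge0.
  - by move=> x /= Px; exact: qO.
have : (r / 2) ^+ 6 * normc (f q) ^+ 2 <= 8 * e ^+ 2.
  rewrite -lee_fin [leRHS]EFinM; apply: (le_trans BI); apply: lee_wpmul2l; first by rewrite lee_fin.
  exact: le_trans IJ Je.
rewrite -[leLHS]/(_ * _) mulrC -ler_pdivlMr ?exprn_gt0 ?divr_gt0// => H.
rewrite -(ler_pXn2r (n := 2)) ?nnegrE ?normc_ge0// ?mulr_ge0 ?sqrtr_ge0// ?(ltW e0)//.
rewrite exprMn sqr_sqrtr; last by rewrite invr_ge0 ltW.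
apply: (le_trans H); rewrite /A invf_div mulrAC//.
Qed.

(** By the previous estimate convergence in square mean is uniform on tori. *)
Lemma A2bar_torus_limit Omega f : open Omega -> torus_invariant Omega -> Omega `<=` @CxCsxCs R ->
  A2bar Omega f -> exists G : nat -> C3 -> C,
    (forall n, holomorphic_past_closure Omega (G n)) /\
    forall p, Omega p -> forall e, 0 < e ->
      \forall n \near \oo, forall q, same_torus p q -> normc (f q - G n q) <= e.
Proof.
move=> oO iO OC [[hf _] fapp].
have pick n : {G | holomorphic_past_closure Omega G /\
    (L2norm Omega (f \- G)%R < (n.+1%:R^-1)%:E)%E}.
  apply/cid; have n0 : 0 < n.+1%:R^-1 :> R by rewrite invr_gt0.
  have [g [gA [U [oU OU [G [hG Gg]]]] Lg]] := fapp _ n0.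
  exists G; split; first by exists U.
  suff <- : L2norm Omega (f \- g)%R = L2norm Omega (f \- G)%R by exact: Lg.
  rewrite /L2norm !L2normE; congr (_ `^ _)%E.
  by apply: eq_integral => x; rewrite inE => Ox /=; rewrite Gg.
exists (fun n => sval (pick n)); split; first by move=> n; case: (svalP (pick n)).
move=> p Op e e0; have [p2 p3] := OC p Op.
have [c c0 cE] := bergman_torus oO iO Op p2 p3.
have ce0 : 0 < c^-1 * e by rewrite mulr_gt0// invr_gt0.
near=> n => q pq; have [[U [oU OU hG]] Ln] := svalP (pick n).
have hfG : holomorphic_on Omega (f \- sval (pick n)).
  move=> z Oz; apply: differentiableB; first exact: hf.
  by apply: hG; apply: OU; exact: subset_closure.
apply: (le_trans (cE _ _ hfG Ln q pq)).
rewrite -ler_pdivlMl//; apply: ltW.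
by near: n; exact: (near_infty_natSinv_lt (PosNum ce0)).
Unshelve. all: by end_near. Qed.

End torus_approximation.

(** * Geometry of worm domains *)

Section worm_geometry.
Variable R : realType.
Notation C := (CC R).
Notation C3 := (CC3 R).
Implicit Types (p q z : C3) (a b e r s mu : R) (Omega U : set C3) (u v w : C) (eta : R * R -> R).

Lemma cvg_sqr (T : Type) (F : set_system T) {FF : Filter F} (f : T -> R) a :
  f @ F --> a -> (fun x => f x ^+ 2) @ F --> a ^+ 2.
Proof.
move=> cf; rewrite (_ : (fun x => _) = (fun x => f x * f x)); last first.
  by apply/funext => x; rewrite expr2.
by rewrite expr2; exact: cvgM.
Qed.

Lemma logsqM u v : u != 0 -> v != 0 -> logsq (u * v) = logsq u + logsq v.
Proof.
move=> u0 v0; rewrite /logsq normcM exprMn lnM// posrE exprn_gt0// normc_gt0//.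
Qed.

Lemma continuous_logsq w : w != 0 -> {for w, continuous (@logsq R)}.
Proof.
move=> w0; rewrite /logsq.
have cn : (fun y : C => normc y) @ nbhs w --> normc w by exact: (@cvg_normc R C (nbhs w) _ id w cvg_id).
have c2 : {for w, continuous (fun y : C => normc y ^+ 2)}.
  exact: (cvg_sqr cn).
apply: (@continuous_comp _ _ _ (fun y : C => normc y ^+ 2) (@ln R)) => //.
by apply: continuous_ln; rewrite exprn_gt0// normc_gt0.
Qed.

Lemma expR_half_sqr a : expR (a / 2) ^+ 2 = expR a.
Proof. by rewrite -expRM_natr; congr expR; field. Qed.

Lemma logsq_normc w a : normc w = expR (a / 2) -> logsq w = a.
Proof. by rewrite /logsq => ->; rewrite expR_half_sqr expRK. Qed.

Lemma normc_logsq w : w != 0 -> normc w = expR (logsq w / 2).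
Proof.
move=> w0; have n0 : 0 < normc w by rewrite normc_gt0.
have -> : logsq w / 2 = ln (normc w) by rewrite /logsq lnXn// mulr2n; field.
by rewrite lnK.
Qed.

Lemma logsq_lt w a b : w != 0 -> (a < logsq w < b) = (expR (a / 2) < normc w < expR (b / 2)).
Proof. by move=> w0; rewrite (normc_logsq w0) !ltr_expR !ltr_pM2r. Qed.

(** The profiles for which the argument works; a cut-off profile makes the
truncated domain another instance. *)
Definition worm_profile mu eta :=
  [/\ forall t : R * R, 0 <= eta t, upper_semicontinuous eta,
      forall t : R * R, - mu < t.1 < mu -> - mu < t.2 < mu -> eta t = 0
    & bounded_set [set t : R * R | 0 <= eta t <= 1]].

Lemma torus_invariant_Weta eta : torus_invariant (Weta eta).
Proof.
move=> p q [q1 q2 q3] [[p2 p3] pe].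
have l2 : logsq (z2 q) = logsq (z2 p) by rewrite /logsq q2.
have l3 : logsq (z3 q) = logsq (z3 p) by rewrite /logsq q3.
have l23 : logsq (z2 q * z3 q) = logsq (z2 p * z3 p) by rewrite /logsq !normcM q2 q3.
have nz u v : normc u = normc v -> v != 0 -> u != 0.
  by move=> E v0; rewrite -normc_gt0 E normc_gt0.
split; first by split; [exact: nz p2|exact: nz p3].
by rewrite q1 l2 l3 l23.
Qed.

Lemma Weta_sub eta : Weta eta `<=` @CxCsxCs R.
Proof. by move=> z []. Qed.

Lemma near_neq0 (g : C3 -> C) z : {for z, continuous g} -> g z != 0 -> \forall y \near z, g y != 0.
Proof.
move=> cg gz; have n0 : 0 < normc (g z) by rewrite normc_gt0.
move/continuous_normcP: cg => /(_ _ n0); apply: filterS => y; apply: contraTneq => ->.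
by rewrite sub0r normcN ltxx.
Qed.

Lemma continuous_centre z : CxCsxCs z ->
  {for z, continuous (fun y : C3 => z1 y - expi (logsq (z2 y * z3 y)))}.
Proof.
move=> [h2 h3].
apply: (@cvgB _ _ _ _ _ (@z1 R) (fun y : C3 => expi (logsq (z2 y * z3 y)))).
  exact: continuous_z1.
apply: (@continuous_comp _ _ _ (fun y : C3 => logsq (z2 y * z3 y)) (@expi R)); last first.
  exact: continuous_expi.
apply: (@continuous_comp _ _ _ (fun y : C3 => z2 y * z3 y) (@logsq R)).
  by apply: continuousM; [exact: continuous_z2|exact: continuous_z3].
by apply: continuous_logsq; rewrite mulf_neq0.
Qed.

Lemma continuous_logsq2 z : CxCsxCs z -> (fun y : C3 => logsq (z2 y)) @ z --> logsq (z2 z).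
Proof.
move=> [h2 _]; apply: (@continuous_comp _ _ _ (@z2 R) (@logsq R)); first exact: continuous_z2.
exact: continuous_logsq.
Qed.

Lemma continuous_logsq3 z : CxCsxCs z -> (fun y : C3 => logsq (z3 y)) @ z --> logsq (z3 z).
Proof.
move=> [_ h3]; apply: (@continuous_comp _ _ _ (@z3 R) (@logsq R)); first exact: continuous_z3.
exact: continuous_logsq.
Qed.

Lemma near_CxCsxCs z : CxCsxCs z -> \forall y \near z, CxCsxCs y.
Proof.
move=> [h2 h3]; apply: filterI.
  exact: (@near_neq0 (@z2 R) z (@continuous_z2 R z) h2).
exact: (@near_neq0 (@z3 R) z (@continuous_z3 R z) h3).
Qed.

Lemma open_Weta eta : upper_semicontinuous eta -> open (Weta eta).
Proof.
move=> usc; rewrite openE => z [Cz ez].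
set d := normc _ ^+ 2 in ez; set tz := (_, _) in ez.
pose m := (d + (1 - eta tz)) / 2.
have dm : d < m by rewrite /m; move: ez; clear; lra.
have me : (((m - 1))%:E < (- eta tz)%:E)%E by rewrite lte_fin /m; move: ez; clear; lra.
have [V nV HV] := usc _ _ me.
have ct : (fun y : C3 => (logsq (z2 y), logsq (z3 y))) @ z --> tz.
  exact: (cvg_pair (continuous_logsq2 Cz) (continuous_logsq3 Cz)).
have cd : (fun y : C3 => normc (z1 y - expi (logsq (z2 y * z3 y)))) @ z -->
    normc (z1 z - expi (logsq (z2 z * z3 z))).
  by apply: cvg_normc; exact: continuous_centre.
have cd2 : (fun y : C3 => normc (z1 y - expi (logsq (z2 y * z3 y))) ^+ 2) @ z --> d.
  exact: (cvg_sqr cd).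
near=> y; split; first by near: y; exact: near_CxCsxCs.
apply: (@lt_trans _ _ m).
  by near: y; exact: (cvgr_lt d cd2).
have : V (logsq (z2 y), logsq (z3 y)) by near: y; exact: ct.
by move=> /HV; rewrite lte_fin; lra.
Unshelve. all: by end_near. Qed.

Lemma near_logsq (g : C3 -> R) z a b : g @ z --> g z -> a < g z < b -> \forall y \near z, a < g y < b.
Proof.
move=> cg /andP[ag gb]; near=> y; apply/andP; split; near: y; [exact: (cvgr_gt _ cg _ ag)|exact: (cvgr_lt _ cg _ gb)].
Unshelve. all: by end_near. Qed.

Lemma open_extra_block a : open (@extra_block R a).
Proof.
rewrite openE => z [Cz h1 h2 h3]; near=> y; split; near: y.
- exact: near_CxCsxCs.
- have cd : (fun y : C3 => normc (z1 y - expi (2 * a))) @ z --> normc (z1 z - expi (2 * a)).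
    apply: cvg_normc; apply: (@cvgB _ _ _ _ _ (@z1 R) (fun=> expi (2 * a))).
      exact: continuous_z1.
    exact: cvg_cst.
  exact: (cvgr_lt _ cd _ h1).
- exact: (near_logsq (continuous_logsq2 Cz) h2).
- exact: (near_logsq (continuous_logsq3 Cz) h3).
Unshelve. all: by end_near. Qed.

Lemma Weta_square mu eta z : worm_profile mu eta -> CxCsxCs z ->
  - mu < logsq (z2 z) < mu -> - mu < logsq (z3 z) < mu ->
  Weta eta z <-> normc (z1 z - expi (logsq (z2 z) + logsq (z3 z))) < 1.
Proof.
move=> [_ _ e0 _] Cz h2 h3; have [n2 n3] := Cz.
have E x : 0 <= x -> (x ^+ 2 < 1 - 0 :> R) = (x < 1).
  by move=> x0; rewrite subr0 -[X in _ < X](expr1n R 2) ltr_pXn2r// nnegrE.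
split=> [[_]|H]; first by rewrite e0// E ?normc_ge0// logsqM.
by split=> //; rewrite e0// E ?normc_ge0// logsqM.
Qed.

(** Every disc of the family has the origin on its boundary. *)
Lemma closure_Weta mu eta v w : worm_profile mu eta -> v != 0 -> w != 0 ->
  - mu < logsq v < mu -> - mu < logsq w < mu -> closure (Weta eta) ((0, v, w) : C3).
Proof.
move=> We v0 w0 hv hw B /nbhs_norm3P[e e0 eB].
pose x := Num.min (e / 2) (1 / 2).
have x0 : 0 < x by rewrite lt_min; apply/andP; split; rewrite divr_gt0.
have x1 : x <= 1 / 2 by rewrite ge_min lexx orbT.
have xe : x < e by rewrite gt_min ltr_pdivrMr// ltr_pMr// ltr1n.
pose E : C := expi (logsq v + logsq w).
exists ((x%:C%C * E, v, w) : C3); split.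
  apply/(Weta_square We) => //.
  change (normc (x%:C%C * E - E) < 1).
  rewrite (_ : _ - E = (x - 1)%:C%C * E); last by rewrite rmorphB/= mulrBl mul1r.
  rewrite normcM normc_expi mulr1 normc_real ltr_norml; apply/andP; split; move: x0 x1; clear; lra.
apply: eB; rewrite norm3_lt; apply/and3P; split.
- change (normc (x%:C%C * E - 0) < e).
  by rewrite subr0 normcM normc_expi mulr1 normc_real gtr0_norm.
- by change (normc (v - v) < e); rewrite subrr normc0.
- by change (normc (w - w) < e); rewrite subrr normc0.
Qed.

(** The value 2 leaves nothing above the outside of the square and keeps the set of arguments
of value at most 1 bounded. *)
Definition square_profile mu : R * R -> R :=
  fun t : R * R => if [&& - mu < t.1, t.1 < mu, - mu < t.2 & t.2 < mu] then 0 else 2.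

Lemma square_profileP mu : worm_profile mu (square_profile mu).
Proof.
rewrite /square_profile; split.
- by move=> t; case: ifP.
- move=> t a; case: ifP => [/and4P[h1 h2 h3 h4]|_] H; last first.
    exists setT; first exact: filterT.
    move=> y _; apply: lt_le_trans H _; rewrite lee_fin; case: ifP => _; lra.
  exists [set t : R * R | [&& - mu < t.1, t.1 < mu, - mu < t.2 & t.2 < mu]].
    have c1 : (fun y : R * R => y.1) @ t --> t.1 by exact: cvg_fst.
    have c2 : (fun y : R * R => y.2) @ t --> t.2 by exact: cvg_snd.
    near=> y; apply/and4P; split; near: y.
    + exact: (cvgr_gt _ c1 _ h1).
    + exact: (cvgr_lt _ c1 _ h2).
    + exact: (cvgr_gt _ c2 _ h3).
    + exact: (cvgr_lt _ c2 _ h4).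
  by move=> y /= ->.
- by move=> t /andP[-> ->] /andP[-> ->].
- exists mu; split; first exact: num_real.
  move=> M muM t /=; case: ifP => [/and4P[h1 h2 h3 h4] _|_ /andP[_]]; last by move=> h; lra.
  rewrite prod_normE ge_max !ler_norml; apply/andP; split; apply/andP; split; lra.
Unshelve. all: by end_near. Qed.

Lemma Wprime_Weta mu : Wprime mu = Weta (square_profile mu) :> set C3.
Proof.
apply/seteqP; split=> z.
  move=> [Cz h1 h2 h3]; apply/(Weta_square (square_profileP mu)) => //.
  by move: Cz h1 => [? ?]; rewrite logsqM.
move=> [Cz]; rewrite /square_profile; case: ifP => [/and4P[h1 h2 h3 h4]|_]; last first.
  by rewrite ltNge => /negP[]; apply: le_trans (sqr_ge0 _); lra.
rewrite subr0 -[X in _ < X](expr1n R 2) ltr_pXn2r// ?nnegrE ?normc_ge0// => H.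
by split=> //; apply/andP; split.
Qed.

End worm_geometry.

(** * Means over circles depending on parameters *)

Section means_with_parameters.
Variable R : realType.
Notation C := (CC R).
Notation C3 := (CC3 R).
Implicit Types (z : C3) (a b e r s t M : R) (u v w c : C) (f g : C3 -> C).

Lemma continuous_cmean (T : topologicalType) (k : T -> C -> C) (p : T) c r :
  (\forall q \near p, forall t, {for (q, t), continuous (fun x : T * R => k x.1 (circ c r x.2))}) ->
  {for p, continuous (fun q => cmean (k q) c r)}.
Proof.
move=> ck; have cslice q : (forall t, {for (q, t), continuous (fun x : T * R => k x.1 (circ c r x.2))}) ->
    cont_on (fun t => k q (circ c r t)) 0 (2 * pi).
  move=> cq t _.
  apply: (@continuous_comp _ _ _ (fun t : R => (q, t)) (fun x : T * R => k x.1 (circ c r x.2))) => //.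
  exact: (cvg_pair (cvg_cst q) cvg_id).
have ckp := nbhs_singleton ck.
apply: (@continuousM _ _ (fun=> (2 * pi)^-1%:C%C) (fun q => rint (fun t => k q (circ c r t)) 0 (2 * pi))).
  exact: cst_continuous.
apply: (@rint_param R T (nbhs p) (fun q t => k q (circ c r t)) p) => //.
- exact: pi2_ge0.
- exact: cslice.
- by apply: filterS ck => q; exact: cslice.
Qed.

(** The bound on the circle above p persists nearby by compactness of the circle. *)
Lemma cmean_bounded_near (T : topologicalType) (k : T -> C -> C) (p : T) c r :
  (forall t, {for (p, t), continuous (fun x : T * R => k x.1 (circ c r x.2))}) ->
  exists M, \forall q \near p, forall t, 0 <= t <= 2 * pi -> normc (k q (circ c r t)) <= M.
Proof.
move=> ck.
have cn : {within `[0, 2 * pi], continuous (fun t => normc (k p (circ c r t)))}.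
  apply: continuous_in_subspaceT => t _; apply: cvg_normc.
  apply: (@continuous_comp _ _ _ (fun t : R => (p, t)) (fun x : T * R => k x.1 (circ c r x.2))) => //.
  exact: (cvg_pair (cvg_cst p) cvg_id).
have [t0 _ t0M] := EVT_max (@pi2_ge0 R) cn.
exists (normc (k p (circ c r t0)) + 1).
have := @segment_compact R 0 (2 * pi); rewrite compact_near_coveringP.
move=> /(_ T (nbhs p) (fun q t => normc (k q (circ c r t)) <= normc (k p (circ c r t0)) + 1)) H.
have : \forall q \near p, `[0, 2 * pi] `<=`
    (fun t : R => normc (k q (circ c r t)) <= normc (k p (circ c r t0)) + 1).
  apply: H => t t2.
  have /continuous_normcP/(_ 1 ltr01) := ck t.
  move=> [[A B] /= [pA tB] AB]; exists (B, A); first by split.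
  move=> [t' q] [/= Bt' Aq]; have H1 := AB (q, t') (conj Aq Bt').
  have := t0M t t2; have := lerB_normc (k q (circ c r t')) (k p (circ c r t)).
  by move: H1 => /=; clear; lra.
by apply: filterS => q Hq t t2; apply: Hq; rewrite /= in_itv.
Qed.

Lemma differentiable_cmean (k : C3 -> C -> C) (p : C3) c r :
  (\forall z \near p, forall t, {for (z, t), continuous (fun x : C3 * R => k x.1 (circ c r x.2))} /\
     differentiable (k^~ (circ c r t)) z) ->
  differentiable (fun z => cmean (k z) c r) p.
Proof.
move=> H; have [M HM] := cmean_bounded_near (fun t => proj1 (nbhs_singleton H t)).
have [e e0 He] := proj1 (nbhs_norm3P p _) (@filterI _ (nbhs p) _ _ _ H HM).
apply: (@differentiableM _ _ (fun=> (2 * pi)^-1%:C%C)); first exact: differentiable_cst.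
have e20 : 0 < e / 2 by rewrite divr_gt0.
have small z : norm3 (z - p) <= e / 2 -> norm3 (z - p) < e.
  by move=> h; apply: le_lt_trans h _; rewrite ltr_pdivrMr// ltr_pMr// ltr1n.
apply: (@differentiable_rint R (fun z t => k z (circ c r t)) 0 (2 * pi) p (e / 2) M) => //.
- exact: pi2_ge0.
- by move=> z t /small/He[+ _] _ => /(_ t)[].
- by move=> z t /small/He[_ +] t2; apply.
- move=> z /small/He[+ _] t _ => /(_ t)[cz _].
  apply: (@continuous_comp _ _ _ (fun t : R => (z, t)) (fun x : C3 * R => k x.1 (circ c r x.2))) => //.
  exact: (cvg_pair (cvg_cst z) cvg_id).
Qed.

Lemma cmeanB_circ (h k : C -> C) c r :
  (forall t, {for t, continuous (fun t => h (circ c r t))}) ->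
  (forall t, {for t, continuous (fun t => k (circ c r t))}) ->
  cmean (fun w => h w - k w) c r = cmean h c r - cmean k c r.
Proof.
move=> ch ck; rewrite /cmean -mulrBr; congr (_ * _).
by apply: rintB; [exact: pi2_ge0|move=> t _; exact: ch|move=> t _; exact: ck].
Qed.

Lemma differentiable_cker_param (w v : C) : v != w -> differentiable (fun v => cker v 0 w) v.
Proof.
move=> vw; apply: (@differentiableM _ _ (fun=> w - 0) (fun v : C => (w - v)^-1)).
  exact: differentiable_cst.
apply: (@differentiableV _ _ (fun v : C => w - v)); last by rewrite subr_eq0 eq_sym.
apply: (@differentiableB _ _ _ (fun=> w) id); first exact: differentiable_cst.
exact: ex_diff.
Qed.

Lemma continuous_cker_both (T : topologicalType) (g h : T -> C) (x : T) :
  {for x, continuous g} -> {for x, continuous h} -> h x != g x ->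
  {for x, continuous (fun y => cker (g y) 0 (h y))}.
Proof.
move=> cg ch gh.
apply: (@continuousM _ _ (fun y => h y - 0) (fun y => (h y - g y)^-1)).
  by apply: (@cvgB _ _ _ _ _ h (fun=> 0)); [exact: ch|exact: cvg_cst].
apply: (@continuousV _ _ (fun y => h y - g y)); first by rewrite subr_eq0.
exact: (cvgB ch cg).
Qed.

End means_with_parameters.

(** * Cauchy integrals over tori *)

Section torus_means.
Variable R : realType.
Notation C := (CC R).
Notation C3 := (CC3 R).
Implicit Types (z p : C3) (a b e s t M : R) (u v w c : C) (f g : C3 -> C) (V Omega : set C3).

(** Cauchy integral over one of the four corner tori of a product of two annuli. *)
Definition torus_mean (r2 r3 : R) f z : C :=
  cmean (fun w2 => cmean (fun w3 => f (z1 z, w2, w3) * cker (z3 z) 0 w3) 0 r3 * cker (z2 z) 0 w2) 0 r2.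

Definition off_torus V (r2 r3 : R) := forall z, V z -> normc (z2 z) != r2 /\ normc (z3 z) != r3.

Definition holomorphic_at_torus V (r2 r3 : R) f := forall z w2 w3,
  V z -> normc w2 = r2 -> normc w3 = r3 -> differentiable f ((z1 z, w2, w3) : C3).

Lemma normc_circ0 (r : R) t : 0 <= r -> normc (circ (0 : C) r t) = r.
Proof. by move=> r0; rewrite -[X in normc X]subr0 normc_circ. Qed.

Lemma continuous_triple (T : topologicalType) (g h k : T -> C) (x : T) :
  {for x, continuous g} -> {for x, continuous h} -> {for x, continuous k} ->
  {for x, continuous (fun y => (g y, h y, k y) : C3)}.
Proof.
move=> /continuous_normcP cg /continuous_normcP ch /continuous_normcP ck A /nbhs_norm3P[e e0 eA].
rewrite nbhs_simpl; near=> y; apply: eA; rewrite norm3_lt; apply/and3P; split; near: y.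
- exact: cg.
- exact: ch.
- exact: ck.
Unshelve. all: by end_near. Qed.

Section fixed_torus.
Variables (V : set C3) (r2 r3 : R).
Hypotheses (oV : open V) (r2_ge0 : 0 <= r2) (r3_ge0 : 0 <= r3) (offV : off_torus V r2 r3).

Lemma circ_off2 z t : V z -> circ 0 r2 t != z2 z.
Proof.
by move=> /offV[+ _]; apply: contra_neq => <-; rewrite normc_circ0.
Qed.

Lemma circ_off3 z t : V z -> circ 0 r3 t != z3 z.
Proof.
by move=> /offV[_]; apply: contra_neq => <-; rewrite normc_circ0.
Qed.

Lemma continuous_integrand (T : topologicalType) (Z : T -> C3) (S2 S3 : T -> R) (x : T) f :
  holomorphic_at_torus V r2 r3 f -> V (Z x) ->
  {for x, continuous Z} -> {for x, continuous S2} -> {for x, continuous S3} ->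
  {for x, continuous (fun y => f (z1 (Z y), circ 0 r2 (S2 y), circ 0 r3 (S3 y)) *
                               cker (z3 (Z y)) 0 (circ 0 r3 (S3 y)))}.
Proof.
move=> hf Vx cZ cS2 cS3.
have c1 : {for x, continuous (fun y => z1 (Z y))}.
  exact: (continuous_comp cZ (@continuous_z1 R (Z x))).
have c3 : {for x, continuous (fun y => z3 (Z y))}.
  exact: (continuous_comp cZ (@continuous_z3 R (Z x))).
have cc2 : {for x, continuous (fun y => circ (0 : C) r2 (S2 y))}.
  exact: (continuous_comp cS2 (@continuous_circ1 R 0 r2 (S2 x))).
have cc3 : {for x, continuous (fun y => circ (0 : C) r3 (S3 y))}.
  exact: (continuous_comp cS3 (@continuous_circ1 R 0 r3 (S3 x))).
apply: (@continuousM _ _ (fun y => f (z1 (Z y), circ 0 r2 (S2 y), circ 0 r3 (S3 y)))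
  (fun y => cker (z3 (Z y)) 0 (circ 0 r3 (S3 y)))); last first.
  by apply: continuous_cker_both => //; exact: circ_off3.
have cq : {for x, continuous (fun y => (z1 (Z y), circ 0 r2 (S2 y), circ 0 r3 (S3 y)) : C3)}.
  exact: (continuous_triple c1 cc2 cc3).
apply: (continuous_comp cq); apply: differentiable3_continuous.
by apply: hf => //; exact: normc_circ0.
Qed.

Lemma continuous_inner_mean z s f : holomorphic_at_torus V r2 r3 f -> V z ->
  {for (z, s), continuous (fun x : C3 * R =>
     cmean (fun w3 => f (z1 x.1, circ 0 r2 x.2, w3) * cker (z3 x.1) 0 w3) 0 r3)}.
Proof.
move=> hf Vz.
apply: (@continuous_cmean R (C3 * R)%type
  (fun x w3 => f (z1 x.1, circ 0 r2 x.2, w3) * cker (z3 x.1) 0 w3)).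
have nV : \forall x \near (z, s), V x.1.
  by apply: (@cvg_fst _ _ (nbhs z) (nbhs s)); exact: open_nbhs_nbhs.
apply: filterS nV => x Vx t.
have c1 : {for (x, t), continuous (fun y : C3 * R * R => y.1.1)}.
  exact: (@continuous_comp _ _ _ fst fst (x, t) cvg_fst cvg_fst).
have c2 : {for (x, t), continuous (fun y : C3 * R * R => y.1.2)}.
  exact: (@continuous_comp _ _ _ fst snd (x, t) cvg_fst cvg_snd).
have c3 : {for (x, t), continuous (fun y : C3 * R * R => y.2)} by exact: cvg_snd.
have E := @continuous_integrand (C3 * R * R)%type (fun y => y.1.1) (fun y => y.1.2) snd (x, t) f hf Vx c1 c2 c3.
exact: E.
Qed.

Lemma continuous_outer_integrand z s f : holomorphic_at_torus V r2 r3 f -> V z ->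
  {for (z, s), continuous (fun x : C3 * R =>
     cmean (fun w3 => f (z1 x.1, circ 0 r2 x.2, w3) * cker (z3 x.1) 0 w3) 0 r3 *
     cker (z2 x.1) 0 (circ 0 r2 x.2))}.
Proof.
move=> hf Vz; apply: (@continuousM _ _ (fun x : C3 * R =>
     cmean (fun w3 => f (z1 x.1, circ 0 r2 x.2, w3) * cker (z3 x.1) 0 w3) 0 r3)
   (fun x => cker (z2 x.1) 0 (circ 0 r2 x.2))).
  exact: continuous_inner_mean.
apply: continuous_cker_both.
- exact: (@continuous_comp _ _ _ fst (@z2 R) (z, s) cvg_fst (@continuous_z2 R z)).
- exact: (@continuous_comp _ _ _ snd (circ 0 r2) (z, s) cvg_snd (@continuous_circ1 R 0 r2 s)).
- exact: circ_off2.
Qed.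

Lemma differentiable_torus_mean z f : holomorphic_at_torus V r2 r3 f -> V z ->
  differentiable (torus_mean r2 r3 f) z.
Proof.
move=> hf Vz.
apply: (@differentiable_cmean R (fun z w2 =>
  cmean (fun w3 => f (z1 z, w2, w3) * cker (z3 z) 0 w3) 0 r3 * cker (z2 z) 0 w2)).
have nV : nbhs z V by exact: open_nbhs_nbhs.
apply: filterS nV => p Vp s; split; first exact: continuous_outer_integrand.
apply: (@differentiableM _ _ (fun y : C3 => cmean (fun w3 => f (z1 y, circ 0 r2 s, w3) *
  cker (z3 y) 0 w3) 0 r3) (fun y => cker (z2 y) 0 (circ 0 r2 s))); last first.
  apply: (@differentiable_comp _ _ _ _ (@z2 R) (fun v => cker v 0 (circ 0 r2 s))).
    exact: differentiable_z2.
  by apply: differentiable_cker_param; rewrite eq_sym; exact: circ_off2.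
apply: (@differentiable_cmean R (fun y w3 => f (z1 y, circ 0 r2 s, w3) * cker (z3 y) 0 w3)).
have nVp : nbhs p V by exact: open_nbhs_nbhs.
apply: filterS nVp => q Vq t; split.
  have c1 : {for (q, t), continuous (fun y : C3 * R => y.1)} by exact: cvg_fst.
  have c2 : {for (q, t), continuous (fun y : C3 * R => s)} by exact: cvg_cst.
  have c3 : {for (q, t), continuous (fun y : C3 * R => y.2)} by exact: cvg_snd.
  exact: (@continuous_integrand (C3 * R)%type fst (fun=> s) snd (q, t) f hf Vq c1 c2 c3).
apply: (@differentiableM _ _ (fun y : C3 => f (z1 y, circ 0 r2 s, circ 0 r3 t))
  (fun y => cker (z3 y) 0 (circ 0 r3 t))).
  apply: (@differentiable_comp3 _ f (@z1 R) (fun=> circ 0 r2 s) (fun=> circ 0 r3 t)).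
  - exact: differentiable_z1.
  - exact: differentiable_cst.
  - exact: differentiable_cst.
  - by apply: hf => //; exact: normc_circ0.
apply: (@differentiable_comp _ _ _ _ (@z3 R) (fun v => cker v 0 (circ 0 r3 t))).
  exact: differentiable_z3.
by apply: differentiable_cker_param; rewrite eq_sym; exact: circ_off3.
Qed.

Lemma normc_cker (r : R) u t : 0 <= r -> normc u != r ->
  normc (cker u 0 (circ 0 r t)) <= r / `|r - normc u|.
Proof.
move=> r0 ur; rewrite /cker normcM normcV subr0 normc_circ0// ler_wpM2l//.
have d0 : 0 < `|r - normc u| by rewrite normr_gt0 subr_eq0 eq_sym.
rewrite lef_pV2 ?posrE//; last by rewrite normc_gt0 subr_eq0; apply: contra_neq ur => <-; exact: normc_circ0.
by rewrite -[X in `|X - _|](@normc_circ0 r t r0); exact: ler_dist_normc.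
Qed.

Lemma cvg_torus_mean f (G : nat -> C3 -> C) z : V z ->
  holomorphic_at_torus V r2 r3 f -> (forall n, holomorphic_at_torus V r2 r3 (G n)) ->
  (forall e, 0 < e -> \forall n \near \oo, forall w2 w3, normc w2 = r2 -> normc w3 = r3 ->
     normc (f (z1 z, w2, w3) - G n (z1 z, w2, w3)) <= e) ->
  torus_mean r2 r3 (G n) z @[n --> \oo] --> torus_mean r2 r3 f z.
Proof.
move=> Vz hf hG fG; apply/cvg_normcP => e e0.
have [n2 n3] := offV Vz.
pose K := (r2 / `|r2 - normc (z2 z)|) * (r3 / `|r3 - normc (z3 z)|) + 1.
have K0 : 0 < K by rewrite ltr_wpDl// mulr_ge0// divr_ge0.
have eK : 0 < e / (2 * K) by rewrite divr_gt0// mulr_gt0.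
apply: filterS (fG _ eK) => n Hn; rewrite normcB.
have inner g s : holomorphic_at_torus V r2 r3 g -> forall t, {for t, continuous (fun t =>
    (fun w3 => g (z1 z, circ 0 r2 s, w3) * cker (z3 z) 0 w3) (circ 0 r3 t))}.
  move=> hg t; have c1 : {for t, continuous (fun y : R => z)} by exact: cvg_cst.
  have c2 : {for t, continuous (fun y : R => s)} by exact: cvg_cst.
  have c3 : {for t, continuous (fun y : R => y)} by exact: cvg_id.
  exact: (@continuous_integrand R (fun=> z) (fun=> s) id t g hg Vz c1 c2 c3).
have outer g : holomorphic_at_torus V r2 r3 g -> forall s, {for s, continuous (fun s =>
    (fun w2 => cmean (fun w3 => g (z1 z, w2, w3) * cker (z3 z) 0 w3) 0 r3 * cker (z2 z) 0 w2)
      (circ 0 r2 s))}.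
  move=> hg s; have zs : {for s, continuous (fun s : R => (z, s))}.
    exact: (cvg_pair (cvg_cst z) cvg_id).
  pose k (x : C3 * R) := cmean (fun w3 => g (z1 x.1, circ 0 r2 x.2, w3) * cker (z3 x.1) 0 w3) 0 r3 *
     cker (z2 x.1) 0 (circ 0 r2 x.2).
  have ck : {for (z, s), continuous k} := @continuous_outer_integrand z s g hg Vz.
  have E := continuous_comp zs ck.
  exact: E.
rewrite /torus_mean -cmeanB_circ; [|exact: outer hf|exact: outer (hG n)].
apply: (@le_lt_trans _ _ ((e / (2 * K) * (r3 / `|r3 - normc (z3 z)|)) * (r2 / `|r2 - normc (z2 z)|))).
  apply: le_cmean_cont.
    by move=> s _; apply: (cvgB (outer f hf s) (outer (G n) (hG n) s)).
  move=> s _; rewrite -mulrBl normcM; apply: ler_pM; rewrite ?normc_ge0//; last exact: normc_cker.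
  rewrite -cmeanB_circ; [|exact: inner hf|exact: inner (hG n)].
  apply: le_cmean_cont.
    by move=> t _; apply: (cvgB (inner f s hf t) (inner (G n) s (hG n) t)).
  move=> t _; rewrite -mulrBl normcM; apply: ler_pM; rewrite ?normc_ge0//; last exact: normc_cker.
  by apply: Hn; exact: normc_circ0.
rewrite -mulrA [X in _ * X]mulrC mulrAC ltr_pdivrMr ?mulr_gt0// ltr_pM2l// /K.
set A := _ * _; have A0 : 0 <= A by rewrite mulr_ge0// divr_ge0.
by rewrite mulrDr mulr1 ltr_pwDr// ler_peMl// ler1n.
Qed.

End fixed_torus.
End torus_means.

(** * Extension from the corners of a product of annuli *)

Section corner_extension.
Variable R : realType.
Notation C := (CC R).
Notation C3 := (CC3 R).
Implicit Types (z p : C3) (e t : R) (u v w c : C) (f g : C3 -> C).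
Variables (V : set C3) (r s : R).
Hypotheses (oV : open V) (r_ge0 : 0 <= r) (rs : r < s).
Hypothesis inV : forall z, V z -> r < normc (z2 z) < s /\ r < normc (z3 z) < s.

Definition corner_radius (x : R) := x = r \/ x = s.

Definition holomorphic_at_corners f := forall z w2 w3, V z ->
  corner_radius (normc w2) -> corner_radius (normc w3) -> differentiable f ((z1 z, w2, w3) : C3).

(** The annular Cauchy formula in both variables reads a function off the four extreme tori. *)
Definition corner_extension f z : C :=
  torus_mean s s f z - torus_mean s r f z - (torus_mean r s f z - torus_mean r r f z).

Lemma off_corner x y : corner_radius x -> corner_radius y -> off_torus V x y.
Proof.
move=> xE yE z /inV[/andP[h1 h2] /andP[h3 h4]].
by split; [case: xE => ->|case: yE => ->]; rewrite ?(gt_eqF h1) ?(lt_eqF h2) ?(gt_eqF h3) ?(lt_eqF h4).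
Qed.

Lemma corner_ge0 x : corner_radius x -> 0 <= x.
Proof. by case=> -> //; apply: le_trans r_ge0 (ltW rs). Qed.

Lemma corner_torus x y f : corner_radius x -> corner_radius y ->
  holomorphic_at_corners f -> holomorphic_at_torus V x y f.
Proof. by move=> xE yE hf z w2 w3 Vz h2 h3; apply: hf => //; rewrite ?h2 ?h3. Qed.

Let cr : corner_radius r := or_introl erefl.
Let cs : corner_radius s := or_intror erefl.

Lemma differentiable_corner f z : holomorphic_at_corners f -> V z ->
  differentiable (corner_extension f) z.
Proof.
move=> hf Vz.
have D x y : corner_radius x -> corner_radius y -> differentiable (torus_mean x y f) z.
  move=> xE yE; apply: (@differentiable_torus_mean R V x y) => //.
  - exact: corner_ge0.
  - exact: corner_ge0.
  - exact: off_corner.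
  - exact: corner_torus.
apply: (@differentiableB _ _ _ (fun z => torus_mean s s f z - torus_mean s r f z)
  (fun z => torus_mean r s f z - torus_mean r r f z)).
  by apply: (@differentiableB _ _ _ (torus_mean s s f) (torus_mean s r f)); exact: D.
by apply: (@differentiableB _ _ _ (torus_mean r s f) (torus_mean r r f)); exact: D.
Qed.

Lemma cvg_corner f (G : nat -> C3 -> C) z : V z ->
  holomorphic_at_corners f -> (forall n, holomorphic_at_corners (G n)) ->
  (forall x y e, corner_radius x -> corner_radius y -> 0 < e ->
     \forall n \near \oo, forall w2 w3, normc w2 = x -> normc w3 = y ->
     normc (f (z1 z, w2, w3) - G n (z1 z, w2, w3)) <= e) ->
  corner_extension (G n) z @[n --> \oo] --> corner_extension f z.
Proof.
move=> Vz hf hG H.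
have D x y : corner_radius x -> corner_radius y ->
    torus_mean x y (G n) z @[n --> \oo] --> torus_mean x y f z.
  move=> xE yE; apply: (@cvg_torus_mean R V x y) => //.
  - exact: corner_ge0.
  - exact: corner_ge0.
  - exact: off_corner.
  - exact: corner_torus.
  - by move=> n; exact: corner_torus.
  - by move=> e e0; exact: H.
exact: (cvgB (cvgB (D _ _ cs cs) (D _ _ cs cr)) (cvgB (D _ _ cr cs) (D _ _ cr cr))).
Qed.

Lemma corner_extension_id g z : V z -> holomorphic_at_corners g ->
  (forall w2 w3, r <= normc w2 <= s -> r <= normc w3 <= s -> differentiable g ((z1 z, w2, w3) : C3)) ->
  corner_extension g z = g z.
Proof.
move=> Vz hg dg; have [z2i z3i] := inV Vz.
have z2w : r <= normc (z2 z) <= s by case/andP: z2i => /ltW -> /ltW ->.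
have z3w : r <= normc (z3 z) <= s by case/andP: z3i => /ltW -> /ltW ->.
have outer x y : corner_radius x -> corner_radius y -> forall t, {for t, continuous (fun t =>
    (fun w2 => cmean (fun w3 => g (z1 z, w2, w3) * cker (z3 z) 0 w3) 0 y * cker (z2 z) 0 w2)
      (circ 0 x t))}.
  move=> xE yE t; have zs : {for t, continuous (fun t : R => (z, t))}.
    exact: (cvg_pair (cvg_cst z) cvg_id).
  pose k (q : C3 * R) := cmean (fun w3 => g (z1 q.1, circ 0 x q.2, w3) * cker (z3 q.1) 0 w3) 0 y *
     cker (z2 q.1) 0 (circ 0 x q.2).
  have ck : {for (z, t), continuous k} := @continuous_outer_integrand R V x y oV
    (corner_ge0 xE) (corner_ge0 yE) (off_corner xE yE) z t g (corner_torus xE yE hg) Vz.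
  have E := continuous_comp zs ck.
  exact: E.
have lam2 (w3 : C) : r <= normc w3 <= s -> forall w, r <= normc (w - 0) <= s ->
    differentiable (fun w2 => g ((z1 z, w2, w3) : C3)) w.
  by move=> h3 w; rewrite subr0 => h2; apply: differentiable_slice2; exact: dg.
have lam3 (w2 : C) : r <= normc w2 <= s -> forall w, r <= normc (w - 0) <= s ->
    differentiable (fun w3 => g ((z1 z, w2, w3) : C3)) w.
  by move=> h2 w; rewrite subr0 => h3; apply: differentiable_slice3; exact: dg.
have sub0 (u : C) : normc (u - 0) = normc u by rewrite subr0.
have step x : corner_radius x -> torus_mean x s g z - torus_mean x r g z =
    cmean (fun w2 => g ((z1 z, w2, z3 z) : C3) * cker (z2 z) 0 w2) 0 x.
  move=> xE; rewrite /torus_mean -cmeanB_circ; [|exact: outer|exact: outer].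
  apply: eq_cmean; first exact: corner_ge0.
  move=> w2; rewrite subr0 => w2x; rewrite -mulrBl; congr (_ * _); apply/esym.
  apply: (@cauchy_annulus R (fun w3 => g ((z1 z, w2, w3) : C3)) 0 (z3 z) r s) => //.
    by rewrite sub0.
  by apply: lam3; rewrite w2x; case: xE => ->; rewrite lexx ?ltW.
rewrite /corner_extension (step s cs) (step r cr).
have E : g z = g ((z1 z, z2 z, z3 z) : C3) by case: (z) => [[]].
rewrite E; apply/esym.
apply: (@cauchy_annulus R (fun w2 => g ((z1 z, w2, z3 z) : C3)) 0 (z2 z) r s) => //.
  by rewrite sub0.
exact: lam2.
Qed.

End corner_extension.

(** * A tube lemma *)

Section tube.
Variable R : realType.
Notation C := (CC R).
Notation C3 := (CC3 R).
Implicit Types (z : C3) (e d t r s : R) (u v w : C) (U W : set C3).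

Let cart (x : R * R) : C := Complex x.1 x.2.

Lemma tube_bounded W s : open W -> (forall v w, W ((0, v, w) : C3)) ->
  exists2 d, 0 < d & forall u v w, normc u < d -> normc v <= s -> normc w <= s -> W ((u, v, w) : C3).
Proof.
move=> oW W0; pose I := `[- s, s]%classic : set R.
have cK : compact ((I `*` I) `*` (I `*` I)).
  by apply: compact_setX; apply: compact_setX; exact: segment_compact.
move: cK; rewrite compact_near_coveringP.
move=> /(_ C (nbhs (0 : C)) (fun u q => W ((u, cart q.1, cart q.2) : C3))) H.
have /nbhs_normcP[d d0 Hd] : \forall u \near (0 : C), ((I `*` I) `*` (I `*` I)) `<=`
    (fun q => W ((u, cart q.1, cart q.2) : C3)).
  apply: H => q _.
  have cc (g : (R * R) * (R * R) * C -> R * R) x : {for x, continuous g} ->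
      {for x, continuous (fun y => cart (g y))}.
    move=> cg; apply: cvg_Complex.
      exact: (@continuous_comp _ _ _ g fst x cg cvg_fst).
    exact: (@continuous_comp _ _ _ g snd x cg cvg_snd).
  have c1 : {for (q, 0 : C), continuous (fun y : (R * R) * (R * R) * C => y.2)} by exact: cvg_snd.
  have c2 : {for (q, 0 : C), continuous (fun y : (R * R) * (R * R) * C => y.1.1)}.
    exact: (@continuous_comp _ _ _ fst fst (q, 0 : C) cvg_fst cvg_fst).
  have c3 : {for (q, 0 : C), continuous (fun y : (R * R) * (R * R) * C => y.1.2)}.
    exact: (@continuous_comp _ _ _ fst snd (q, 0 : C) cvg_fst cvg_snd).
  have cq := continuous_triple c1 (cc _ _ c2) (cc _ _ c3).
  have nW : nbhs ((0 : C, cart q.1, cart q.2) : C3) W by apply: open_nbhs_nbhs; split.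
  have [[A B] /= [qA uB] AB] := cq _ nW.
  exists (A, B); first by split.
  by move=> [q' u'] [/= Aq Bu]; exact: (AB (q', u') (conj Aq Bu)).
exists d => // u v w ud vs ws.
have inI v' : normc v' <= s -> (I `*` I) (complex.Re v', complex.Im v').
  move=> h; split; rewrite /I /= in_itv /= -ler_norml.
    exact: le_trans (normc_Re v') h.
  exact: le_trans (normc_Im v') h.
have cartK v' : cart (complex.Re v', complex.Im v') = v' by case: v'.
have h : normc (u - 0) < d by rewrite subr0.
have := Hd u h ((complex.Re v, complex.Im v), (complex.Re w, complex.Im w)) (conj (inI v vs) (inI w ws)).
by rewrite [X in W X]/= !cartK.
Qed.

Lemma open_annulus_complement (g : C3 -> C) r s z : {for z, continuous g} ->
  ~ (r <= normc (g z) <= s) -> \forall y \near z, ~ (r <= normc (g y) <= s).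
Proof.
move=> cg H; have cn : (fun y : C3 => normc (g y)) @ z --> normc (g z) by apply: cvg_normc.
case: (ltP (normc (g z)) r) => h1.
  by apply: filterS (cvgr_lt _ cn _ h1) => y h /andP[]; rewrite leNgt h.
case: (ltP s (normc (g z))) => h2; last by case: H; rewrite h1 h2.
by apply: filterS (cvgr_gt _ cn _ h2) => y h /andP[_]; rewrite leNgt h.
Qed.

(** The tube lemma for compact polydiscs, applied to the union of U and of the open set where
one of the two coordinates leaves the annulus. *)
Lemma tube_annuli U r s : open U ->
  (forall v w, r <= normc v <= s -> r <= normc w <= s -> U ((0, v, w) : C3)) ->
  exists2 d, 0 < d & forall u v w, normc u < d -> r <= normc v <= s -> r <= normc w <= s ->
    U ((u, v, w) : C3).
Proof.
move=> oU HU.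
pose W : set C3 := [set z | r <= normc (z2 z) <= s -> r <= normc (z3 z) <= s -> U z].
have oW : open W.
  rewrite openE => z Wz.
  have [h2|h2] := pselect (r <= normc (z2 z) <= s); last first.
    apply: filterS (open_annulus_complement (@continuous_z2 R z) h2) => y hy h.
    by case: (hy h).
  have [h3|h3] := pselect (r <= normc (z3 z) <= s); last first.
    apply: filterS (open_annulus_complement (@continuous_z3 R z) h3) => y hy _ h.
    by case: (hy h).
  have nU : nbhs z U by apply: open_nbhs_nbhs; split => //; exact: Wz.
  by apply: filterS nU => y Uy _ _.
have [d d0 Hd] := tube_bounded s oW (fun v w => HU v w).
exists d => // u v w ud /andP[v1 v2] /andP[w1 w2].
by apply: (Hd u v w ud v2 w2); rewrite /z2 /z3 /=; apply/andP; split.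
Qed.

End tube.

(** * Extension to the blocks *)

Section holomorphic_extension.
Variable R : realType.
Notation C := (CC R).
Notation C3 := (CC3 R).
Implicit Types (z p : C3) (e d t : R) (u v w : C) (f g G : C3 -> C) (U : set C3).
Variables (mu : R) (eta : R * R -> R).
Hypothesis We : worm_profile mu eta.

Definition block_index (a : R) := - (mu / 2) < a < mu / 2 - 2 * pi.
Definition inner_radius (a : R) := expR (a / 2).
Definition outer_radius (a : R) := expR ((a + 2 * pi) / 2).
(** Only values on tori inside the domain enter, so that this is defined for every function
holomorphic there. *)
Definition block_extension (a : R) := @corner_extension R (inner_radius a) (outer_radius a).

Lemma inner_lt_outer a : inner_radius a < outer_radius a.
Proof. by rewrite ltr_expR ltr_pM2r// ltrDl pi2_gt0. Qed.

Lemma block_radii a z : extra_block a z ->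
  inner_radius a < normc (z2 z) < outer_radius a /\ inner_radius a < normc (z3 z) < outer_radius a.
Proof. by move=> [[n2 n3] _ h2 h3]; rewrite -!logsq_lt. Qed.

Lemma logsq_annulus a w : inner_radius a <= normc w <= outer_radius a ->
  w != 0 /\ a <= logsq w <= a + 2 * pi.
Proof.
move=> /andP[h1 h2]; have w0 : w != 0.
  by rewrite -normc_gt0; apply: lt_le_trans h1; exact: expR_gt0.
split=> //; move: h1 h2; rewrite /inner_radius /outer_radius (normc_logsq w0) !ler_expR.
by rewrite !ler_pM2r// => -> ->.
Qed.

Lemma block_square a t : block_index a -> a <= t <= a + 2 * pi -> - mu < t < mu.
Proof.
have := @pi2_gt0 R; rewrite /block_index => p0 /andP[h1 h2] /andP[h3 h4].
by apply/andP; split; move: p0 h1 h2 h3 h4; rewrite ![2 * pi]mulrC; lra.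
Qed.

Lemma block_in_square a z : block_index a -> extra_block a z ->
  - mu < logsq (z2 z) < mu /\ - mu < logsq (z3 z) < mu.
Proof.
move=> ha [_ _ /andP[h1 h2] /andP[h3 h4]].
by split; apply: (block_square ha); apply/andP; split; exact: ltW.
Qed.

(** At the corners the angle is 2a modulo full turns, so the discs of the block and of the domain
coincide there. *)
Lemma block_corner a z w2 w3 : block_index a -> extra_block a z ->
  corner_radius (inner_radius a) (outer_radius a) (normc w2) ->
  corner_radius (inner_radius a) (outer_radius a) (normc w3) -> Weta eta ((z1 z, w2, w3) : C3).
Proof.
move=> ha [_ h1 _ _] k2 k3.
have corner w : corner_radius (inner_radius a) (outer_radius a) (normc w) ->
    [/\ w != 0, - mu < logsq w < mu & expi (logsq w) = expi a :> C].
  move=> k; have lw : logsq w = a \/ logsq w = a + 2 * pi.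
    by case: k => /logsq_normc ->; [left|right].
  have w0 : w != 0.
    by rewrite -normc_gt0; case: k => ->; exact: expR_gt0.
  split=> //; last by case: lw => -> //; rewrite expiD expi2pi mulr1.
  apply: (block_square ha); have := @pi2_gt0 R.
  by case: lw => -> p0; rewrite lexx /= ?andbT lerDl ltW.
have [n2 s2 e2] := corner _ k2; have [n3 s3 e3] := corner _ k3.
apply/(Weta_square We) => //; change (normc (z1 z - expi (logsq w2 + logsq w3)) < 1).
by rewrite expiD e2 e3 -expiD -mulr2n -[a *+ 2]mulr_natl.
Qed.

Lemma holomorphic_at_block_corners a f : block_index a -> holomorphic_on (Weta eta) f ->
  holomorphic_at_corners (extra_block a) (inner_radius a) (outer_radius a) f.
Proof. by move=> ha hf z w2 w3 Vz k2 k3; apply: hf; exact: block_corner k2 k3. Qed.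

Lemma holomorphic_block_extension a f : block_index a -> holomorphic_on (Weta eta) f ->
  holomorphic_on (extra_block a) (block_extension a f).
Proof.
move=> ha hf z Vz.
apply: (differentiable_corner (@open_extra_block R a) (expR_ge0 _) (inner_lt_outer a)) Vz.
  exact: block_radii.
exact: holomorphic_at_block_corners.
Qed.

Lemma past_closure_holomorphic G : holomorphic_past_closure (Weta eta) G -> holomorphic_on (Weta eta) G.
Proof. by move=> [U [_ OU hG]] z Oz; apply/hG/OU; exact: subset_closure. Qed.

(** For small z1 the product of the two closed annuli lies in the neighbourhood of the closure,
where Cauchy's formula applies. *)
Lemma block_extension_near0 a G (v w : C) : block_index a -> holomorphic_past_closure (Weta eta) G ->
  v != 0 -> w != 0 -> a < logsq v < a + 2 * pi -> a < logsq w < a + 2 * pi ->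
  exists2 d, 0 < d & forall u, normc u < d -> normc (u - expi (2 * a)) < 1 ->
    block_extension a G (u, v, w) = G (u, v, w).
Proof.
move=> ha pG v0 w0 hv hw; have hGO := past_closure_holomorphic pG.
have [U [oU OU hG]] := pG.
have axis v2 v3 : inner_radius a <= normc v2 <= outer_radius a ->
    inner_radius a <= normc v3 <= outer_radius a -> U ((0, v2, v3) : C3).
  move=> /logsq_annulus[n2 l2] /logsq_annulus[n3 l3]; apply: OU.
  by apply: (closure_Weta We) => //; exact: (block_square ha).
have [d d0 Hd] := tube_annuli oU axis.
exists d => // u ud u1.
have Vz : extra_block a ((u, v, w) : C3) by split.
apply: (corner_extension_id (@open_extra_block R a) (expR_ge0 _) (inner_lt_outer a)) Vz _ _.
- exact: block_radii.
- exact: holomorphic_at_block_corners.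
- by move=> v2 v3 h2 h3; apply: hG; exact: Hd.
Qed.

(** As functions of z1 both sides are holomorphic on unit discs having the origin on their
boundary, and they agree near the origin. *)
Lemma block_extension_agree a G z : block_index a -> holomorphic_past_closure (Weta eta) G ->
  extra_block a z -> Weta eta z -> block_extension a G z = G z.
Proof.
move=> ha pG Vz Oz; have hG := past_closure_holomorphic pG.
have [s2 s3] := block_in_square ha Vz; have [Cz h1 h2 h3] := Vz; have [n2 n3] := Cz.
have [d d0 Hd] := block_extension_near0 ha pG n2 n3 h2 h3.
have /(Weta_square We Cz s2 s3) h1' := Oz.
have E : z = ((z1 z, z2 z, z3 z) : C3) by case: (z) => [[]].
rewrite E; apply: (@identity_lens R (fun u => block_extension a G ((u, z2 z, z3 z) : C3))
  (fun u => G ((u, z2 z, z3 z) : C3)) (expi (2 * a)) (expi (logsq (z2 z) + logsq (z3 z))) d (z1 z)).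
- exact: normc_expi.
- exact: normc_expi.
- by [].
- move=> u u1; apply: differentiable_slice1; apply: holomorphic_block_extension => //.
- by move=> u u1; apply: differentiable_slice1; apply: hG; apply/(Weta_square We).
- by move=> u ud u1 _; exact: Hd.
- by [].
- by [].
Qed.

Lemma block_extension_agree2 a b G z : block_index a -> block_index b -> holomorphic_past_closure (Weta eta) G ->
  extra_block a z -> extra_block b z -> block_extension a G z = block_extension b G z.
Proof.
move=> ha hb pG Va Vb; have hG := past_closure_holomorphic pG.
have [[n2 n3] h1 h2 h3] := Va; have [_ k1 k2 k3] := Vb.
have [d d0 Hd] := block_extension_near0 ha pG n2 n3 h2 h3.
have [d' d'0 Hd'] := block_extension_near0 hb pG n2 n3 k2 k3.
have E : z = ((z1 z, z2 z, z3 z) : C3) by case: (z) => [[]].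
rewrite E; apply: (@identity_lens R (fun u => block_extension a G ((u, z2 z, z3 z) : C3))
  (fun u => block_extension b G ((u, z2 z, z3 z) : C3)) (expi (2 * a)) (expi (2 * b))
  (Num.min d d') (z1 z)).
- exact: normc_expi.
- exact: normc_expi.
- by rewrite lt_min d0 d'0.
- by move=> u u1; apply: differentiable_slice1; apply: holomorphic_block_extension.
- by move=> u u1; apply: differentiable_slice1; apply: holomorphic_block_extension.
- move=> u; rewrite lt_min => /andP[ud ud'] u1 u2.
  by rewrite (Hd u ud u1) (Hd' u ud' u2).
- by [].
- by [].
Qed.

Section limit.
Variables (f : C3 -> C) (G : nat -> C3 -> C).
Hypothesis hf : holomorphic_on (Weta eta) f.
Hypothesis pG : forall n, holomorphic_past_closure (Weta eta) (G n).
Hypothesis Gf : forall p, Weta eta p -> forall e, 0 < e ->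
  \forall n \near \oo, forall q, same_torus p q -> normc (f q - G n q) <= e.

Lemma cvg_torus_limit z : Weta eta z -> G n z @[n --> \oo] --> f z.
Proof.
move=> Oz; apply/cvg_normcP => e e0; have e20 : 0 < e / 2 by rewrite divr_gt0.
apply: filterS (Gf Oz e20) => n Hn; rewrite normcB.
apply: le_lt_trans (Hn z _) _; first by split.
by rewrite ltr_pdivrMr// ltr_pMr// ltr1n.
Qed.

Lemma cvg_block_extension a z : block_index a -> extra_block a z ->
  block_extension a (G n) z @[n --> \oo] --> block_extension a f z.
Proof.
move=> ha Vz.
have inV := @block_radii a.
apply: (cvg_corner (@open_extra_block R a) (expR_ge0 _) (inner_lt_outer a) inV Vz).
- exact: holomorphic_at_block_corners.
- by move=> n; apply: holomorphic_at_block_corners => //; exact: past_closure_holomorphic.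
- move=> x y e kx ky e0.
  have x0 : 0 <= x by case: kx => ->; exact: expR_ge0.
  have y0 : 0 <= y by case: ky => ->; exact: expR_ge0.
  have nx : normc (x%:C%C : C) = x by rewrite normc_real ger0_norm.
  have ny : normc (y%:C%C : C) = y by rewrite normc_real ger0_norm.
  have Op : Weta eta ((z1 z, x%:C%C, y%:C%C) : C3).
    by apply: (block_corner ha Vz); rewrite ?nx ?ny.
  apply: filterS (Gf Op e0) => n Hn w2 w3 h2 h3; apply: Hn; split=> //.
    by change (normc w2 = normc (x%:C%C : C)); rewrite nx.
  by change (normc w3 = normc (y%:C%C : C)); rewrite ny.
Qed.

(** Evaluation at a point and on tori is continuous along the approximating sequence. *)
Lemma limit_agree a z : block_index a -> extra_block a z -> Weta eta z ->
  block_extension a f z = f z.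
Proof.
move=> ha Vz Oz; have := cvg_block_extension ha Vz.
rewrite (_ : (fun n => _) = (fun n => G n z)); last first.
  by apply/funext => n; exact: block_extension_agree.
by move=> /(cvg_unique _) /(_ (cvg_torus_limit Oz)) ->.
Qed.

Lemma limit_agree2 a b z : block_index a -> block_index b ->
  extra_block a z -> extra_block b z -> block_extension a f z = block_extension b f z.
Proof.
move=> ha hb Va Vb; have := cvg_block_extension ha Va.
rewrite (_ : (fun n => _) = (fun n => block_extension b (G n) z)); last first.
  by apply/funext => n; exact: block_extension_agree2.
by move=> /(cvg_unique _) /(_ (cvg_block_extension hb Vb)) ->.
Qed.

Lemma glued_extension : holomorphically_extends (Weta eta) f (hat mu (Weta eta)).
Proof.
pose pick z : R := xget 0 [set a | block_index a /\ extra_block a z].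
pose F z : C := if pselect (Weta eta z) then f z else block_extension (pick z) f z.
have FO z : Weta eta z -> F z = f z by rewrite /F; case: pselect.
have FV a z : block_index a -> extra_block a z -> F z = block_extension a f z.
  move=> ha Vz; rewrite /F; case: pselect => Oz; first by rewrite (limit_agree ha Vz Oz).
  have [hp Vp] : [set a | block_index a /\ extra_block a z] (pick z) by apply: xgetPex; exists a.
  exact: limit_agree2.
have [_ usc _ _] := We.
exists F; split; last exact: FO.
move=> z [Oz|[a ha Vz]].
  apply: (near_eq_differentiable (f := f)); last exact: hf.
  have nO : nbhs z (Weta eta) by apply: open_nbhs_nbhs; split => //; exact: open_Weta.
  by apply: filterS nO => y Oy; rewrite FO.
apply: (near_eq_differentiable (f := block_extension a f)); last exact: holomorphic_block_extension.
have nV : nbhs z (extra_block a) by apply: open_nbhs_nbhs; split => //; exact: open_extra_block.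
by apply: filterS nV => y Vy; rewrite (FV a).
Qed.

End limit.

Theorem A2bar_extends f : A2bar (Weta eta) f ->
  holomorphically_extends (Weta eta) f (hat mu (Weta eta)).
Proof.
move=> fA; have [_ usc _ _] := We.
have [G [pG Gf]] := A2bar_torus_limit (open_Weta usc) (@torus_invariant_Weta R eta)
  (@Weta_sub R eta) fA.
have [[hf _] _] := fA.
exact: glued_extension hf pG Gf.
Qed.

End holomorphic_extension.

(** * A root that follows the worm *)

Section square_root.
Variable R : realType.
Notation C := (CC R).
Notation C3 := (CC3 R).
Implicit Types (z p : C3) (e d t s : R) (u v w : C).

(** The root with positive real part, for arguments with positive real part. *)
Definition csqrt u : C := if 0 < complex.Re (sqrtc u) then sqrtc u else - sqrtc u.

Lemma csqrtK u : csqrt u ^+ 2 = u.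
Proof. by rewrite /csqrt; case: ifP => _; rewrite ?sqrrN sqr_sqrtc. Qed.

Lemma Re_csqrt_gt0 u : 0 < complex.Re u -> 0 < complex.Re (csqrt u).
Proof.
move=> u0; rewrite /csqrt; case: ifP => // /negbT; rewrite -leNgt => h.
have : complex.Re (sqrtc u) != 0.
  apply: contraTneq u0 => E; rewrite -leNgt -[u in leLHS]sqr_sqrtc.
  move: E; case: (sqrtc u) => x y /= ->.
  by rewrite mul0r add0r oppr_le0 -expr2 sqr_ge0.
by case: (sqrtc u) h => x y /= h x0; rewrite oppr_gt0 lt_neqAle x0.
Qed.

Lemma continuous_csqrt u : 0 < complex.Re u -> {for u, continuous csqrt}.
Proof.
move=> u0; have m0 := Re_csqrt_gt0 u0; set m := complex.Re (csqrt u) in m0.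
have cRe : (fun v : C => complex.Re v) @ nbhs u --> complex.Re u.
  exact: (@cvg_ReC R C (nbhs u) _ id u cvg_id).
apply/continuous_normcP => e e0.
have near_u : \forall v \near u, normc (v - u) < e * m.
  by apply/nbhs_normcP; exists (e * m) => //; rewrite mulr_gt0.
near=> v; have v0 : 0 < complex.Re v by near: v; exact: (cvgr_gt _ cRe _ u0).
have vu : normc (v - u) < e * m by near: v.
have sm : m <= normc (csqrt v + csqrt u).
  apply: le_trans (normc_Re _); apply: le_trans (ler_norm _).
  rewrite -[leRHS]/(complex.Re (csqrt v + csqrt u)) /m.
  have := Re_csqrt_gt0 v0; case: (csqrt v) => x y; case: (csqrt u) => x' y' /= h.
  by rewrite lerDr ltW.
have E : normc (csqrt v - csqrt u) * normc (csqrt v + csqrt u) = normc (v - u).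
  by rewrite -normcM -subr_sqr !csqrtK.
have s0 : 0 < normc (csqrt v + csqrt u) by exact: lt_le_trans m0 sm.
rewrite -(ltr_pM2r s0) E; apply: lt_le_trans vu _.
by rewrite ler_pM2l.
Unshelve. all: by end_near. Qed.

(** The difference quotient of a root g is 1 / (g y + g z), which has a limit by continuity. *)
Lemma differentiable_root (g : C3 -> C) z : {for z, continuous g} -> g z != 0 ->
  (forall y, g y ^+ 2 = z1 y) -> differentiable g z.
Proof.
move=> cg g0 gs; apply/differentiable3P; exists (g z + g z)^-1, 0, 0 => e e0.
have gz2 : g z + g z != 0 by rewrite -mulr2n -mulr_natl mulf_neq0// pnatr_eq0.
have cs : {for z, continuous (fun y => g y + g z)} by exact: (cvgD cg (cvg_cst (g z))).
have ci : {for z, continuous (fun y => (g y + g z)^-1)}.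
  by apply: (@continuousV _ _ (fun y => g y + g z)); [exact: gz2|exact: cs].
have n0 := near_neq0 cs gz2.
near=> y.
have y0 : g y + g z != 0 by near: y.
have iy : normc ((g y + g z)^-1 - (g z + g z)^-1) < e.
  by near: y; move/continuous_normcP: ci => /(_ e e0).
rewrite /lin3 !mul0r !addr0.
have -> : z1 (y - z) = g y ^+ 2 - g z ^+ 2 by rewrite !gs.
rewrite (_ : _ - _ = ((g y + g z)^-1 - (g z + g z)^-1) * (g y ^+ 2 - g z ^+ 2)); last first.
  rewrite [RHS]mulrBl; congr (_ - _).
  by rewrite subr_sqr mulrC mulfK.
rewrite !gs normcM; apply: ler_pM; rewrite ?normc_ge0//; first exact: ltW.
exact: (normc_z1 (y - z)).
Unshelve. all: by end_near. Qed.

(** The branch of the square root of z1 obtained by following the centre of the disc. When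
log |z2|^2 grows by 2 pi the centre makes a full turn and the branch changes its sign. *)
Definition worm_root z : C :=
  expi ((logsq (z2 z) + logsq (z3 z)) / 2) * csqrt (z1 z * expi (- (logsq (z2 z) + logsq (z3 z)))).

Lemma worm_rootK z : worm_root z ^+ 2 = z1 z.
Proof.
rewrite /worm_root exprMn csqrtK expr2 -expiD mulrCA -expiD.
by rewrite (_ : _ + _ = 0) ?expi0 ?mulr1//; field.
Qed.

Variables (mu : R) (eta : R * R -> R).
Hypothesis We : worm_profile mu eta.

Lemma Weta_disc z : Weta eta z -> normc (z1 z - expi (logsq (z2 z) + logsq (z3 z))) < 1.
Proof.
move=> [[n2 n3]]; rewrite logsqM// => h; have [eta0 _ _ _] := We.
rewrite -(ltr_pXn2r (n := 2)) ?nnegrE ?normc_ge0// expr1n; apply: lt_le_trans h _.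
by rewrite gerBl.
Qed.

Lemma Weta_rotated z : Weta eta z ->
  0 < complex.Re (z1 z * expi (- (logsq (z2 z) + logsq (z3 z)))).
Proof.
move=> /Weta_disc; set s := logsq _ + logsq _ => h.
have : normc (z1 z * expi (- s) - 1) < 1.
  rewrite (_ : _ - 1 = (z1 z - expi s) * expi (- s)); last first.
    by rewrite mulrBl -expiD subrr expi0.
  by rewrite normcM normc_expi mulr1.
set u := _ * _; move=> /(le_lt_trans (normc_Re _)).
rewrite ltr_norml => /andP[+ _]; case: u => x y /=; lra.
Qed.

Lemma continuous_worm_root z : Weta eta z -> {for z, continuous worm_root}.
Proof.
move=> Oz; have Cz := Weta_sub Oz.
have cs : {for z, continuous (fun y : C3 => logsq (z2 y) + logsq (z3 y))}.
  exact: cvgD (continuous_logsq2 Cz) (continuous_logsq3 Cz).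
apply: (@continuousM _ _ (fun y : C3 => expi ((logsq (z2 y) + logsq (z3 y)) / 2))
  (fun y : C3 => csqrt (z1 y * expi (- (logsq (z2 y) + logsq (z3 y)))))).
  apply: (@continuous_comp _ _ _ (fun y : C3 => (logsq (z2 y) + logsq (z3 y)) / 2) (@expi R)).
    exact: cvgMl cs.
  exact: continuous_expi.
apply: (@continuous_comp _ _ _ (fun y : C3 => z1 y * expi (- (logsq (z2 y) + logsq (z3 y)))) csqrt).
  apply: (@continuousM _ _ (@z1 R)); first exact: continuous_z1.
  apply: (@continuous_comp _ _ _ (fun y : C3 => - (logsq (z2 y) + logsq (z3 y))) (@expi R)).
    exact: cvgN cs.
  exact: continuous_expi.
by apply: continuous_csqrt; exact: Weta_rotated.
Qed.

Lemma worm_root_neq0 z : Weta eta z -> worm_root z != 0.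
Proof.
move=> Oz; apply: contraTneq (Weta_rotated Oz) => E.
by rewrite -(worm_rootK z) E expr2 !mul0r ltxx.
Qed.

Lemma holomorphic_worm_root : holomorphic_on (Weta eta) worm_root.
Proof.
move=> z Oz; apply: differentiable_root.
- exact: continuous_worm_root.
- exact: worm_root_neq0.
- exact: worm_rootK.
Qed.

End square_root.

(** * The root is not approximable *)

Section proper_inclusion.
Variable R : realType.
Notation C := (CC R).
Notation C3 := (CC3 R).
Implicit Types (z p : C3) (e d t s : R) (u v w : C) (g G : C3 -> C).
Variables (mu : R) (eta : R * R -> R).
Hypothesis We : worm_profile mu eta.
Hypothesis hmu : 4 * pi < mu.

Lemma Weta_normc_z1 z : Weta eta z -> normc (z1 z) < 2.
Proof.
move=> /(Weta_disc We) h.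
have := lerB_normc (z1 z) (expi (logsq (z2 z) + logsq (z3 z))).
by rewrite normc_expi; move: h; set x := normc _; set y := normc _ => *; lra.
Qed.

Lemma Weta_bounded : exists2 K, 0 < K & forall z, Weta eta z ->
  [/\ normc (z1 z) < K, normc (z2 z) < K & normc (z3 z) < K].
Proof.
have [eta0 _ _ [M [_ HM]]] := We.
have HM1 := HM (M + 1) (ltr_pwDr ltr01 (lexx M)).
pose K := 2 + expR ((M + 1) / 2); exists K; first by rewrite ltr_pwDl// expR_ge0.
move=> z Oz; have [[n2 n3] ez] := Oz.
set t := (_, _) in ez.
have t01 : 0 <= eta t <= 1.
  rewrite eta0 /=; have := sqr_ge0 (normc (z1 z - expi (logsq (z2 z * z3 z)))).
  by move: ez; set x := normc _ ^+ 2 => *; lra.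
have : `|t| <= M + 1 := HM1 t t01; rewrite prod_normE ge_max => /andP[t2 t3].
have E0 := expR_gt0 ((M + 1) / 2).
have coord w : w != 0 -> `|logsq w| <= M + 1 -> normc w < K.
  move=> w0 /(le_trans (ler_norm _)) h; rewrite (normc_logsq w0) /K ltr_pwDl// ler_expR.
  by rewrite ler_pM2r.
split; [|exact: coord|exact: coord].
by apply: lt_trans (Weta_normc_z1 Oz) _; rewrite ltrDl.
Qed.

Lemma leb_Weta_fin : (leb R (@toC3 R @^-1` Weta eta) < +oo)%E.
Proof.
have [_ usc _ _] := We; have [K K0 HK] := Weta_bounded.
have K2 : 0 < 2 * K by rewrite mulr_gt0.
apply: (@le_lt_trans _ _ (leb R (cube (2 * K) 0 0 0 0 0 0))); last by rewrite leb_cube// ltry.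
apply: le_measure; rewrite ?inE.
- by apply: measurable_open_toC3; exact: open_Weta.
- exact: measurable_cube.
move=> [[[[[x1 y1] x2] y2] x3] y3] /HK[h1 h2 h3].
have I x : `|x| < K -> (`]0 - 2 * K / 2, 0 + 2 * K / 2[%classic : set R) x.
  rewrite ltr_norml => /andP[? ?]; rewrite /= in_itv /=; apply/andP; split; lra.
do 5 (split; last (apply: I; first [exact: le_lt_trans (normc_Im _) h3|
  exact: le_lt_trans (normc_Re _) h3|exact: le_lt_trans (normc_Im _) h2|
  exact: le_lt_trans (normc_Re _) h2|exact: le_lt_trans (normc_Im _) h1])).
by apply: I; exact: le_lt_trans (normc_Re _) h1.
Qed.

Lemma worm_root_A2 : A2 (Weta eta) (@worm_root R).
Proof.
have [_ usc _ _] := We; split; first exact: (holomorphic_worm_root We).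
have : (leb R).-integrable (@toC3 R @^-1` Weta eta) (EFin \o (fun x => normc (worm_root (toC3 x)) ^+ 2)).
  apply: measurable_bounded_integrable.
  - by apply: measurable_open_toC3; exact: open_Weta.
  - exact: leb_Weta_fin.
  - apply: (@measurable_continuous_toC3 R (Weta eta) (fun z => normc (worm_root z) ^+ 2)).
      exact: open_Weta.
    by move=> z Oz; apply: cvg_sqr; apply: cvg_normc; exact: (continuous_worm_root We).
  - exists 2; split; first exact: num_real.
    move=> M M2 x Ox /=; rewrite -normcX worm_rootK ger0_norm ?normc_ge0//.
    exact: le_trans (ltW (Weta_normc_z1 Ox)) (ltW M2).
exact.
Qed.

(* The bound 4 pi < mu makes this index admissible. *)
Let a : R := - pi.

Let block_a : block_index mu a.
Proof.
rewrite /block_index /a; move: hmu (@pi_gt0 R); generalize (@pi R) => p p4 p0.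
by apply/andP; split; lra.
Qed.

Let x3 : C := (inner_radius a)%:C%C.

Let normc_x3 : normc x3 = inner_radius a.
Proof. by rewrite normc_real ger0_norm// expR_ge0. Qed.

Let corner_in u w : normc (u - expi (2 * a)) < 1 ->
  corner_radius (inner_radius a) (outer_radius a) (normc w) -> Weta eta ((u, w, x3) : C3).
Proof.
move=> ua kw.
have l1 : a < logsq (1 : C) < a + 2 * pi.
  rewrite /logsq normc1 expr1n ln1 /a; move: (@pi_gt0 R); generalize (@pi R) => p p0.
  by apply/andP; split; lra.
have V : extra_block a ((u, 1, 1) : C3) by split => //; split; exact: oner_neq0.
by apply: (block_corner We block_a V kw); rewrite normc_x3; left.
Qed.

Let slice_mean g (r : R) z : C := cmean (fun w => g ((z1 z, w, x3) : C3)) 0 r.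

Let differentiable_slice_mean G r u : holomorphic_past_closure (Weta eta) G -> corner_radius (inner_radius a) (outer_radius a) r ->
  normc (u - expi (2 * a)) < 1 -> differentiable (slice_mean G r) ((u, 0, 0) : C3).
Proof.
move=> pG kr ua; have r0 : 0 <= r by case: kr => ->; exact: expR_ge0.
have hG := past_closure_holomorphic pG.
apply: (@differentiable_cmean R (fun z w => G ((z1 z, w, x3) : C3))).
have cn : {for ((u, 0, 0) : C3), continuous (fun y : C3 => normc (z1 y - expi (2 * a)))}.
  by apply: cvg_normc; apply: (cvgB (@continuous_z1 R _) (cvg_cst _)).
apply: filterS (cvgr_lt _ cn _ ua) => z zu t.
have dG : differentiable G ((z1 z, circ 0 r t, x3) : C3).
  by apply: hG; apply: corner_in => //; rewrite normc_circ0.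
split; last first.
  exact: (@differentiable_comp3 _ G (@z1 R) (fun=> circ 0 r t) (fun=> x3) z
    (differentiable_z1 z) (differentiable_cst _ _) (differentiable_cst _ _) dG).
have c1 : {for (z, t), continuous (fun y : C3 * R => z1 y.1)}.
  exact: (@continuous_comp _ _ _ fst (@z1 R) (z, t) cvg_fst (@continuous_z1 R z)).
have c2 : {for (z, t), continuous (fun y : C3 * R => circ (0 : C) r y.2)}.
  exact: (@continuous_comp _ _ _ snd (circ 0 r) (z, t) cvg_snd (@continuous_circ1 R 0 r t)).
have c3 : {for (z, t), continuous (fun y : C3 * R => x3)} by exact: cvg_cst.
have ct := continuous_triple c1 c2 c3.
pose k (y : C3 * R) : C3 := (z1 y.1, circ 0 r y.2, x3).
have cG : {for k (z, t), continuous G} by exact: differentiable3_continuous.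
exact: (@continuous_comp _ _ _ k G (z, t) ct cG).
Qed.

(** Near the origin of the first variable the circle can be moved across the annulus; the means
then agree on the whole disc. *)
Let slice_mean_eq G u : holomorphic_past_closure (Weta eta) G -> normc (u - expi (2 * a)) < 1 ->
  slice_mean G (inner_radius a) ((u, 0, 0) : C3) = slice_mean G (outer_radius a) ((u, 0, 0) : C3).
Proof.
move=> pG ua; have [U [oU OU hG]] := pG.
have axis v2 v3 : inner_radius a <= normc v2 <= outer_radius a ->
    inner_radius a <= normc v3 <= outer_radius a -> U ((0, v2, v3) : C3).
  move=> /logsq_annulus[n2 l2] /logsq_annulus[n3 l3]; apply: OU.
  by apply: (closure_Weta We) => //; exact: (block_square block_a).
have [d d0 Hd] := tube_annuli oU axis.
have io := ltW (inner_lt_outer a).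
have ci : corner_radius (inner_radius a) (outer_radius a) (inner_radius a) by left.
have co : corner_radius (inner_radius a) (outer_radius a) (outer_radius a) by right.
apply: (@identity_lens R (fun u => slice_mean G (inner_radius a) ((u, 0, 0) : C3))
  (fun u => slice_mean G (outer_radius a) ((u, 0, 0) : C3)) (expi (2 * a)) (expi (2 * a)) d u).
- exact: normc_expi.
- exact: normc_expi.
- by [].
- by move=> v v1; apply: differentiable_slice1; exact: differentiable_slice_mean.
- by move=> v v1; apply: differentiable_slice1; exact: differentiable_slice_mean.
- move=> v vd _ _; apply: cmean_const_open; [exact: expR_gt0|exact: io|].
  move=> w; rewrite subr0 => hw; apply: differentiable_slice2; apply: hG.
  by apply: Hd => //; rewrite normc_x3 lexx io.
- by [].
- by [].
Qed.

Let worm_root_inner w : normc w = inner_radius a ->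
  worm_root ((expi (2 * a), w, x3) : C3) = expi a * csqrt 1.
Proof.
move=> /logsq_normc lw; rewrite /worm_root /z1 /z2 /z3 /= lw (logsq_normc normc_x3).
by rewrite (_ : a + a = 2 * a) -?expiD ?subrr ?expi0; [congr (expi _ * _); field|ring].
Qed.

Let worm_root_outer w : normc w = outer_radius a ->
  worm_root ((expi (2 * a), w, x3) : C3) = - (expi a * csqrt 1).
Proof.
move=> /logsq_normc lw; rewrite /worm_root /z1 /z2 /z3 /= lw (logsq_normc normc_x3).
have -> : expi (2 * a) * expi (- (a + 2 * pi + a)) = 1 :> C.
  by rewrite -expiD (_ : _ - _ = - (2 * pi)) ?expiN ?expi2pi ?invr1//; ring.
have -> : (a + 2 * pi + a) / 2 = a + pi by field.
rewrite expiD (_ : expi pi = -1 :> C); last first.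
  by rewrite /expi cospi sinpi; apply/eqP; rewrite eq_complex /= oppr0 !eqxx.
by rewrite mulrN1 mulNr.
Qed.

(** On the two circles the root is constant with opposite values, whereas the means of its
approximants over them coincide. *)
Theorem worm_root_not_A2bar : ~ A2bar (Weta eta) (@worm_root R).
Proof.
move=> qA; have [_ usc _ _] := We.
have [G [pG Gq]] := A2bar_torus_limit (open_Weta usc) (@torus_invariant_Weta R eta)
  (@Weta_sub R eta) qA.
set xi : C := expi (2 * a); set sigma : C := expi a * csqrt 1.
have xi1 : normc (xi - expi (2 * a)) < 1 by rewrite subrr normc0.
have ci : corner_radius (inner_radius a) (outer_radius a) (inner_radius a) by left.
have co : corner_radius (inner_radius a) (outer_radius a) (outer_radius a) by right.
have near_mean r tau : corner_radius (inner_radius a) (outer_radius a) r ->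
    (forall w, normc w = r -> worm_root ((xi, w, x3) : C3) = tau) ->
    \forall n \near \oo, normc (tau - slice_mean (G n) r ((xi, 0, 0) : C3)) <= 1 / 2.
  move=> kr Er; have r0 : 0 <= r by case: kr => ->; exact: expR_ge0.
  have nr : normc (r%:C%C : C) = r by rewrite normc_real ger0_norm.
  have Op : Weta eta ((xi, r%:C%C, x3) : C3) by apply: corner_in; rewrite ?nr.
  have h0 : 0 < 1 / 2 :> R by rewrite divr_gt0.
  apply: filterS (Gq _ Op _ h0) => n Hn.
  have cG t : {for t, continuous (fun t => (fun w => G n ((xi, w, x3) : C3)) (circ 0 r t))}.
    have dG : differentiable (G n) ((xi, circ 0 r t, x3) : C3).
      by apply: (past_closure_holomorphic (pG n)); apply: corner_in => //; rewrite normc_circ0.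
    have c1 : {for t, continuous (fun _ : R => xi)} by exact: cvg_cst.
    have c3 : {for t, continuous (fun _ : R => x3)} by exact: cvg_cst.
    have ct := continuous_triple c1 (@continuous_circ1 R 0 r t) c3.
    exact: (@continuous_comp _ _ _ _ (G n) t ct (differentiable3_continuous dG)).
  have ccst t : {for t, continuous (fun t : R => (fun _ : C => tau) (circ 0 r t))}.
    exact: cvg_cst.
  rewrite -[X in X - _](cmean_cst tau 0 r) /slice_mean -cmeanB_circ; [|exact: ccst|exact: cG].
  apply: le_cmean_cont; first by move=> t _; exact: (cvgB (ccst t) (cG t)).
  move=> t _; rewrite -(Er (circ 0 r t)); last by rewrite normc_circ0.
  apply: Hn; split=> //.
  by change (normc (circ 0 r t : C) = normc (r%:C%C : C)); rewrite nr normc_circ0.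
have [n [H1 H2]] := @filter_ex _ \oo _ _ (filterI (near_mean _ _ ci worm_root_inner) (near_mean _ _ co worm_root_outer)).
move: H1 H2; rewrite (slice_mean_eq (pG n) xi1) -/sigma; set m := slice_mean _ _ _ => H1 H2.
have s1 : normc sigma = 1.
  have : normc (csqrt (1 : C)) ^+ 2 = 1 by rewrite -normcX csqrtK normc1.
  move/eqP; rewrite sqrf_eq1 => /orP[/eqP|/eqP] E; first by rewrite /sigma normcM normc_expi E mulr1.
  by have := normc_ge0 (csqrt (1 : C)); rewrite E oppr_ge0 ler10.
have : normc (sigma - - sigma) <= 1.
  apply: le_trans (ler_distcD m _ _) _; rewrite [normc (m - _)]normcB.
  by move: H1 H2; set x := normc _; set y := normc _; lra.
rewrite opprK -mulr2n -mulr_natl normcM s1 mulr1 (_ : normc _ = 2); first by lra.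
by rewrite (_ : (2 : C) = (2 : R)%:C%C) ?normc_real ?ger0_norm// rmorph_nat.
Qed.

Theorem A2bar_proper : A2bar (Weta eta) `<` A2 (Weta eta).
Proof.
split; first by move=> f [].
by move=> /(_ _ worm_root_A2); exact: worm_root_not_A2bar.
Qed.

End proper_inclusion.

(** * Worm domains of the class *)

Lemma class_C_profile (R : realType) (mu : R) (Omega : set (CC3 R)) : class_C mu Omega ->
  exists2 eta, worm_profile mu eta & Omega = Weta eta.
Proof.
move=> [eta [eta0 [usc [etas [_ [_ [_ [bd _]]]]]]] <-]; exists eta => //.
Qed.

Theorem theorem4p5 (R : realType) (mu : R) (hmu : 4 * pi < mu) :
  ((forall f : CC3 R -> CC R, A2bar (Wprime mu) f ->
      holomorphically_extends (Wprime mu) f (hat mu (Wprime mu))) /\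
   A2bar (Wprime mu) `<` A2 (Wprime mu)) /\
  (forall Omega : set (CC3 R), class_C mu Omega ->
    (forall f : CC3 R -> CC R, A2bar Omega f ->
      holomorphically_extends Omega f (hat mu Omega)) /\
    A2bar Omega `<` A2 Omega).
Proof.
have profile_case eta : worm_profile mu eta ->
    (forall f : CC3 R -> CC R, A2bar (Weta eta) f ->
      holomorphically_extends (Weta eta) f (hat mu (Weta eta))) /\
    A2bar (Weta eta) `<` A2 (Weta eta).
  by move=> We; split; [exact: (A2bar_extends We)|exact: (A2bar_proper We hmu)].
split; first by rewrite Wprime_Weta; exact: profile_case (square_profileP mu).
by move=> Omega /class_C_profile[eta We ->]; exact: profile_case.
Qed.
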